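(* Let $\phi=\phi(x)$, $x\in\mathbb{R}$, be a smooth compactly supported function and let $\xi$ be a standard Gaussian random variable. Then the equation $$u_t+u\diamond u_x=u_{xx},\qquad 0<t\le T,\ x\in\mathbb{R},$$ with initial condition $u(0,x)=\xi\,\phi(x)$, cannot have a solution that is an element of $(\mathcal{S})_{-\rho,-\ell}\big(L_2((0,T);H^2(\mathbb{R}))\big)$ for some $0\le\rho<1$ and $\ell>0$. (That is, there is no pair $(\rho,\ell)$ with $0\le\rho<1$ and $\ell>0$ for which a solution belonging to this space exists.)
   Context: Throughout, $0<T<\infty$ is non-random, $\diamond$ is the Wick product, and ''solution'' means strong chaos solution; all are defined below. **Chaos space.** Fix a probability space $(\Omega,\mathcal{F},\mathbb{P})$ and a sequence $\boldsymbol{\xi}=(\xi_1,\xi_2,\ldots)$ of iid standard Gaussian random variables such that $\mathcal{F}$ is generated by $\boldsymbol{\xi}$. The random variable $\xi$ in the initial condition is understood as a member of this family, say $\xi=\xi_1$. Also fix a separable Hilbert space $H$ and an unbounded self-adjoint positive-definite operator $Q$ on $H$ with pure point spectrum, whose eigenfunctions form an orthonormal basis of $H$ and whose eigenvalues $\mathfrak{q}=(q_1,q_2,\ldots)$ satisfy $1<q_1\le q_2\le\cdots$ and $\sum_k 1/q_k<1$. (Only the numbers $q_k$ enter below, as weights.) **Multi-indices.** $\mathcal{J}$ is the set of sequences $\boldsymbol{\alpha}=(\alpha_1,\alpha_2,\ldots)$ of non-negative integers with only finitely many non-zero entries; $\boldsymbol{(0)}$ is the zero multi-index; $\boldsymbol{\alpha}!=\prod_k\alpha_k!$;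 and $\boldsymbol{z}^{\boldsymbol{\alpha}}=\prod_k z_k^{\alpha_k}$, $\boldsymbol{z}^{r\boldsymbol{\alpha}}=(\boldsymbol{z}^{\boldsymbol{\alpha}})^r$ for a sequence $\boldsymbol{z}=(z_1,z_2,\ldots)$. Set $\xi_{\boldsymbol{\alpha}}=\frac{1}{\sqrt{\boldsymbol{\alpha}!}}\prod_k \mathrm{H}_{\alpha_k}(\xi_k)$, with $\mathrm{H}_n(x)=(-1)^ne^{x^2/2}\frac{d^n}{dx^n}e^{-x^2/2}$. For a (complex) Hilbert space $V$, $\mathbb{L}_2(\boldsymbol{\xi};V)$ is the space of square-integrable $V$-valued functions $\Phi$ of $\boldsymbol{\xi}$; each has the expansion $\Phi=\sum_{\boldsymbol{\alpha}\in\mathcal{J}}\Phi_{\boldsymbol{\alpha}}\xi_{\boldsymbol{\alpha}}$ with $\Phi_{\boldsymbol{\alpha}}=\mathbb{E}(\Phi\xi_{\boldsymbol{\alpha}})\in V$. **Spaces.** For $\rho\in[0,1]$, $\ell\ge0$: $(\mathcal{S})_{\rho,\ell}(V)$ is the set of $\Phi\in\mathbb{L}_2(\boldsymbol{\xi};V)$ with $\sum_{\boldsymbol{\alpha}}(\boldsymbol{\alpha}!)^{\rho}\mathfrak{q}^{\ell\boldsymbol{\alpha}}\|\Phi_{\boldsymbol{\alpha}}\|_V^2<\infty$; $(\mathcal{S})_{-\rho,-\ell}(V)$ is the closure (completion) of $\mathbb{L}_2(\boldsymbol{\xi};V)$ in the norm $\|\Phi\|^2_{-\rho,-\ell;V}=\sum_{\boldsymbol{\alpha}}(\boldsymbol{\alpha}!)^{-\rho}\mathfrak{q}^{-\ell\boldsymbol{\alpha}}\|\Phi_{\boldsymbol{\alpha}}\|_V^2$,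 so its elements are formal series $\sum_{\boldsymbol{\alpha}}\Phi_{\boldsymbol{\alpha}}\xi_{\boldsymbol{\alpha}}$ with finite norm. $(\mathcal{S})_{-\rho}(V)$ is the union (inductive limit) of $(\mathcal{S})_{-\rho,-\ell}(V)$ over non-negative integers $\ell$. **$S$-transform and Wick product.** The $S$-transform of $\Phi=\sum_{\boldsymbol{\alpha}}\Phi_{\boldsymbol{\alpha}}\xi_{\boldsymbol{\alpha}}\in(\mathcal{S})_{-\rho,-\ell}(V)$ is $\widetilde{\Phi}(\boldsymbol{z})=\sum_{\boldsymbol{\alpha}}\frac{\Phi_{\boldsymbol{\alpha}}}{\sqrt{\boldsymbol{\alpha}!}}\boldsymbol{z}^{\boldsymbol{\alpha}}$, defined for complex sequences $\boldsymbol{z}$ such that $\mathcal{E}(\boldsymbol{z})=\sum_{\boldsymbol{\alpha}}\frac{\boldsymbol{z}^{\boldsymbol{\alpha}}}{\sqrt{\boldsymbol{\alpha}!}}\xi_{\boldsymbol{\alpha}}$ is in $(\mathcal{S})_{\rho,\ell}(\mathbb{C})$. The Wick product $\Phi\diamond\Psi$ is characterized by $\widetilde{\Phi\diamond\Psi}=\widetilde{\Phi}\,\widetilde{\Psi}$. For $0<R,\ell<\infty$ let $\mathbb{K}_\ell(R)=\{\boldsymbol{z}:\ \sum_{\boldsymbol{\alpha}\ne\boldsymbol{(0)}}\mathfrak{q}^{\ell\boldsymbol{\alpha}}|\boldsymbol{z}^{\boldsymbol{\alpha}}|^2<R^2\}$. **Strong chaos solution.** $H^\gamma(\mathbb{R})$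 are the $L_2$-based Sobolev spaces. A process $u\in(\mathcal{S})_{-1}\big(L_2((0,T);H^2(\mathbb{R}))\big)$ is a strong chaos solution of $u_t+u\diamond u_x=u_{xx}$ with initial condition $u(0,x)$ if there exist $0<R,\ell<\infty$ such that, for all $\boldsymbol{z}\in\mathbb{K}_\ell(R)$ and all $t\in[0,T]$, the equality $$\widetilde{u}(t,x;\boldsymbol{z})+\int_0^t\widetilde{u}(s,x;\boldsymbol{z})\widetilde{u}_x(s,x;\boldsymbol{z})\,ds=\widetilde{u}(0,x;\boldsymbol{z})+\int_0^t\widetilde{u}_{xx}(s,x;\boldsymbol{z})\,ds$$ holds in $L_2(\mathbb{R})$. Since only one random variable $\xi$ is involved, there is only one complex parameter $z$, and $\widetilde{u}(0,x;z)=z\phi(x)$.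
   Formalization: The function φ is additionally assumed not identically zero, since for φ = 0 the zero process is a solution belonging to every one of these spaces. *)

(* Defs.v *)
From HB Require Import structures.
From mathcomp Require Import all_boot all_order all_algebra finmap.
From mathcomp Require Import complex.
From mathcomp Require Import all_classical all_reals all_analysis.
Set Implicit Arguments.
Unset Strict Implicit.
Unset Printing Implicit Defensive.
Import Order.TTheory GRing.Theory Num.Theory.
Import numFieldNormedType.Exports.
Local Open Scope classical_set_scope.
Local Open Scope ring_scope.
Local Open Scope complex_scope.

Section ComplexFunctions.
Context {R : realType}.
Implicit Types (z : R[i]).

Definition sqmod z : R := complex.Re z ^+ 2 + complex.Im z ^+ 2.

Definition cmeasurable_fun d (X : measurableType d) (D : set X)
    (f : X -> R[i]) : Prop :=
  measurable_fun D (fun x => complex.Re (f x)) /\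
  measurable_fun D (fun x => complex.Im (f x)).

Definition cintegral d (X : measurableType d)
    (mu : {measure set X -> \bar R}) (D : set X) (f : X -> R[i]) : R[i] :=
  (\int[mu]_(x in D) complex.Re (f x)) +i*
  (\int[mu]_(x in D) complex.Im (f x)).

Definition smooth_compact_support (f : R -> R) : Prop :=
  (forall (n : nat) (x : R), derivable (derive1n n f) x 1) /\
  compact (closure [set x | f x != 0]).

Definition csmooth_compact_support (f : R -> R[i]) : Prop :=
  smooth_compact_support (fun x => complex.Re (f x)) /\
  smooth_compact_support (fun x => complex.Im (f x)).

Definition weak_derivative (f g : R -> R[i]) : Prop :=
  forall psi : R -> R, smooth_compact_support psi ->
    cintegral lebesgue_measure [set: R] (fun x => f x * (derive1 psi x)%:C) =
    - cintegral lebesgue_measure [set: R] (fun x => g x * (psi x)%:C).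

End ComplexFunctions.

(* A Hilbert space of (classes of) complex functions on X, given by its
   representatives and its squared norm. *)
Record function_space (R : realType) (X : Type) := FunctionSpace {
  members : set (X -> R[i]);
  sqnorm : (X -> R[i]) -> \bar R }.

Section HilbertSpaces.
Context {R : realType}.

Definition scalars : function_space R unit :=
  FunctionSpace setT (fun c => (sqmod (c tt))%:E).

Definition L2_sqnorm (f : R -> R[i]) : \bar R :=
  (\int[lebesgue_measure]_x (sqmod (f x))%:E)%E.

Definition L2R : function_space R R :=
  FunctionSpace
    [set f | cmeasurable_fun [set: R] f /\ (L2_sqnorm f < +oo)%E]
    L2_sqnorm.

Definition L2_eq (f g : R -> R[i]) : Prop :=
  [/\ members L2R f, members L2R g &
      {ae lebesgue_measure, forall x, f x = g x}].

(* An element f of L_2((0,T); H^2(R)) is carried by a jet F, where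
   F (k, (t, x)) represents the k-th weak x-derivative of f at (t, x), k <= 2.
   Values at t outside ]0, T[ do not matter for membership nor for the norm. *)
Definition jet_point : Type := 'I_3 * (R * R).

Definition L2H2_sqnorm (T : R) (F : jet_point -> R[i]) : \bar R :=
  (\sum_(k < 3) \int[lebesgue_measure]_(t in `]0%R, T[)
                  L2_sqnorm (fun x => F (k, (t, x))))%E.

Definition L2H2 (T : R) : function_space R jet_point :=
  FunctionSpace
    [set F | [/\ forall k : 'I_3,
                   cmeasurable_fun (`]0, T[ `*` [set: R]) (fun p => F (k, p)),
                 {ae lebesgue_measure, forall t, t \in `]0, T[ ->
                   weak_derivative (fun x => F (0, (t, x)))
                                   (fun x => F (1, (t, x))) /\
                   weak_derivative (fun x => F (1, (t, x)))
                                   (fun x => F (2%R, (t, x)))} &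
                 (L2H2_sqnorm T F < +oo)%E]]
    (L2H2_sqnorm T).

End HilbertSpaces.

(* Multi-indices; positions are numbered from 0 instead of 1. *)
Definition mindex : Type := {fsfun nat -> nat with 0%N}.

Definition mfact (a : mindex) : nat := (\prod_(k <- finsupp a) (a k)`!)%N.

Definition mpow (A : comPzRingType) (z : nat -> A) (a : mindex) : A :=
  \prod_(k <- finsupp a) z k ^+ a k.

Section ChaosSpaces.
Context {R : realType}.

Definition weight_sequence (q : nat -> R) : Prop :=
  [/\ 1 < q 0%N, {homo q : m n / (m <= n)%N >-> m <= n} &
      (\sum_(0 <= k <oo) (q k)^-1%:E < 1)%E].

(* A formal series sum_a (u a) xi_a is identified with its coefficients u.
   For rho, l >= 0 this is (S)_{rho,l}(V); (S)_{-rho,-l}(V) is obtained with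
   the opposite exponents. *)
Definition chaos_space (q : nat -> R) (rho l : R) X (V : function_space R X)
    : set (mindex -> X -> R[i]) :=
  [set u | (forall a, members V (u a)) /\
    (\esum_(a in [set: mindex])
       (((mfact a)%:R `^ rho * mpow q a `^ l)%:E * sqnorm V (u a)) < +oo)%E].

Definition normalized_mpow (z : nat -> R[i]) (a : mindex) : R[i] :=
  mpow z a / (Num.sqrt (mfact a)%:R)%:C.

Definition stochastic_exponential (z : nat -> R[i]) : mindex -> unit -> R[i] :=
  fun a _ => normalized_mpow z a.

(* F is (a representative of) the value at z of the S-transform of an element
   u of (S)_{-rho,-l}(V); the series over the multi-indices converges
   unconditionally in V. *)
Definition is_S_transform (q : nat -> R) (rho l : R) X
    (V : function_space R X) (u : mindex -> X -> R[i]) (z : nat -> R[i])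
    (F : X -> R[i]) : Prop :=
  [/\ chaos_space q (- rho) (- l) V u,
      chaos_space q rho l scalars (stochastic_exponential z),
      members V F &
      forall e : R, 0 < e -> exists A0 : {fset mindex},
        forall A : {fset mindex}, (A0 `<=` A)%fset ->
          (sqnorm V (fun p => (F p
             - \sum_(a <- A) normalized_mpow z a * u a p)%R) < e%:E)%E].

Definition K_set (q : nat -> R) (l r : R) : set (nat -> R[i]) :=
  [set z | (\esum_(a in [set a : mindex | a != [fsfun]])
              (mpow q a `^ l * sqmod (mpow z a))%:E < (r ^+ 2)%:E)%E].

(* u is a strong chaos solution of u_t + u <> u_x = u_xx on [0, T] with initial
   condition the formal series u0. Among the representatives of the S-transform
   of u at z, F is the one for which the equality holds at every t. *)
Definition strong_chaos_solution (q : nat -> R) (T : R)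
    (u0 : mindex -> R -> R[i]) (u : mindex -> jet_point -> R[i]) : Prop :=
  exists l0 : nat, chaos_space q (- 1) (- l0%:R) (L2H2 T) u /\
  exists r l : R, [/\ 0 < r, 0 < l &
    forall z, K_set q l r z -> exists (F : jet_point -> R[i]) (F0 : R -> R[i]),
      [/\ is_S_transform q 1 l0%:R (L2H2 T) u z F,
          is_S_transform q 1 l0%:R L2R u0 z F0 &
          forall t : R, 0 <= t <= T ->
            L2_eq (fun x => F (0, (t, x)) +
                     cintegral lebesgue_measure `[0, t]
                       (fun s => F (0, (s, x)) * F (1, (s, x))))
                  (fun x => F0 x +
                     cintegral lebesgue_measure `[0, t]
                       (fun s => F (2%R, (s, x))))]].

Section GaussianChaos.
Context d (Omega : measurableType d) (P : probability Omega R).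

Definition hermite (n : nat) (x : R) : R :=
  (- 1) ^+ n * expR (x ^+ 2 / 2) * derive1n n (fun y : R => expR (- (y ^+ 2) / 2)) x.

Definition mutually_independent (xi : nat -> {RV P >-> R}) : Prop :=
  forall (A : {fset nat}) (B : nat -> set R),
    (forall k, measurable (B k)) ->
    P (\bigcap_(k in [set` A]) (xi k @^-1` B k)) =
    (\prod_(k <- A) P (xi k @^-1` B k))%E.

Definition iid_standard_gaussian (xi : nat -> {RV P >-> R}) : Prop :=
  mutually_independent xi /\
  forall (k : nat) (B : set R), measurable B ->
    distribution P (xi k) B = normal_prob 0 1 B.

Definition generating (xi : nat -> {RV P >-> R}) : Prop :=
  @measurable d Omega =
  <<s [set A | exists k (B : set R), measurable B /\ A = xi k @^-1` B] >>.

Definition xi_basis (xi : nat -> {RV P >-> R}) (a : mindex) (w : Omega) : R :=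
  (\prod_(k <- finsupp a) hermite (a k) (xi k w)) / Num.sqrt (mfact a)%:R.

Definition chaos_coef (xi : nat -> {RV P >-> R}) X (Phi : Omega -> X -> R[i])
    (a : mindex) (p : X) : R[i] :=
  cintegral P [set: Omega] (fun w => Phi w p * (xi_basis xi a w)%:C).

End GaussianChaos.
End ChaosSpaces.

(* Main.v *)
Require Import Defs.
From HB Require Import structures.
From mathcomp Require Import all_boot all_order all_algebra finmap.
From mathcomp Require Import complex.
From mathcomp Require Import all_classical all_reals all_analysis.
From mathcomp Require Import measurable_realfun ring lra zify.
Import Order.TTheory GRing.Theory Num.Theory.
Import numFieldNormedType.Exports.
Local Open Scope classical_set_scope.
Local Open Scope ring_scope.
Set Implicit Arguments.
Unset Strict Implicit.
Unset Printing Implicit Defensive.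

(** The Wick equation becomes, after the S-transform, a family of viscous Burgers
equations W_t + W W_x = W_xx with W(0) = z phi, one for every admissible complex
sequence; here only sequences (z, 0, 0, ...) are used, and W = sum_n z^n w_n
with w_n = u_(n,0,0,...) / sqrt n!.

Membership in (S)_{-rho,-l} with rho < 1 makes this power series entire: the
square norm of u_(n,0,0,...) may grow at most like (n!)^rho Q^n, and dividing by
n! leaves (n!)^-(1 - rho) (lemma strip_coef_majorized). So the proof is a
Liouville argument in z. Set
  g_n(t, x) = [n = 1] Phi(x) + int_0^t (w_n' - (1/2) sum_{i+j=n} w_i w_j) ds,
where Phi is a primitive of phi. The equation, known for small z only, says
that the x-derivative of sum_n z^n g_n is W; evaluating it along real z tending
to 0 gives g_n' = w_n for each n (heights_from_sums), and therefore the same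
relation for the entire sums G = sum_n z^n g_n at every complex z.

This G is the Cole-Hopf potential: G_t = G_xx - (G_x)^2 / 2. For complex z the
function E = exp(- Re G) satisfies
  E_t - E_xx = - (1/2) |G_x|^2 E <= 0,
so its integral against a positive weight w with |w'| <= C w grows at most like
exp(C^2 t / 2) (slice_inequality, evolution). Since - s <= M + exp(- s - M), this
bounds - int Re G(t, x) w(x) dx by a function of the form A |z| + B (exp_energy,
moment_bound). An entire function whose real part is bounded below in this way
is affine (second_coefficient), hence int g_2(t, x) w(x) dx = 0 for all such
weights; perturbing the weight by a test function yields g_2 = 0, and so
w_2 = g_2' = 0. The definition of g_2 now reads int_0^t w_1^2 ds = 0, so w_1 = 0.
Then g_1 = Phi, while g_1' = w_1 = 0: Phi is constant and phi = 0.

The weak derivatives that occur belong to functions that are only locally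
integrable, and are turned into classical ones by the du Bois-Reymond lemma. Its
smooth kernels are built from any nonzero test function (has_bump); phi itself
provides one. *)

(** * Real-valued integrals *)

Section RealIntegral.
Context d (X : measurableType d) (R : realType) (mu : {measure set X -> \bar R}).
Implicit Types (D : set X) (f g : X -> R).

Lemma ae_eq_Rintegral D f g : measurable D ->
  measurable_fun D f -> measurable_fun D g ->
  {ae mu, forall x, D x -> f x = g x} ->
  \int[mu]_(x in D) f x = \int[mu]_(x in D) g x.
Proof.
move=> mD mf mg fg; congr fine; apply: ae_eq_integral => //.
- exact/measurable_EFinP.
- exact/measurable_EFinP.
- by apply: filterS fg => x /= fg Dx; rewrite fg.
Qed.

Lemma le_integrableR D f g : measurable D -> measurable_fun D f ->
  (forall x, D x -> `|f x| <= g x) -> mu.-integrable D (EFin \o g) ->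
  mu.-integrable D (EFin \o f).
Proof.
move=> mD mf fg; apply: le_integrable => //; first exact/measurable_EFinP.
move=> x Dx /=; rewrite lee_fin; apply: le_trans (fg _ Dx) _.
exact: ler_norm.
Qed.

Lemma ae_le_integrableR D f g : measurable D -> measurable_fun D f ->
  {ae mu, forall x, D x -> `|f x| <= g x} -> mu.-integrable D (EFin \o g) ->
  mu.-integrable D (EFin \o f).
Proof.
move=> mD mf fg /integrableP[/measurable_EFinP mg ig]; apply/integrableP; split.
  exact/measurable_EFinP.
apply: le_lt_trans ig; apply: ae_ge0_le_integral => //.
- by apply/measurableT_comp => //; exact/measurable_EFinP.
- by apply/measurableT_comp => //; exact/measurable_EFinP.
- apply: filterS fg => x /= fg Dx; rewrite lee_fin (le_trans (fg Dx))//.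
  exact: ler_norm.
Qed.

Lemma integrable_EFinD D f g : measurable D -> mu.-integrable D (EFin \o f) ->
  mu.-integrable D (EFin \o g) ->
  mu.-integrable D (EFin \o (fun x => f x + g x)).
Proof. by move=> mD fi gi; exact: (integrableD mD fi gi). Qed.

Lemma integrable_EFinN D f : measurable D -> mu.-integrable D (EFin \o f) ->
  mu.-integrable D (EFin \o (fun x => - f x)).
Proof. by move=> mD fi; exact: (integrableN fi). Qed.

Lemma integrable_EFinB D f g : measurable D -> mu.-integrable D (EFin \o f) ->
  mu.-integrable D (EFin \o g) ->
  mu.-integrable D (EFin \o (fun x => f x - g x)).
Proof. by move=> mD fi gi; apply: eq_integrable (integrableB mD fi gi) => // x _. Qed.

Lemma integrable_EFinZ D (k : R) f : measurable D ->
  mu.-integrable D (EFin \o f) ->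
  mu.-integrable D (EFin \o (fun x => k * f x)).
Proof. by move=> mD fi; apply: eq_integrable (integrableZl mD k fi) => // x _. Qed.

Lemma integrable_measurable D f : mu.-integrable D (EFin \o f) ->
  measurable_fun D f.
Proof. by move=> /integrableP[/measurable_EFinP]. Qed.

Lemma integrable_boundedM D f g (C : R) : measurable D ->
  measurable_fun D f -> (forall x, D x -> `|f x| <= C) ->
  mu.-integrable D (EFin \o g) ->
  mu.-integrable D (EFin \o (fun x => f x * g x)).
Proof.
move=> mD mf fC gi; have mg := integrable_measurable gi.
apply: (@le_integrableR _ _ (fun x => C * `|g x|)) => //.
- exact: measurable_funM.
- by move=> x Dx; rewrite normrM ler_wpM2r// fC.
- by apply: integrable_EFinZ => //; exact: integrable_norm.
Qed.

Lemma ge0_le_RintegralS D E f : measurable D -> measurable E -> D `<=` E ->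
  (forall x, 0 <= f x) -> mu.-integrable E (EFin \o f) ->
  \int[mu]_(x in D) f x <= \int[mu]_(x in E) f x.
Proof.
move=> mD mE DE f0 fi; rewrite /Rintegral fine_le//.
- by apply: integrable_fin_num => //; exact: integrableS fi.
- exact: integrable_fin_num.
- apply: ge0_subset_integral => //; first by case/integrableP : fi.
  by move=> x _; rewrite lee_fin.
Qed.

Lemma Rintegral_dominated (f_ : nat -> X -> R) f g D : measurable D ->
  (forall n, measurable_fun D (f_ n)) ->
  (forall x, D x -> f_ ^~ x @ \oo --> f x) ->
  mu.-integrable D (EFin \o g) ->
  (forall n x, D x -> `|f_ n x| <= g x) ->
  mu.-integrable D (EFin \o f) /\
  (fun n => \int[mu]_(x in D) f_ n x) @ \oo --> \int[mu]_(x in D) f x.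
Proof.
move=> mD mf cf gi fg.
have mfl : measurable_fun D f by apply: measurable_fun_cvg mf cf.
have := @dominated_convergence _ _ _ mu D mD (fun n => EFin \o f_ n)
  (EFin \o f) (EFin \o g).
case.
- by move=> n; exact/measurable_EFinP.
- exact/measurable_EFinP.
- by apply: aeW => x Dx; apply/fine_cvgP; split; [exact: nearW|exact: cf].
- exact: gi.
- by apply: aeW => x n Dx; rewrite lee_fin fg.
move=> fi _ cfi; split => //.
apply/fine_cvg.
by rewrite /Rintegral fineK// integrable_fin_num.
Qed.

End RealIntegral.

Section RealIntegralEq.
Context d (X : measurableType d) (R : realType) (mu : {measure set X -> \bar R}).
Implicit Types (D : set X) (f g : X -> R).

Lemma Rintegral_congr D f g : (forall x, D x -> f x = g x) ->
  \int[mu]_(x in D) f x = \int[mu]_(x in D) g x.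
Proof. by move=> fg; apply: eq_Rintegral => x /set_mem; exact: fg. Qed.

Lemma Rintegral_eq0 D f : (forall x, D x -> f x = 0) -> \int[mu]_(x in D) f x = 0.
Proof.
move=> f0; rewrite (@Rintegral_congr D f (cst 0))//.
by rewrite /Rintegral integral0.
Qed.

End RealIntegralEq.

(** * Test functions and smooth cutoffs *)

Section TestFunctions.
Context {R : realType}.
Notation mu := (@lebesgue_measure R).
Implicit Types f g : R -> R.

(** A recursive form of smoothness up to order n, stable under the
    inductions that prove closure under sums, products and affine changes of
    variable. *)
Fixpoint nsmooth n f : Prop :=
  if n is m.+1 then (forall x : R, derivable f x 1) /\ nsmooth m (derive1 f)
  else True.
Definition smooth f := forall n (x : R), derivable (derive1n n f) x 1.

Lemma derive1nSr n f : derive1n n.+1 f = derive1n n (derive1 f).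
Proof. by rewrite /derive1n iterSr. Qed.

Lemma nsmooth_pred n f : nsmooth n.+1 f -> nsmooth n f.
Proof. by elim: n f => [f _ //|n ih] f [df sf]; split => //; exact: ih. Qed.

Lemma smooth_nsmooth f : smooth f -> forall n, nsmooth n f.
Proof.
move=> sf n; elim: n f sf => [f _ //|n ih] f sf; split; first exact: (sf 0%N).
by apply: ih => k x; rewrite -derive1nSr; exact: sf.
Qed.

Lemma nsmooth_smooth f : (forall n, nsmooth n f) -> smooth f.
Proof.
move=> h n; elim: n f h => [f h x|n ih f h x]; first by have [+ _] := h 1%N; apply.
by rewrite derive1nSr; apply: ih => k; have [_ +] := h k.+1.
Qed.

Lemma nsmoothD n f g : nsmooth n f -> nsmooth n g -> nsmooth n (fun x => f x + g x).
Proof.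
elim: n f g => [f g _ _ //|n ih] f g [df sf] [dg sg]; split.
  by move=> x; apply: derivableD.
have -> : derive1 (fun x => f x + g x) = fun x => derive1 f x + derive1 g x.
  by apply/funext => x; rewrite !derive1E deriveD.
exact: ih.
Qed.

Lemma nsmoothZ n (k : R) f : nsmooth n f -> nsmooth n (fun x => k * f x).
Proof.
elim: n f => [f _ //|n ih] f [df sf]; split.
  by move=> x; apply: derivableZ.
have -> : derive1 (fun x => k * f x) = fun x => k * derive1 f x.
  by apply/funext => x; rewrite !derive1E deriveZ.
exact: ih.
Qed.

Lemma nsmoothM n f g : nsmooth n f -> nsmooth n g -> nsmooth n (fun x => f x * g x).
Proof.
elim: n f g => [f g _ _ //|n ih] f g sf sg.
have sf0 := nsmooth_pred sf; have sg0 := nsmooth_pred sg.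
case: sf sg => [df sf] [dg sg]; split.
  by move=> x; apply: derivableM.
have -> : derive1 (fun x => f x * g x) = fun x => f x * derive1 g x + g x * derive1 f x.
  by apply/funext => x; rewrite !derive1E deriveM.
by apply: nsmoothD; apply: ih.
Qed.

Lemma affine_is_derive f (a b x : R) : derivable f (a * x + b) 1 ->
  is_derive x 1 (fun y => f (a * y + b)) (a * derive1 f (a * x + b)).
Proof.
move=> df.
have dg : is_derive x 1 (fun y => a * y + b) a.
  by apply: is_derive_eq; rewrite addr0 /GRing.scale/= mulr1.
have df' : is_derive (a * x + b) 1 f (derive1 f (a * x + b)).
  by rewrite derive1E; apply: DeriveDef.
have := @is_derive1_comp _ f (fun y => a * y + b) x _ _ df' dg.
by rewrite mulrC.
Qed.

Lemma nsmooth_affine n (a b : R) f : nsmooth n f ->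
  nsmooth n (fun x => f (a * x + b)).
Proof.
elim: n f => [f _ //|n ih] f [df sf]; split.
  by move=> x; case: (affine_is_derive (df (a * x + b))).
have -> : derive1 (fun x => f (a * x + b)) = fun x => a * derive1 f (a * x + b).
  apply/funext => x; rewrite [LHS]derive1E.
  by apply: derive_val; exact: affine_is_derive.
by apply: nsmoothZ; exact: ih.
Qed.

Lemma smooth_continuous f : smooth f -> continuous f.
Proof.
by move=> sf x; apply/differentiable_continuous/derivable1_diffP; exact: (sf 0%N).
Qed.

Lemma smooth_derive1 f : smooth f -> smooth (derive1 f).
Proof. by move=> sf n x; rewrite -derive1nSr; exact: sf. Qed.

Lemma support_compact f (a b : R) : (forall x, f x != 0 -> a <= x <= b) ->
  compact (closure [set x | f x != 0]).
Proof.
move=> fab; apply: (@subclosed_compact _ _ `[a, b]).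
- exact: closed_closure.
- exact: segment_compact.
- rewrite [X in _ `<=` X](closure_id _).1; last exact: interval_closed.
  apply: closureS => x /= /fab; by rewrite in_itv.
Qed.

Lemma compact_support_bounded f : compact (closure [set x | f x != 0]) ->
  exists2 M : R, 0 < M & forall x, M <= `|x| -> f x = 0.
Proof.
move=> /compact_bounded[M [_ hM]].
exists (`|M| + 2) => [|x Mx]; first by rewrite ltr_wpDl.
apply: contrapT => /eqP fx0.
have xS : closure [set x | f x != 0] x by apply: subset_closure.
have := hM (`|M| + 1) _ x xS.
have -> : M < `|M| + 1 by rewrite (le_lt_trans (ler_norm _))// ltrDl.
move=> /(_ erefl) xM; have := le_trans Mx xM; lra.
Qed.

Lemma compact_support_integrable f (M : R) : continuous f ->
  (forall x, M <= `|x| -> f x = 0) -> mu.-integrable setT (EFin \o f).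
Proof.
move=> cf fM.
have -> : EFin \o f = (EFin \o f) \_ `[- M, M].
  apply/funext => x; rewrite patchE; case: ifPn => // xM /=.
  rewrite fM//; move: xM; apply: contraNle => /ltW; rewrite ler_norml => h.
  by rewrite inE/= in_itv.
rewrite -integrable_mkcond//.
apply: continuous_compact_integrable; first exact: segment_compact.
exact: continuous_subspaceT.
Qed.

(** The normalized primitive of f^2 is a smooth transition from 0 to 1
    whenever f is a nonzero test function. *)
Lemma cutoff_exists f : smooth f -> compact (closure [set x | f x != 0]) ->
  (exists x, f x != 0) ->
  exists (P : R -> R) (M K : R),
    [/\ 0 < M, smooth P, (forall v, v <= - M -> P v = 0) /\
        (forall v, M <= v -> P v = 1), (forall v, 0 <= P v <= 1) &
        forall v, `|derive1 P v| <= K].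
Proof.
move=> sf /compact_support_bounded[M M0 fM] [x0 fx0].
pose g x := f x * f x.
have g0 x : 0 <= g x by rewrite /g -expr2 sqr_ge0.
have sg : smooth g.
  by apply: nsmooth_smooth => n; apply: nsmoothM; exact: smooth_nsmooth.
have cg := smooth_continuous sg.
have gM x : M <= `|x| -> g x = 0 by move=> /fM; rewrite /g => ->; rewrite mulr0.
have ig := compact_support_integrable cg gM.
pose F v := \int[mu]_(x in [set` `]-oo, v]]) g x.
have iS v : mu.-integrable [set` `]-oo, v]] (EFin \o g).
  by apply: integrableS ig.
have dF (v : R) : derivable F v 1 /\ derive1 F v = g v.
  have /(_ v (v + 1)) h := @continuous_FTC1 R g -oo%O.
  have h1 : v < v + 1 by rewrite ltrDl.
  have h3 := h h1 (iS _). by apply: (h3 _ (cg v)); rewrite ltNyr.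
have F_mono u v : u <= v -> F u <= F v.
  by move=> uv; apply: ge0_le_RintegralS => //; apply: subset_itvl.
have F0 v : 0 <= F v by apply: Rintegral_ge0.
have FM v : M <= v -> F v = F M.
  have h w : M <= w -> F w = \int[mu]_x g x.
    move=> Mw; rewrite /F Rintegral_mkcond; apply: eq_Rintegral => x _.
    rewrite patchE; case: ifPn => // xw; rewrite gM//; move: xw.
    apply: contraNle => xM; rewrite inE/= in_itv/= ltW// (lt_le_trans _ Mw)//.
    exact: le_lt_trans (ler_norm _) xM.
  by move=> Mv; rewrite !h.
have FN v : v <= - M -> F v = 0.
  move=> vM; apply: Rintegral_eq0 => x; rewrite /= in_itv/= => xv; rewrite gM// -normrN (le_trans _ (ler_norm _))//.
  by rewrite lerNr (le_trans xv).
have c0 : 0 < F M.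
  rewrite lt_neqAle F0 andbT; apply/negP => /eqP/esym FM0.
  have x0M : x0 < M.
    rewrite (le_lt_trans (ler_norm _))// ltNge; apply: contra fx0 => /fM ->.
    by rewrite eqxx.
  have [_] := dF x0; rewrite derive1E => /esym.
  have -> : 'D_1 F x0 = 0.
    transitivity ('D_1 (cst (0 : R)) x0); last exact: derive_cst.
    apply: near_eq_derive.
    near=> y; apply/eqP; rewrite eq_le F0 andbT -FM0; apply: F_mono.
    apply: ltW; near: y; exact: lt_nbhsl.
  by rewrite /g => /eqP; rewrite mulf_eq0 orbb (negbTE fx0).
have [K hK] : exists K : R, forall v, `|g v| <= K.
  have : bounded_set (g @` `[- M, M]).
    apply: compact_bounded; apply: continuous_compact; last exact: segment_compact.
    exact: continuous_subspaceT.
  move=> [K [_ hK]]; exists (`|K| + 1) => v.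
  have [vM|vM] := leP M `|v|; first by rewrite gM// normr0 addr_ge0.
  apply: (hK (`|K| + 1)); first by rewrite (le_lt_trans (ler_norm _))// ltrDl.
  by exists v => //=; rewrite in_itv/= -ler_norml ltW.
exists (fun v => (F M)^-1 * F v), M, ((F M)^-1 * K); split; [exact: M0| | | |].
- apply: nsmooth_smooth => n; apply: nsmoothZ.
  case: n => // n; split; first by move=> x; case: (dF x).
  rewrite (_ : derive1 F = g); first exact: smooth_nsmooth.
  by apply/funext => x; case: (dF x).
- split=> v vM; first by rewrite (FN v vM) mulr0.
  by rewrite (FM v vM) mulVf// gt_eqF.
- move=> v; rewrite mulr_ge0 ?invr_ge0//=.
  have [vM|/ltW/FM ->] := leP v M; last by rewrite mulVf// gt_eqF.
  by rewrite mulrC ler_pdivrMr// mul1r F_mono.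
- move=> v; rewrite derive1E deriveZ; last by case: (dF v).
  rewrite -derive1E; have [_ ->] := dF v.
  by rewrite /GRing.scale/= normrM gtr0_norm ?invr_gt0// ler_wpM2l// invr_ge0 ltW.
Unshelve. all: by end_near. Qed.

(** A translate of the previous cutoff, with its transition in [0, M], so
    that the kernels below approximate from the right. *)
Lemma cutoff0_exists f : smooth f -> compact (closure [set x | f x != 0]) ->
  (exists x, f x != 0) ->
  exists (P : R -> R) (M K : R),
    [/\ 0 < M, smooth P, (forall v, v <= 0 -> P v = 0) /\
        (forall v, M <= v -> P v = 1), (forall v, 0 <= P v <= 1) &
        forall v, `|derive1 P v| <= K].
Proof.
move=> sf cf f0; have [P [M [K [M0 sP [PN PM] P01 PK]]]] := cutoff_exists sf cf f0.
have dP x : derive1 (fun v => P (1 * v + - M)) x = derive1 P (1 * x + - M).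
  rewrite derive1E -[RHS]mul1r.
  by apply: derive_val; apply: affine_is_derive; exact: (sP 0%N).
exists (fun v => P (1 * v + - M)), (2 * M), K; split.
- by rewrite mulr_gt0.
- by apply: nsmooth_smooth => n; apply: nsmooth_affine; exact: smooth_nsmooth.
- by split=> v vM; [apply: PN|apply: PM]; lra.
- by [].
- by move=> v; rewrite dP.
Qed.

End TestFunctions.

(** * Locally integrable functions *)

Section LocallyIntegrable.
Context {R : realType}.
Notation mu := (@lebesgue_measure R).
Implicit Types f g : R -> R.

Lemma loc_integrable_itv f (a b : R) : locally_integrable setT f ->
  mu.-integrable `[a, b] (EFin \o f).
Proof.
move=> [mf _ fK]; apply/integrableP; split.
  by apply/measurable_EFinP; exact: measurable_funS mf.
by apply: fK => //; exact: segment_compact.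
Qed.

Lemma loc_integrableP f : measurable_fun setT f ->
  (forall a b : R, mu.-integrable `[a, b] (EFin \o f)) ->
  locally_integrable setT f.
Proof.
move=> mf fi; split => //; first exact: openT.
move=> K _ cK; have [M [_ KM]] := compact_bounded cK.
have /integrableP[_] := fi (- (`|M| + 1)) (`|M| + 1).
apply: le_lt_trans; apply: ge0_subset_integral => //.
- exact: compact_measurable.
- apply/measurable_EFinP; apply: measurableT_comp => //; exact: measurable_funS mf.
- move=> x Kx /=; rewrite in_itv/= -ler_norml.
  by apply: KM => //; rewrite (le_lt_trans (ler_norm _))// ltrDl.
Qed.

Lemma loc_integrableM f g (a b C : R) : locally_integrable setT f ->
  measurable_fun setT g -> (forall x, `|g x| <= C) ->
  (forall x, ~ (a <= x <= b) -> g x = 0) ->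
  mu.-integrable setT (EFin \o (fun x => f x * g x)).
Proof.
move=> lf mg gC g0.
have -> : EFin \o (fun x => f x * g x) = (EFin \o (fun x => g x * f x)) \_ `[a, b].
  apply/funext => x; rewrite patchE; case: ifPn => xab /=; first by rewrite mulrC.
  by rewrite g0 ?mulr0//; move: xab; rewrite notin_setE/= in_itv/=.
rewrite -integrable_mkcond//; apply: (integrable_boundedM (C := C)) => //.
- exact: measurable_funS mg.
- exact: loc_integrable_itv.
Qed.

Lemma FTC_C1 f (a b : R) : a <= b -> (forall x : R, derivable f x 1) ->
  continuous (derive1 f) -> \int[mu]_(x in `[a, b]) derive1 f x = f b - f a.
Proof.
rewrite le_eqVlt => /predU1P[<- _ _|ab df cf].
  by rewrite set_itv1 Rintegral_set1 subrr.
have cF x : {for x, continuous f}.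
  by apply/differentiable_continuous/derivable1_diffP.
have h1 : {within `[a, b], continuous (derive1 f)} by exact: continuous_subspaceT.
have h2 : derivable_oo_LRcontinuous f a b.
  split; [by move=> x _; exact: df|apply: cvg_at_right_filter; exact: cF|].
  by apply: cvg_at_left_filter; exact: cF.
have h3 : {in `]a, b[, derive1 f =1 derive1 f} by [].
by rewrite /Rintegral (continuous_FTC2 ab h1 h2 h3).
Qed.

End LocallyIntegrable.

Lemma smooth_derivable {R : realType} (f : R -> R) : smooth f ->
  forall x : R, derivable f x 1.
Proof. by move=> sf x; exact: (sf 0%N). Qed.

Arguments smooth_derivable {R f} _ _.

(** * Weak derivatives and the du Bois-Reymond lemma *)

Section WeakDerivative.
Context {R : realType}.
Notation mu := (@lebesgue_measure R).
Implicit Types f g : R -> R.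

Definition weak_diff f g := forall psi, smooth_compact_support psi ->
  \int[mu]_x (f x * derive1 psi x) = - \int[mu]_x (g x * psi x).

Variables (P : R -> R) (M K : R).
Hypotheses (M0 : 0 < M) (sP : smooth P) (P0 : forall v, v <= 0 -> P v = 0)
  (P1 : forall v, M <= v -> P v = 1) (P01 : forall v, 0 <= P v <= 1)
  (PK : forall v, `|derive1 P v| <= K).

(** A steep transition just to the right of x: its derivative in y is an
    approximation of the Dirac mass at x. *)
Definition kernel (x : R) (n : nat) (y : R) : R := P (n.+1%:R * y + - (n.+1%:R * x)).

Lemma kernel_derive x n y : derivable (kernel x n) y 1 /\
  derive1 (kernel x n) y = n.+1%:R * derive1 P (n.+1%:R * y + - (n.+1%:R * x)).
Proof.
have h := @affine_is_derive R P n.+1%:R (- (n.+1%:R * x)) y (smooth_derivable sP _).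
by split; [case: h|rewrite derive1E; apply: derive_val].
Qed.

Lemma kernel_smooth x n : smooth (kernel x n).
Proof. by apply: nsmooth_smooth => k; apply: nsmooth_affine; exact: smooth_nsmooth. Qed.

Lemma kernel0 x n y : y <= x -> kernel x n y = 0.
Proof.
by move=> yx; rewrite /kernel P0// -mulrBr pmulr_rle0 ?subr_le0.
Qed.

Lemma kernel1 x n y : x + M / n.+1%:R <= y -> kernel x n y = 1.
Proof.
by move=> yx; rewrite /kernel P1// -mulrBr -ler_pdivrMl// mulrC lerBrDl.
Qed.

Lemma derive1_P0 v : v < 0 \/ M < v -> derive1 P v = 0.
Proof.
move=> vM; rewrite derive1E.
case: vM => vM.
- transitivity ('D_1 (cst (0 : R)) v); last exact: derive_cst.
  apply: near_eq_derive; near=> y; rewrite P0// ltW//.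
  by near: y; exact: lt_nbhsl.
- transitivity ('D_1 (cst (1 : R)) v); last exact: derive_cst.
  apply: near_eq_derive; near=> y; rewrite P1// ltW//.
  by near: y; exact: lt_nbhsr.
Unshelve. all: by end_near. Qed.

Lemma derive1_kernel0 x n y : y < x \/ x + M / n.+1%:R < y ->
  derive1 (kernel x n) y = 0.
Proof.
move=> h; have [_ ->] := kernel_derive x n y.
rewrite derive1_P0 ?mulr0//; case: h => h; [left|right].
- by rewrite -mulrBr pmulr_rlt0// subr_lt0.
- by rewrite -mulrBr -ltr_pdivrMl// mulrC ltrBrDl.
Qed.

Lemma continuous_derive1_kernel x n : continuous (derive1 (kernel x n)).
Proof. apply: smooth_continuous; apply: smooth_derive1; exact: kernel_smooth. Qed.

Lemma Rintegral_derive1_kernel x n : \int[mu]_y derive1 (kernel x n) y = 1.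
Proof.
have e0 : 0 < M / n.+1%:R by rewrite divr_gt0.
transitivity (\int[mu]_(y in `[x, x + M / n.+1%:R]) derive1 (kernel x n) y).
  rewrite [RHS]Rintegral_mkcond; apply: Rintegral_congr => y _.
  rewrite patchE; case: ifPn => // yx; apply: derive1_kernel0.
  move: yx; rewrite notin_setE/= in_itv/= => /negP.
  by rewrite negb_and -!ltNge => /orP.
rewrite FTC_C1.
- by rewrite kernel1// kernel0// subr0.
- by rewrite lerDl ltW.
- by move=> y; case: (kernel_derive x n y).
- exact: continuous_derive1_kernel.
Qed.

Lemma measurable_continuous f : continuous f -> measurable_fun setT f.
Proof. by move=> cf; exact: continuous_measurable_fun. Qed.

(** The derivative of the kernel has mass one, lives in
    [x, x + M / (n + 1)] and has size O(n), so it averages f near x and the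
    definition of a Lebesgue point applies. *)
Lemma kernel_lebesgue_pt f x : locally_integrable setT f -> lebesgue_pt f x ->
  (fun n => \int[mu]_y (f y * derive1 (kernel x n) y)) @ \oo --> f x.
Proof.
move=> lf fx.
pose r n : R := 2 * M / n.+1%:R.
have r0 n : 0 < r n by rewrite divr_gt0// mulr_gt0.
have K0 : 0 <= K by exact: le_trans (PK 0).
have mk n : measurable_fun setT (derive1 (kernel x n)).
  by apply: measurable_continuous; exact: continuous_derive1_kernel.
have kb n y : `|derive1 (kernel x n) y| <= n.+1%:R * K.
  by have [_ ->] := kernel_derive x n y; rewrite normrM ger0_norm// ler_wpM2l.
have k0 n y : ~ (x <= y <= x + M / n.+1%:R) -> derive1 (kernel x n) y = 0.
  move=> /negP; rewrite negb_and -!ltNge => /orP; exact: derive1_kernel0.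
have lc : locally_integrable setT (fun y => f y - f x).
  apply: loc_integrableP.
    by apply: measurable_funB => //; case: lf.
  move=> a b; apply: integrable_EFinB => //; first exact: loc_integrable_itv.
  apply: continuous_compact_integrable; first exact: segment_compact.
  by apply: continuous_subspaceT => ?; exact: cvg_cst.
have ik1 n : mu.-integrable setT (EFin \o derive1 (kernel x n)).
  have -> : derive1 (kernel x n) = fun y => 1 * derive1 (kernel x n) y.
    by apply/funext => y; rewrite mul1r.
  apply: (loc_integrableM _ (mk n) (kb n) (@k0 n)).
  apply: loc_integrableP => // a b.
  apply: continuous_compact_integrable; first exact: segment_compact.
  by apply: continuous_subspaceT => ?; exact: cvg_cst.
have ik n : mu.-integrable setT (EFin \o (fun y => f x * derive1 (kernel x n) y)).
  exact: integrable_EFinZ.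
have ifk n : mu.-integrable setT (EFin \o (fun y => f y * derive1 (kernel x n) y)).
  exact: loc_integrableM lf (mk n) (kb n) (@k0 n).
have icn n : mu.-integrable (ball x (r n)) (EFin \o (fun y => f y - f x)).
  apply: (integrableS _ _ _ (loc_integrable_itv (x - r n) (x + r n) lc)) => //.
    exact: measurable_ball.
  by rewrite ball_itv; exact: subset_itv_oo_cc.
have dv n : fine (davg f x (r n)) =
    (r n *+ 2)^-1 * \int[mu]_(y in ball x (r n)) `|f y - f x|.
  rewrite /davg /iavg lebesgue_measure_ball ?(ltW (r0 n))// inver mulrn_eq0/=.
  rewrite gt_eqF// fineM//; apply: integrable_fin_num; first exact: measurable_ball.
  exact: integrable_norm.
have main n : `|f x - \int[mu]_y (f y * derive1 (kernel x n) y)| <=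
    K * M * 4 * fine (davg f x (r n)).
  have fxE : f x = \int[mu]_y (f x * derive1 (kernel x n) y).
    by rewrite RintegralZl// Rintegral_derive1_kernel mulr1.
  rewrite [X in X - _]fxE -RintegralB//.
  apply: (le_trans (le_normr_Rintegral _ _)) => //; first exact: integrable_EFinB.
  have -> : K * M * 4 * fine (davg f x (r n)) =
      \int[mu]_(y in ball x (r n)) (n.+1%:R * K * `|f y - f x|).
    rewrite dv RintegralZl; [|exact: measurable_ball|exact: integrable_norm].
    rewrite mulrA; congr (_ * _); rewrite /r; field.
    by rewrite !gt_eqF//; move: (ltr0Sn R n); rewrite -natr1.
  rewrite [leRHS]Rintegral_mkcond; apply: le_Rintegral => //.
  - by apply: integrable_norm; exact: integrable_EFinB.
  - rewrite -restrict_EFin -integrable_mkcond; last exact: measurable_ball.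
    apply: integrable_EFinZ; first exact: measurable_ball.
    exact: integrable_norm.
  move=> y _; rewrite patchE; case: ifPn => yb.
    by rewrite -mulrBl normrM mulrC distrC ler_wpM2r// kb.
  rewrite -mulrBl k0 ?mulr0 ?normr0// => /andP[xy yx].
  move: yb; rewrite notin_setE; apply.
  rewrite /ball/= distrC ger0_norm ?subr_ge0// ltrBlDl (le_lt_trans yx)//.
  by rewrite ltrD2l /r ltr_pM2r ?invr_gt0// ltr_pMl// ltr1n.
apply/cvgrPdist_le => e e0.
have : (fun n => K * M * 4 * fine (davg f x (r n))) @ \oo --> (0 : R).
  rewrite -[X in _ --> X](mulr0 (K * M * 4)); apply: cvgMr => //.
  have r_cvg : r @ \oo --> (0 : R)^'+.
    have rc : r @ \oo --> (0 : R).
      rewrite -[X in _ --> X](mulr0 (2 * M)); apply: cvgMr => //.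
      exact: cvg_harmonic.
    move=> A hA.
    have h : \forall n \near \oo, 0 < r n -> A (r n) by exact: rc _ hA.
    apply: (@filterS _ (nbhs \oo) _ _ _ _ h) => n {}h; exact: (h (r0 n)).
  have /fine_cvg := cvg_comp _ _ r_cvg fx.
  exact.
move=> /cvgrPdist_le /(_ e e0); apply: filterS => n.
rewrite sub0r normrN => h; apply: le_trans (main n) _.
exact: le_trans (ler_norm _) h.
Qed.

Arguments kernel_smooth : clear implicits.

Lemma ae_mono {d} {X : measurableType d} {R' : realType} (nu : {measure set X -> \bar R'})
    (Q1 Q2 : X -> Prop) :
  {ae nu, forall x, Q1 x} -> (forall x, Q1 x -> Q2 x) -> {ae nu, forall x, Q2 x}.
Proof. by move=> h h12; apply: filterS h. Qed.

Lemma ae_and {d} {X : measurableType d} {R' : realType} (nu : {measure set X -> \bar R'})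
    (Q1 Q2 : X -> Prop) :
  {ae nu, forall x, Q1 x} -> {ae nu, forall x, Q2 x} ->
  {ae nu, forall x, Q1 x /\ Q2 x}.
Proof. by move=> h1 h2; apply: filterI. Qed.

Lemma ae_mono2 {d} {X : measurableType d} {R' : realType} (nu : {measure set X -> \bar R'})
    (Q1 Q2 Q3 : X -> Prop) :
  {ae nu, forall x, Q1 x} -> {ae nu, forall x, Q2 x} ->
  (forall x, Q1 x -> Q2 x -> Q3 x) -> {ae nu, forall x, Q3 x}.
Proof.
by move=> h1 h2 h; apply: ae_mono (ae_and h1 h2) _ => x []; exact: h.
Qed.

Lemma ae_all {d} {X : measurableType d} {R' : realType} (nu : {measure set X -> \bar R'})
    (Q : nat -> X -> Prop) :
  (forall n, {ae nu, forall x, Q n x}) -> {ae nu, forall x, forall n, Q n x}.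
Proof. exact: ae_foralln. Qed.

Lemma test_derive1_kernel x n : smooth_compact_support (derive1 (kernel x n)).
Proof.
split; first by apply: smooth_derive1; exact: kernel_smooth.
apply: (@support_compact _ _ x (x + M / n.+1%:R)) => y; apply: contraNT.
rewrite negb_and -!ltNge => /orP h; apply/eqP; exact: derive1_kernel0.
Qed.

Lemma ae_neq (x : R) : {ae mu, forall y, y != x}.
Proof.
exists [set x]; split; [exact: measurable_set1|exact: lebesgue_measure_set1|].
by move=> y /= /negP/negPn/eqP.
Qed.

(** Fundamental lemma of the calculus of variations: the derivatives
    of the kernels are test functions and recover f at every Lebesgue point. *)
Lemma test_orthogonal_ae0 f : locally_integrable setT f ->
  (forall psi, smooth_compact_support psi -> \int[mu]_x (f x * psi x) = 0) ->
  {ae mu, forall x, f x = 0}.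
Proof.
move=> lf f0; apply: ae_mono (lebesgue_differentiation lf) _ => x fx.
have := kernel_lebesgue_pt lf fx.
have -> : (fun n => \int[mu]_y (f y * derive1 (kernel x n) y)) = cst 0.
  by apply/funext => n; exact: f0 (test_derive1_kernel x n).
move=> h; exact: (cvg_unique _ h (cvg_cst _)).
Qed.

(** The difference of two transitions, a smooth approximation of the indicator
    function of [x1, x2]; against it the weak derivative becomes an increment. *)
Definition plateau x1 x2 n y := kernel x1 n y + -1 * kernel x2 n y.

Lemma plateau_derive x1 x2 n y :
  derive1 (plateau x1 x2 n) y = derive1 (kernel x1 n) y - derive1 (kernel x2 n) y.
Proof.
have d1 := smooth_derivable (kernel_smooth x1 n) y.
have d2 := smooth_derivable (kernel_smooth x2 n) y.
rewrite derive1E deriveD; [|exact: d1|apply: derivableZ; exact: d2].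
rewrite deriveZ; last exact: d2.
by rewrite -!derive1E scaleN1r.
Qed.

Lemma test_plateau x1 x2 n : x1 <= x2 -> smooth_compact_support (plateau x1 x2 n).
Proof.
move=> x12; split.
  apply: nsmooth_smooth => k; apply: nsmoothD; last apply: nsmoothZ.
  - by apply: smooth_nsmooth; exact: kernel_smooth.
  - by apply: smooth_nsmooth; exact: kernel_smooth.
have e0 : 0 < M / n.+1%:R by rewrite divr_gt0.
apply: (@support_compact _ _ x1 (x2 + M / n.+1%:R)) => y; apply: contraNT.
rewrite negb_and -!ltNge => /orP[h|h]; apply/eqP; rewrite /plateau.
  rewrite (kernel0 n (ltW h)) (kernel0 n (le_trans (ltW h) x12)).
  by rewrite mulr0 addr0.
have h1 : x1 + M / n.+1%:R <= y by rewrite ltW// (le_lt_trans _ h)// lerD2r.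
by rewrite (kernel1 h1) (kernel1 (ltW h)) mulr1 addrN.
Qed.

Lemma kernel_cvg x y : kernel x ^~ y @ \oo --> (if x < y then 1 else 0 : R).
Proof.
case: ifPn => xy; last first.
  rewrite (_ : kernel x ^~ y = cst 0); first exact: cvg_cst.
  by apply/funext => n; rewrite kernel0// leNgt.
apply: (@cvg_trans _ ((fun=> 1 : R) @ \oo)); last exact: cvg_cst.
apply: near_eq_cvg; near=> n; rewrite kernel1//.
rewrite -lerBrDl ler_pdivrMr// -ler_pdivrMl ?subr_gt0//.
rewrite (@le_trans _ _ n%:R) ?ler_nat//.
near: n; exact: nbhs_infty_ger.
Unshelve. all: by end_near. Qed.

Lemma weak_diff_lebesgue_pt f g x1 x2 : locally_integrable setT f ->
  locally_integrable setT g -> weak_diff f g -> x1 < x2 ->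
  lebesgue_pt f x1 -> lebesgue_pt f x2 ->
  f x2 - f x1 = \int[mu]_(y in `[x1, x2]) g y.
Proof.
move=> lf lg fg x12 fx1 fx2.
pose h (y : R) : R := if x1 < y <= x2 then 1 else 0.
have ikk x n : mu.-integrable setT (EFin \o (fun y => f y * derive1 (kernel x n) y)).
  apply: (@loc_integrableM _ _ _ x (x + M / n.+1%:R) (n.+1%:R * K)) => //.
  - by apply: measurable_continuous; exact: continuous_derive1_kernel.
  - by move=> y; have [_ ->] := kernel_derive x n y; rewrite normrM ger0_norm// ler_wpM2l.
  - by move=> y /negP; rewrite negb_and -!ltNge => /orP; exact: derive1_kernel0.
have lhs : (fun n => \int[mu]_y (f y * derive1 (plateau x1 x2 n) y)) @ \oo --> f x1 - f x2.
  rewrite (_ : (fun n => _) = fun n => \int[mu]_y (f y * derive1 (kernel x1 n) y) -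
      \int[mu]_y (f y * derive1 (kernel x2 n) y)).
    by apply: cvgB; exact: kernel_lebesgue_pt.
  apply/funext => n; rewrite -RintegralB//; apply: Rintegral_congr => y _.
  by rewrite plateau_derive mulrBr.
have mpl n : measurable_fun setT (plateau x1 x2 n).
  apply: measurable_continuous; apply: smooth_continuous.
  by case: (test_plateau n (ltW x12)).
have dom n (y : R) : `|g y * plateau x1 x2 n y| <= 2 * `|(g \_ `[x1, x2 + M]) y|.
  rewrite patchE; case: ifPn => [_|yx].
    rewrite normrM mulrC ler_wpM2r// (le_trans (ler_normD _ _))// mulN1r normrN.
    have /andP[a0 a1] := P01 (n.+1%:R * y + - (n.+1%:R * x1)).
    have /andP[b0 b1] := P01 (n.+1%:R * y + - (n.+1%:R * x2)).
    rewrite !ger0_norm//; apply: lerD; rewrite /kernel; lra.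
  rewrite normr0 mulr0 /plateau.
  have [yx1|xy] := leP y x1.
    rewrite (kernel0 n yx1) (kernel0 n (le_trans yx1 (ltW x12))).
    by rewrite !mulr0 addr0 mulr0 normr0.
  have yx2 : x2 + M < y.
    move: yx; rewrite notin_setE/= in_itv/= => /negP.
    by rewrite (ltW xy)/= -ltNge.
  have Mn : M / n.+1%:R <= M by rewrite ler_pdivrMr// ler_peMr ?(ltW M0)// ler1n.
  have h1 : x1 + M / n.+1%:R <= y by rewrite (le_trans (lerD (ltW x12) Mn))// ltW.
  have h2 : x2 + M / n.+1%:R <= y by rewrite (le_trans (lerD (lexx x2) Mn))// ltW.
  by rewrite (kernel1 h1) (kernel1 h2) mulr1 addrN mulr0 normr0.
have := @Rintegral_dominated _ _ _ mu (fun n y => g y * plateau x1 x2 n y)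
  (fun y => g y * h y) (fun y => 2 * `|(g \_ `[x1, x2 + M]) y|) setT measurableT.
case.
- by move=> n; apply: measurable_funM; [case: lg|exact: mpl].
- move=> y _; apply: cvgMr.
  rewrite (_ : h y = (if x1 < y then 1 else 0) + -1 * (if x2 < y then 1 else 0)).
    by apply: cvgD; [|apply: cvgMr]; exact: kernel_cvg.
  rewrite /h leNgt; case: ltP => [xy|yx]/=; last first.
    by rewrite ltNge (le_trans yx (ltW x12)) mulr0 addr0.
  by case: ltP; rewrite /= ?mulr1 ?mulr0 ?subrr ?addr0.
- apply: integrable_EFinZ => //; apply: integrable_norm.
  by rewrite -restrict_EFin -integrable_mkcond//; exact: loc_integrable_itv.
- by move=> n y _; exact: dom.
move=> ih rhs.
have -> : \int[mu]_(y in `[x1, x2]) g y = \int[mu]_y (g y * h y).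
  rewrite Rintegral_mkcond; apply: ae_eq_Rintegral => //.
  - by apply/(measurable_restrictT _ _).1 => //; apply: (@measurable_funS _ _ _ _ setT) => //; case: lg.
  - exact: integrable_measurable ih.
  - apply: ae_mono (ae_neq x1) _ => y yx1 _; rewrite patchE /h.
    case: ifPn => [|]; rewrite ?notin_setE ?inE/= in_itv/=.
      by move=> /andP[x1y ->]; rewrite lt_neqAle eq_sym yx1 x1y mulr1.
    move=> /negP; rewrite negb_and -!ltNge => /orP[yx|xy].
      by rewrite ltNge (ltW yx) mulr0.
    by rewrite [y <= x2]leNgt xy andbF mulr0.
have e n : \int[mu]_y (f y * derive1 (plateau x1 x2 n) y) =
   - \int[mu]_y (g y * plateau x1 x2 n y) by apply: fg; exact: test_plateau (ltW x12).
rewrite -opprB; apply/eqP; rewrite eqr_oppLR; apply/eqP.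
have rhs' : (fun n => \int[mu]_y (f y * derive1 (plateau x1 x2 n) y)) @ \oo -->
    - \int[mu]_x (g x * h x) by rewrite (funext e); exact: cvgN.
exact: (cvg_unique _ lhs rhs').
Qed.

Lemma Rintegral_itv_split g (a b c : R) : locally_integrable setT g ->
  a <= b -> b <= c ->
  \int[mu]_(t in `[a, c]) g t = \int[mu]_(t in `[a, b]) g t + \int[mu]_(t in `[b, c]) g t.
Proof.
move=> lg ab bc.
have h := @Rintegral_itvB R g (BLeft a) (BRight c) b (loc_integrable_itv a c lg).
rewrite -[X in _ = _ + X]Rintegral_itv_obnd_cbnd.
  by rewrite -h ?bnd_simp// addrC subrK.
apply: integrableS (loc_integrable_itv b c lg) => //.
by apply: subset_itvr; rewrite bnd_simp.
Qed.

Lemma increment_continuous g h : locally_integrable setT g ->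
  (forall x y, x <= y -> h y - h x = \int[mu]_(t in `[x, y]) g t) -> continuous h.
Proof.
move=> lg hg x.
have ab : x - 1 < x + 1 by lra.
have := parameterized_integral_continuous (ltW ab) (loc_integrable_itv (x - 1) (x + 1) lg).
move=> /(continuous_within_itvP _ ab)[/(_ x) + _ _].
rewrite in_itv/= => /(_ ltac:(by apply/andP; split; lra)) cx.
have : {for x, continuous (fun z => h (x - 1) + parameterized_integral mu (x - 1) z g)}.
  by apply: continuousD => //; exact: cvg_cst.
have e z : x - 1 <= z -> h (x - 1) + parameterized_integral mu (x - 1) z g = h z.
  by move=> xz; rewrite /parameterized_integral -hg// addrC subrK.
rewrite /prop_for /continuous_at e; last by lra.
apply: cvg_trans; apply: near_eq_cvg; near=> z; rewrite e//.
apply: ltW; near: z; apply: lt_nbhsr; lra.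
Unshelve. all: by end_near. Qed.

Lemma weak_diff_primitive f g : locally_integrable setT f ->
  locally_integrable setT g -> weak_diff f g ->
  exists h, [/\ continuous h,
    (forall x y, x <= y -> h y - h x = \int[mu]_(t in `[x, y]) g t) &
    {ae mu, forall x, f x = h x}].
Proof.
move=> lf lg fg.
have [x0 fx0] : exists x0, lebesgue_pt f x0.
  have := lebesgue_differentiation lf.
  apply: contraPP => /forallNP h [N [mN N0 sN]].
  have NT : N = setT by apply/seteqP; split => // x _; apply: sN; exact: h.
  by move: N0; rewrite NT -set_itvNyy lebesgue_measure_itv.
pose h x := f x0 + if x0 <= x then \int[mu]_(t in `[x0, x]) g t
                   else - \int[mu]_(t in `[x, x0]) g t.
have hg x y : x <= y -> h y - h x = \int[mu]_(t in `[x, y]) g t.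
  move=> xy; rewrite /h opprD addrACA subrr add0r.
  have [x0x|xx0] := leP x0 x.
    by rewrite (le_trans x0x xy) (Rintegral_itv_split lg x0x xy) addrC addrA addNr add0r.
  have [x0y|yx0] := leP x0 y.
    by rewrite opprK (Rintegral_itv_split lg (ltW xx0) x0y) addrC.
  rewrite opprK (Rintegral_itv_split lg xy (ltW yx0)).
  by rewrite addrC -addrA subrr addr0.
exists h; split => //; first exact: increment_continuous hg.
apply: ae_mono (lebesgue_differentiation lf) _ => x fx.
rewrite /h; case: (ltgtP x0 x) => [x0x|xx0|<-].
- by rewrite -(weak_diff_lebesgue_pt lf lg fg x0x)// addrC subrK.
- by rewrite -(weak_diff_lebesgue_pt lf lg fg xx0)// opprB addrC subrK.
- by rewrite set_itv1 Rintegral_set1 addr0.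
Qed.

End WeakDerivative.

(** * Sobolev functions on the line *)

Section SobolevLine.
Context {R : realType}.
Notation mu := (@lebesgue_measure R).
Implicit Types f g h k : R -> R.

Definition has_bump := exists f : R -> R, smooth_compact_support f /\ exists x, f x != 0.

(** Du Bois-Reymond: testing with plateaus gives the increments between
    Lebesgue points, which form a set of full measure. *)
Lemma weak_diff_prim f g : has_bump -> locally_integrable setT f ->
  locally_integrable setT g -> weak_diff f g ->
  exists h, [/\ continuous h,
    (forall x y, x <= y -> h y - h x = \int[mu]_(t in `[x, y]) g t) &
    {ae mu, forall x, f x = h x}].
Proof.
move=> [b [[sb cb] b0]] lf lg fg.
have [P [M [K [M0 sP [P0 P1] P01 PK]]]] := cutoff0_exists sb cb b0.
exact: (weak_diff_primitive M0 sP P0 P1 P01 PK lf lg fg).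
Qed.

Lemma test_orthogonal_ae f : has_bump -> locally_integrable setT f ->
  (forall psi, smooth_compact_support psi -> \int[mu]_x (f x * psi x) = 0) ->
  {ae mu, forall x, f x = 0}.
Proof.
move=> [b [[sb cb] b0]] lf f0.
have [P [M [K [M0 sP [P0 P1] P01 PK]]]] := cutoff0_exists sb cb b0.
exact: (test_orthogonal_ae0 M0 sP P0 P1 PK lf f0).
Qed.

Lemma continuous_ae_le f (B : R) : continuous f ->
  {ae mu, forall x, f x <= B} -> forall x, f x <= B.
Proof.
move=> cf [N [mN N0 sN]] x; rewrite leNgt; apply/negP => Bx.
have [e /= e0 he] : \forall y \near x, B < f y by exact: (cf x _ (lt_nbhsr Bx)).
have bN : ball x e `<=` N.
  by move=> y /he By; apply: sN => /=; rewrite leNgt By.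
have : (mu (ball x e) <= mu N)%E.
  by apply: le_measure => //; rewrite inE//; exact: measurable_ball.
rewrite N0 lebesgue_measure_ball ?(ltW e0)// lee_fin.
by rewrite leNgt pmulrn_lgt0// e0.
Qed.

Lemma increment_derive h k : continuous k ->
  (forall x y, x <= y -> h y - h x = \int[mu]_(t in `[x, y]) k t) ->
  forall x : R, derivable h x 1 /\ derive1 h x = k x.
Proof.
move=> ck hk x.
pose F z := \int[mu]_(t in `[x - 1, z]) k t.
have x12 : x < x + 1 by lra.
have x01 : x - 1 < x by lra.
have ik : mu.-integrable `[x - 1, x + 1] (EFin \o k).
  apply: continuous_compact_integrable; first exact: segment_compact.
  exact: continuous_subspaceT.
have [dF F'] := continuous_FTC1_closed x12 ik x01 (ck x).
have e : \forall z \near x, F z + h (x - 1) = h z.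
  near=> z; rewrite /F -hk ?subrK//; apply: ltW; near: z; apply: lt_nbhsr; lra.
have dF1 : derivable (fun z => F z + h (x - 1)) x 1.
  by apply: derivableD; [exact: dF|exact: derivable_cst].
split.
  exact: near_eq_derivable e dF1.
rewrite derive1E -(near_eq_derive _ e).
rewrite deriveD; [|exact: dF|exact: derivable_cst].
by rewrite derive_cst addr0 -derive1E; exact: F'.
Unshelve. all: by end_near. Qed.

Definition L2fun f := measurable_fun setT f /\ mu.-integrable setT (EFin \o (fun x => f x ^+ 2)).

Lemma L2_loc f : L2fun f -> locally_integrable setT f.
Proof.
move=> [mf f2]; apply: loc_integrableP => // a b.
apply: (@le_integrableR _ _ _ mu _ _ (fun x => 1 + f x ^+ 2)) => //.
- exact: measurable_funS mf.
- move=> x _; rewrite -real_normK ?num_real//.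
  have := normr_ge0 (f x); nra.
- apply: integrable_EFinD => //; last exact: integrableS f2.
  apply: continuous_compact_integrable; first exact: segment_compact.
  by apply: continuous_subspaceT => ?; exact: cvg_cst.
Qed.

(** Sobolev embedding in one dimension: on [x, x + 1] the values of h differ from h x by
    at most the integral of |g|, which Cauchy-Schwarz bounds by its square norm; then
    average over this interval. *)
Lemma increment_sup_bound h g : L2fun h -> L2fun g ->
  (forall x y, x <= y -> h y - h x = \int[mu]_(t in `[x, y]) g t) ->
  forall x, h x ^+ 2 <= 2 * (\int[mu]_y (h y ^+ 2) + \int[mu]_y (g y ^+ 2)).
Proof.
move=> [mh h2] L2g hg x; have [mg g2] := L2g.
have lg := L2_loc L2g.
pose I : set R := `[x, x + 1]%classic.
have mI : measurable I by exact: measurable_itv.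
have m1 : fine (mu I) = 1.
  by rewrite /I lebesgue_measure_itv/= lte_fin ltrDl ltr01 -EFinD addrC addKr.
have ci (c : R) : mu.-integrable I (EFin \o cst c).
  apply: continuous_compact_integrable; first exact: segment_compact.
  by apply: continuous_subspaceT => ?; exact: cvg_cst.
have ig : mu.-integrable I (EFin \o (fun y => `|g y|)).
  by apply: integrable_norm; exact: loc_integrable_itv.
have ig2 : mu.-integrable I (EFin \o (fun y => g y ^+ 2)) by exact: integrableS g2.
have ih2 : mu.-integrable I (EFin \o (fun y => h y ^+ 2)) by exact: integrableS h2.
pose c := \int[mu]_(y in I) `|g y|.
have c2 : c ^+ 2 <= \int[mu]_(y in I) (g y ^+ 2).
  have : 0 <= \int[mu]_(y in I) ((g y ^+ 2 - 2 * c * `|g y|) + c ^+ 2).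
    apply: Rintegral_ge0 => y _.
    have -> : g y ^+ 2 = `|g y| ^+ 2 by rewrite real_normK// num_real.
    by have := sqr_ge0 (`|g y| - c); lra.
  rewrite RintegralD//; [|apply: integrable_EFinB => //; exact: integrable_EFinZ|exact: ci].
  rewrite RintegralB//; last exact: integrable_EFinZ.
  rewrite RintegralZl// Rintegral_cst// m1 -/c; lra.
have hxy y : I y -> h x ^+ 2 <= 2 * h y ^+ 2 + 2 * c ^+ 2.
  rewrite /I/= in_itv/= => /andP[xy yx1].
  have : `|h y - h x| <= c.
    rewrite hg//; apply: (le_trans (le_normr_Rintegral _ _)) => //.
      exact: loc_integrable_itv.
    apply: ge0_le_RintegralS => //.
    by apply: subset_itvl; rewrite bnd_simp.
  move=> hc; have : (h y - h x) ^+ 2 <= c ^+ 2.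
    by rewrite -[X in X <= _]real_normK ?num_real// lerXn2r ?nnegrE// (le_trans _ hc).
  by have := sqr_ge0 (2 * h y - h x); lra.
have : \int[mu]_(y in I) (h x ^+ 2) <= \int[mu]_(y in I) (2 * h y ^+ 2 + 2 * c ^+ 2).
  apply: le_Rintegral => //; first exact: ci.
  by apply: integrable_EFinD => //; [exact: integrable_EFinZ|exact: ci].
rewrite Rintegral_cst// m1 mulr1 RintegralD//; [|exact: integrable_EFinZ|exact: ci].
rewrite Rintegral_cst// m1 mulr1 RintegralZl//.
have : \int[mu]_(y in I) (h y ^+ 2) <= \int[mu]_y (h y ^+ 2).
  by apply: ge0_le_RintegralS => // y; exact: sqr_ge0.
have : \int[mu]_(y in I) (g y ^+ 2) <= \int[mu]_y (g y ^+ 2).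
  by apply: ge0_le_RintegralS => // y; exact: sqr_ge0.
lra.
Qed.

End SobolevLine.

(** * Regular representatives and products *)

Section SobolevProducts.
Context {R : realType}.
Notation mu := (@lebesgue_measure R).
Implicit Types f g h k psi : R -> R.

Lemma continuous_loc f : continuous f -> locally_integrable setT f.
Proof.
move=> cf; apply: loc_integrableP; first exact: measurable_continuous.
move=> a b; apply: continuous_compact_integrable; first exact: segment_compact.
exact: continuous_subspaceT.
Qed.

Lemma derivable_continuous f : (forall x : R, derivable f x 1) -> continuous f.
Proof. by move=> df x; apply/differentiable_continuous/derivable1_diffP; exact: df. Qed.

Lemma near_zero_derive1 f (M : R) : (forall x, M <= `|x| -> f x = 0) ->
  forall x, M < `|x| -> derive1 f x = 0.
Proof.
move=> f0 x Mx; rewrite derive1E.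
transitivity ('D_1 (cst (0 : R)) x); last exact: derive_cst.
apply: near_eq_derive; near=> y; apply: f0; apply: ltW.
near: y.
have cn : {for x, continuous (fun y : R => `|y|)} by exact: norm_continuous.
exact: (cn _ (lt_nbhsr Mx)).
Unshelve. all: by end_near. Qed.

Lemma Rintegral_derive1_compact f (M : R) : 0 < M ->
  (forall x, M <= `|x| -> f x = 0) -> (forall x : R, derivable f x 1) ->
  continuous (derive1 f) -> \int[mu]_x derive1 f x = 0.
Proof.
move=> M0 f0 df cf.
transitivity (\int[mu]_(x in `[- M, M]) derive1 f x).
  rewrite [RHS]Rintegral_mkcond; apply: Rintegral_congr => x _.
  rewrite patchE; case: ifPn => // xM; apply: (near_zero_derive1 f0).
  by move: xM; rewrite notin_setE/= in_itv/= -ler_norml => /negP; rewrite -ltNge.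
rewrite FTC_C1//; last by lra.
by rewrite !f0 ?subrr// ?normrN gtr0_norm.
Qed.

Lemma test_bound psi : smooth_compact_support psi ->
  exists M C : R, [/\ 0 < M, forall x, M <= `|x| -> psi x = 0 & forall x : R, `|psi x| <= C].
Proof.
move=> [sp cp]; have [M M0 pM] := compact_support_bounded cp.
have : bounded_set (psi @` `[- M, M]).
  apply: compact_bounded; apply: continuous_compact; last exact: segment_compact.
  by apply: continuous_subspaceT; exact: smooth_continuous.
move=> [K [_ hK]]; exists M, (`|K| + 1); split => // v.
have [vM|vM] := leP M `|v|; first by rewrite pM// normr0 addr_ge0.
apply: (hK (`|K| + 1)); first by rewrite (le_lt_trans (ler_norm _))// ltrDl.
by exists v => //=; rewrite in_itv/= -ler_norml ltW.
Qed.

Lemma test_derive1 psi : smooth_compact_support psi ->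
  @smooth_compact_support R (derive1 psi).
Proof.
move=> sp; have [M [C [M0 pM _]]] := test_bound sp.
case: sp => sp _; split; first exact: smooth_derive1.
apply: (@support_compact _ _ (- M) M) => x; apply: contraNT.
rewrite -ler_norml -ltNge => xM; apply/eqP; exact: near_zero_derive1 pM _ xM.
Qed.

Lemma test_continuous psi : smooth_compact_support psi -> continuous psi.
Proof. by move=> [sp _]; exact: smooth_continuous. Qed.

Lemma loc_test_integrable f psi : locally_integrable setT f ->
  smooth_compact_support psi -> mu.-integrable setT (EFin \o (fun x => f x * psi x)).
Proof.
move=> lf sp; have [M [C [M0 pM pC]]] := test_bound sp.
apply: (@loc_integrableM _ _ _ (- M) M C) => //.
  exact: measurable_continuous (test_continuous sp).
move=> x /negP; rewrite -ler_norml -ltNge => /ltW; exact: pM.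
Qed.

Lemma C1_weak_diff h : (forall x : R, derivable h x 1) -> continuous (derive1 h) ->
  weak_diff h (derive1 h).
Proof.
move=> dh ch psi sp; have [M [C [M0 pM _]]] := test_bound sp.
have lh := continuous_loc (derivable_continuous dh).
have lh' := continuous_loc ch.
have dp x : derivable psi x 1 by case: sp => sp _; exact: smooth_derivable.
have cp' : continuous (derive1 psi) by exact: test_continuous (test_derive1 sp).
have E x : derive1 (fun y => h y * psi y) x = h x * derive1 psi x + derive1 h x * psi x.
  rewrite derive1E deriveM; [|exact: dh|exact: dp].
  by rewrite -!derive1E /GRing.scale/= [psi x * _]mulrC.
apply/eqP; rewrite -subr_eq0 opprK -RintegralD//; last 2 first.
- exact: loc_test_integrable (test_derive1 sp).
- exact: loc_test_integrable.
apply/eqP; transitivity (\int[mu]_x derive1 (fun y => h y * psi y) x).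
  by apply: Rintegral_congr => x _; rewrite E.
apply: (Rintegral_derive1_compact M0).
- by move=> x Mx; rewrite pM// mulr0.
- by move=> x; apply: derivableM; [exact: dh|exact: dp].
- rewrite (funext E) => x; apply: cvgD; apply: cvgM.
  + exact: (derivable_continuous dh).
  + exact: cp'.
  + exact: ch.
  + exact: (test_continuous sp).
Qed.

Lemma weak_diff_ae f f' g g' : measurable_fun setT f -> measurable_fun setT f' ->
  measurable_fun setT g -> measurable_fun setT g' ->
  {ae mu, forall x, f x = g x} -> {ae mu, forall x, f' x = g' x} ->
  weak_diff f f' -> weak_diff g g'.
Proof.
move=> mf mf' mg mg' fg fg' w psi sp.
have mp := measurable_continuous (test_continuous sp).
have mp' := measurable_continuous (test_continuous (test_derive1 sp)).
transitivity (\int[mu]_x (f x * derive1 psi x)).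
  apply: ae_eq_Rintegral => //; [exact: measurable_funM|exact: measurable_funM|].
  by apply: ae_mono fg _ => x ->.
rewrite w//; congr (- _); apply: ae_eq_Rintegral => //; [exact: measurable_funM|exact: measurable_funM|].
by apply: ae_mono fg' _ => x ->.
Qed.

(** Two weak derivatives give a representative that is continuously
    differentiable; integrations by parts are then done classically. *)
Lemma weak_diff_C1 f f1 f2 : @has_bump R -> locally_integrable setT f ->
  locally_integrable setT f1 -> locally_integrable setT f2 ->
  weak_diff f f1 -> weak_diff f1 f2 ->
  exists h, [/\ (forall x : R, derivable h x 1), continuous (derive1 h),
    {ae mu, forall x, f x = h x}, {ae mu, forall x, f1 x = derive1 h x} &
    (forall x y, x <= y -> h y - h x = \int[mu]_(t in `[x, y]) f1 t) /\
    (forall x y, x <= y -> derive1 h y - derive1 h x = \int[mu]_(t in `[x, y]) f2 t)].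
Proof.
move=> bump lf lf1 lf2 w w1.
have [h [ch hi fh]] := weak_diff_prim bump lf lf1 w.
have [k [ck ki fk]] := weak_diff_prim bump lf1 lf2 w1.
have hk x y : x <= y -> h y - h x = \int[mu]_(t in `[x, y]) k t.
  move=> xy; rewrite hi//; apply: ae_eq_Rintegral => //.
  - by apply: (@measurable_funS _ _ _ _ setT) => //; case: lf1.
  - by apply: (@measurable_funS _ _ _ _ setT) => //; exact: measurable_continuous.
  - by apply: ae_mono fk _ => z ->.
have dh := increment_derive ck hk.
have hE : derive1 h = k by apply/funext => x; case: (dh x).
exists h; rewrite hE; split => //.
by move=> x; case: (dh x).
Qed.

(** The product rule is proved on the representatives with continuous derivatives. *)
Lemma weak_diffM f f1 f2 g g1 g2 : @has_bump R ->
  locally_integrable setT f -> locally_integrable setT f1 -> locally_integrable setT f2 ->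
  locally_integrable setT g -> locally_integrable setT g1 -> locally_integrable setT g2 ->
  weak_diff f f1 -> weak_diff f1 f2 -> weak_diff g g1 -> weak_diff g1 g2 ->
  weak_diff (fun x => f x * g x) (fun x => f1 x * g x + f x * g1 x).
Proof.
move=> bump lf lf1 lf2 lg lg1 lg2 w w1 v v1.
have [h [dh ch fh f1h _]] := weak_diff_C1 bump lf lf1 lf2 w w1.
have [k [dk ck gk g1k _]] := weak_diff_C1 bump lg lg1 lg2 v v1.
have mh := measurable_continuous (derivable_continuous dh).
have mk := measurable_continuous (derivable_continuous dk).
have mh' := measurable_continuous ch; have mk' := measurable_continuous ck.
have E x : derive1 (fun y => h y * k y) x = derive1 h x * k x + h x * derive1 k x.
  rewrite derive1E deriveM; [|exact: dh|exact: dk].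
  by rewrite -!derive1E /GRing.scale/= addrC [k x * _]mulrC.
have [mf _ _] := lf; have [mf1 _ _] := lf1; have [mg _ _] := lg; have [mg1 _ _] := lg1.
have W : weak_diff (fun x => h x * k x) (derive1 (fun x => h x * k x)).
  apply: C1_weak_diff; first by move=> x; apply: derivableM; [exact: dh|exact: dk].
  rewrite (funext E) => x; apply: cvgD; apply: cvgM.
  + exact: ch.
  + exact: (derivable_continuous dk).
  + exact: (derivable_continuous dh).
  + exact: ck.
apply: weak_diff_ae W.
- exact: measurable_funM.
- rewrite (funext E); apply: measurable_funD; exact: measurable_funM.
- exact: measurable_funM.
- apply: measurable_funD; exact: measurable_funM.
- by apply: ae_mono2 fh gk _ => x -> ->.
- apply: ae_mono (ae_and (ae_and fh gk) (ae_and f1h g1k)) _ => x [[-> ->] [-> ->]].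
  exact: E.
Qed.

End SobolevProducts.

(** * The differential inequality at a fixed time *)

Section SliceInequality.
Context {R : realType}.
Notation mu := (@lebesgue_measure R).
Implicit Types f g h k psi : R -> R.

(** The condition that |w'| be at most C w is what makes the diffusion term absorbable:
    after integration by parts w' is dominated by w itself. *)
Definition weight (C : R) (w : R -> R) :=
  [/\ (forall x, 0 < w x), (forall x : R, derivable w x 1), continuous (derive1 w),
      (forall x, `|derive1 w x| <= C * w x) &
      mu.-integrable setT (EFin \o w)] /\
  ((fun n : nat => w n%:R) @ \oo --> (0:R) /\ (fun n : nat => w (- n%:R)) @ \oo --> (0:R)).

Lemma cvg_bounded_mul (u v : nat -> R) (B : R) : (forall n, `|u n| <= B) ->
  v @ \oo --> (0 : R) -> (fun n => u n * v n) @ \oo --> (0 : R).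
Proof.
move=> uB v0; apply/cvgr0Pnorm_le => e e0.
have B0 : 0 <= B by exact: le_trans (uB 0%N).
have e1 : 0 < e / (B + 1) by rewrite divr_gt0// ltr_wpDl.
move/cvgr0Pnorm_le : v0 => /(_ _ e1); apply: filterS => n vn.
rewrite normrM (le_trans (ler_pM _ _ (uB n) vn))//.
rewrite mulrA ler_pdivrMr ?ltr_wpDl// mulrC ler_wpM2l//; first exact: ltW.
by rewrite lerDl.
Qed.

Lemma Rintegral_centered_cvg f : mu.-integrable setT (EFin \o f) ->
  (fun n : nat => \int[mu]_(x in `[- n%:R, n%:R]) f x) @ \oo --> \int[mu]_x f x.
Proof.
move=> fi; have mf := integrable_measurable fi.
rewrite (_ : (fun n : nat => _) = fun n : nat => \int[mu]_x (f \_ `[- n%:R, n%:R]) x); last first.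
  by apply/funext => n; rewrite Rintegral_mkcond.
apply: (@Rintegral_dominated _ _ _ mu _ f (fun x => `|f x|) setT measurableT _ _ _ _).2.
- move=> n; apply/(measurable_restrictT _ _).1 => //; exact: measurable_funS mf.
- move=> x _; apply: (@cvg_trans _ ((fun=> f x) @ \oo)); last exact: cvg_cst.
  apply: near_eq_cvg; near=> n; rewrite patchE mem_set//= in_itv/= -ler_norml.
  near: n; exact: nbhs_infty_ger.
- exact: integrable_norm.
- by move=> n x _; rewrite patchE; case: ifPn => // _; rewrite normr0.
Unshelve. all: by end_near. Qed.

Lemma ae_le_Rintegral D f g : measurable D ->
  mu.-integrable D (EFin \o f) -> mu.-integrable D (EFin \o g) ->
  {ae mu, forall x, f x <= g x} ->
  \int[mu]_(x in D) f x <= \int[mu]_(x in D) g x.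
Proof.
move=> mD fi gi fg.
have mf := integrable_measurable fi; have mg := integrable_measurable gi.
have mm : measurable_fun D (fun x => Num.min (f x) (g x)) by exact: measurable_minr.
have mi : mu.-integrable D (EFin \o (fun x => Num.min (f x) (g x))).
  apply: (@le_integrableR _ _ _ mu _ _ (fun x => `|f x| + `|g x|)) => //.
    by move=> x _; case: (leP (f x) (g x)) => _; rewrite ?lerDl ?lerDr.
  by apply: integrable_EFinD => //; exact: integrable_norm.
rewrite (@ae_eq_Rintegral _ _ _ mu D f (fun x => Num.min (f x) (g x)))//.
  by apply: le_Rintegral => // x _; rewrite ge_min lexx orbT.
by apply: ae_mono fg _ => x fgx _; rewrite min_l.
Qed.

Lemma L2_ae f g : L2fun f -> measurable_fun setT g ->
  {ae mu, forall x, f x = g x} -> L2fun g.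
Proof.
move=> [mf f2] mg fg; split => //.
apply: (@ae_le_integrableR _ _ _ mu setT _ (fun x => f x ^+ 2)) => //.
  by apply: measurable_funX.
by apply: ae_mono fg _ => x -> _; rewrite ger0_norm// sqr_ge0.
Qed.

Lemma continuous_ae_eq f g : continuous f -> continuous g ->
  {ae mu, forall x, f x = g x} -> f = g.
Proof.
move=> cf cg fg; apply/funext => x; apply/eqP; rewrite eq_le -subr_le0.
rewrite (@continuous_ae_le _ (fun x => f x - g x) 0)/=.
- rewrite -subr_le0 (@continuous_ae_le _ (fun x => g x - f x) 0)//.
    by move=> y; apply: cvgB; [exact: cg|exact: cf].
  by apply: ae_mono fg _ => y ->; rewrite subrr.
- by move=> y; apply: cvgB; [exact: cf|exact: cg].
- by apply: ae_mono fg _ => y ->; rewrite subrr.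
Qed.

(** With f the time derivative of the potential and G0 the potential,
    integrating by parts in the term a1 exp(- G0) w turns the integrand into
    (a0^2 / 2 + b0^2 / 2 + C^2 / 2) exp(- G0) w - a0 exp(- G0) w', and the bound on
    w' leaves at least half the square of |a0| - C. *)
Lemma slice_inequality (C B : R) (w a0 a1 a2 b0 G0 : R -> R) : @has_bump R ->
  weight C w -> L2fun a0 -> L2fun a1 -> L2fun a2 -> measurable_fun setT b0 ->
  measurable_fun setT G0 -> (forall x, `|G0 x| <= B) ->
  weak_diff a0 a1 -> weak_diff a1 a2 -> weak_diff G0 a0 ->
  mu.-integrable setT (EFin \o (fun x => (a1 x - (a0 x ^+ 2 - b0 x ^+ 2) / 2) * w x)) ->
  0 <= \int[mu]_x ((a1 x - (a0 x ^+ 2 - b0 x ^+ 2) / 2 + C ^+ 2 / 2) * expR (- G0 x) * w x).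
Proof.
move=> bump [[w0 dw cw wC iw] [wp wn]] L0 L1 L2 mb mG GB wa0 wa1 wG if1.
have l0 := L2_loc L0; have l1 := L2_loc L1; have l2 := L2_loc L2.
have lG : locally_integrable setT G0.
  apply: loc_integrableP => // a b.
  apply: measurable_bounded_integrable => //.
  - by rewrite /= lebesgue_measure_itv; case: ifPn => // _; rewrite -EFinB ltry.
  - exact: measurable_funS mG.
  - exists B; split; first by rewrite num_real.
    by move=> z Bz x _ /=; rewrite (le_trans (GB x))// ltW.
have [h [dh ch ah ah1 [hi h1i]]] := weak_diff_C1 bump l0 l1 l2 wa0 wa1.
have [G [dG cG aG aG0 _]] := weak_diff_C1 bump lG l0 l1 wG wa0.
have chh := derivable_continuous dh; have cGG := derivable_continuous dG.
have G1 : derive1 G = h.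
  by apply: continuous_ae_eq => //; apply: ae_mono2 aG0 ah _ => x <- <-.
have GB' x : `|G x| <= B.
  apply: (@continuous_ae_le _ (fun x => `|G x|)).
    by move=> y; apply: cvg_norm; exact: cGG.
  by apply: ae_mono aG _ => y <-.
have [H hH] : exists H, forall x, `|h x| <= H.
  have L2h : L2fun h by apply: L2_ae L0 _ ah; exact: measurable_continuous.
  exists (1 + 2 * (\int[mu]_y (h y ^+ 2) + \int[mu]_y (a1 y ^+ 2))) => x.
  have := increment_sup_bound L2h L1 hi x.
  rewrite -[X in X <= _ -> _]real_normK ?num_real//.
  have := normr_ge0 (h x); nra.
pose e x := expR (- G x) * w x.
have e0 x : 0 < e x by rewrite mulr_gt0// expR_gt0.
have de x : derivable e x 1 /\ derive1 e x = - h x * e x + expR (- G x) * derive1 w x.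
  have dGx : is_derive x 1 G (h x) by rewrite -G1 derive1E; apply: DeriveDef.
  have dE : is_derive x 1 (fun y => expR (- G y)) (expR (- G x) * - h x).
    by apply: is_derive1_comp.
  have [dE1 dE2] := dE; split; first by apply: derivableM; [exact: dE1|exact: dw].
  rewrite derive1E deriveM; [|exact: dE1|exact: dw].
  rewrite dE2 -derive1E /GRing.scale/= /e; ring.
have dhe x : derivable (fun x => h x * e x) x 1 /\
    derive1 (fun x => h x * e x) x = derive1 h x * e x + h x * derive1 e x.
  have [de1 _] := de x.
  split; first by apply: derivableM; [exact: dh|exact: de1].
  rewrite derive1E deriveM; [|exact: dh|exact: de1].
  by rewrite -!derive1E /GRing.scale/=; ring.
have ce : continuous e by apply: derivable_continuous => x; case: (de x).
have ce' : continuous (derive1 e).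
  rewrite (funext (fun x => (de x).2)) => x; apply: cvgD; apply: cvgM.
  - by apply: cvgN; exact: chh.
  - exact: ce.
  - apply: (@continuous_comp _ _ _ (fun x => - G x) expR).
      by apply: cvgN; exact: cGG.
    exact: continuous_expR.
  - exact: cw.
have che : continuous (derive1 (fun x => h x * e x)).
  rewrite (funext (fun x => (dhe x).2)) => x; apply: cvgD; apply: cvgM.
  - exact: ch.
  - exact: ce.
  - exact: chh.
  - exact: ce'.
pose F x := (a1 x - (a0 x ^+ 2 - b0 x ^+ 2) / 2 + C ^+ 2 / 2) * expR (- G0 x) * w x.
have iF : mu.-integrable setT (EFin \o F).
  have -> : F = fun x => expR (- G0 x) *
      ((a1 x - (a0 x ^+ 2 - b0 x ^+ 2) / 2) * w x + C ^+ 2 / 2 * w x).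
    by apply/funext => x; rewrite /F; ring.
  apply: (@integrable_boundedM _ _ _ mu setT _ _ (expR B)) => //.
  - by apply: measurableT_comp => //; exact: measurableT_comp.
  - move=> x _; rewrite ger0_norm ?expR_ge0// ler_expR.
    by have := GB x; rewrite ler_norml => /andP[]; lra.
  - by apply: integrable_EFinD => //; exact: integrable_EFinZ.
have Fge : {ae mu, forall x, derive1 (fun x => h x * e x) x <= F x}.
  apply: ae_mono (ae_and (ae_and ah ah1) aG) _ => x [[hx h1x] Gx].
  have [_ ->] := dhe x; have [_ ->] := de x; rewrite /F hx h1x Gx /e.
  rewrite -subr_ge0.
  set E := expR (- G x).
  have -> : (derive1 h x - (h x ^+ 2 - b0 x ^+ 2) / 2 + C ^+ 2 / 2) * E * w x -
     (derive1 h x * (E * w x) + h x * (- h x * (E * w x) + E * derive1 w x)) =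
     E * ((h x ^+ 2 / 2 + b0 x ^+ 2 / 2 + C ^+ 2 / 2) * w x - h x * derive1 w x) by field.
  apply: mulr_ge0; first exact: expR_ge0.
  have := wC x; rewrite ler_norml => /andP[w1 w2].
  have C0 : 0 <= C by have := w0 x; have := normr_ge0 (derive1 w x); have := wC x; nra.
  have b2 : 0 <= b0 x ^+ 2 / 2 * w x by rewrite mulr_ge0 ?divr_ge0 ?sqr_ge0// ltW.
  have : h x * derive1 w x <= `|h x| * (C * w x).
    by rewrite (le_trans (ler_norm _))// normrM ler_wpM2l.
  have : 0 <= (`|h x| - C) ^+ 2 * w x by rewrite mulr_ge0 ?sqr_ge0// ltW.
  rewrite -[h x ^+ 2]real_normK ?num_real//; lra.
have cF := Rintegral_centered_cvg iF.
have hb n : h n%:R * e n%:R - h (- n%:R) * e (- n%:R) <= \int[mu]_(x in `[- n%:R, n%:R]) F x.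
  have nn : - n%:R <= n%:R :> R by rewrite (@le_trans _ _ 0)// oppr_le0.
  rewrite -(@FTC_C1 _ (fun x => h x * e x) _ _ nn _ che); last by move=> x; case: (dhe x).
  apply: ae_le_Rintegral => //; last exact: integrableS iF.
  apply: continuous_compact_integrable; first exact: segment_compact.
  exact: continuous_subspaceT.
have c0 : (fun n : nat => h n%:R * e n%:R - h (- n%:R) * e (- n%:R)) @ \oo --> (0 : R).
  have hE u : `|h u * expR (- G u)| <= H * expR B.
    rewrite normrM ler_pM// ger0_norm ?expR_ge0// ler_expR.
    by have := GB' u; rewrite ler_norml => /andP[]; lra.
  rewrite -[X in _ --> X](subrr 0); apply: cvgB; rewrite /e; under eq_fun do rewrite mulrA;
    by apply: (@cvg_bounded_mul _ _ (H * expR B)) => // n; exact: hE.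
apply: (ler_cvg_to c0 cF); exact: nearW.
Qed.

End SliceInequality.

(** * The exponential of an absolutely continuous function *)

Section ExponentialChainRule.
Context {R : realType}.
Notation mu := (@lebesgue_measure R).
Implicit Types f g h k : R -> R.

Lemma primitive_exists g : locally_integrable setT g ->
  exists2 h : R -> R, h 0 = 0 & forall x y, x <= y -> h y - h x = \int[mu]_(t in `[x, y]) g t.
Proof.
move=> lg.
exists (fun x => if 0 <= x then \int[mu]_(t in `[0, x]) g t else - \int[mu]_(t in `[x, 0]) g t).
  by rewrite lexx set_itv1 Rintegral_set1.
move=> x y xy; have [x0|x0] := leP 0 x.
  by rewrite (le_trans x0 xy) (Rintegral_itv_split lg x0 xy) addrC addKr.
have [y0|y0] := leP 0 y.
  by rewrite opprK (Rintegral_itv_split lg (ltW x0) y0) addrC.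
by rewrite opprK (Rintegral_itv_split lg xy (ltW y0)) addrC -addrA subrr addr0.
Qed.

Lemma expR_lipschitz (B x y : R) : x <= B -> y <= B ->
  `|expR x - expR y| <= expR B * `|x - y|.
Proof.
wlog xy : x y / y <= x.
  by move=> H xB yB; have [/H|/ltW/H] := leP y x; [exact|rewrite distrC (distrC x); exact].
move=> xB _; rewrite !ger0_norm ?subr_ge0 ?ler_expR//.
have -> : expR x - expR y = expR x * (1 - expR (y - x)).
  by rewrite mulrBr mulr1 -expRD; congr (_ - expR _); lra.
have := expR_ge1Dx (y - x) => h1.
apply: (@le_trans _ _ (expR x * (x - y))).
  by rewrite ler_wpM2l ?expR_ge0//; lra.
by rewrite ler_wpM2r ?subr_ge0// ler_expR.
Qed.

Lemma Rintegral_opp D f : measurable D -> mu.-integrable D (EFin \o f) ->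
  \int[mu]_(x in D) (- f x) = - \int[mu]_(x in D) f x.
Proof.
move=> mD fi; rewrite -mulN1r -RintegralZl//.
by apply: Rintegral_congr => x _; rewrite mulN1r.
Qed.

(** Only the integrated form of h' = f is available, with f integrable; f is approximated in
    L^1 by continuous functions, for which the chain rule is classical. *)
Lemma exp_chain_rule f h (a b : R) : a <= b -> locally_integrable setT f ->
  (forall x y, x <= y -> h y - h x = \int[mu]_(t in `[x, y]) f t) ->
  expR (- h b) - expR (- h a) = - \int[mu]_(t in `[a, b]) (f t * expR (- h t)).
Proof.
move=> ab lf hf.
have ch := increment_continuous lf hf.
pose I : set R := `[a, b]%classic.
have mI : measurable I by exact: measurable_itv.
have ifI : mu.-integrable I (EFin \o f) by exact: loc_integrable_itv.
have muI : (mu I < +oo)%E.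
  by rewrite /I lebesgue_measure_itv; case: ifPn => // _; rewrite -EFinB ltry.
have [g [cg ig g0]] := approximation_continuous_integrable mI muI ifI.
pose dl n := \int[mu]_(t in I) `|f t - g n t|.
have dl0 : dl @ \oo --> (0 : R) by apply: fine_cvg; exact: g0.
have idl n : mu.-integrable I (EFin \o (fun t => `|f t - g n t|)).
  by apply: integrable_norm; apply: integrable_EFinB.
pose A := \int[mu]_(t in I) `|f t|.
have A0 : 0 <= A by apply: Rintegral_ge0.
have dl_ge0 n : 0 <= dl n by apply: Rintegral_ge0.
have in_ext (k : R -> R) t : mu.-integrable I (EFin \o k) -> I t ->
    \int[mu]_(s in `[a, t]) `|k s| <= \int[mu]_(s in I) `|k s|.
  move=> ik; rewrite /I/= in_itv/= => /andP[at_ tb].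
  by apply: ge0_le_RintegralS => //; [apply: subset_itvl; rewrite bnd_simp|exact: integrable_norm].
have hb t : I t -> `|h t - h a| <= A.
  move=> It; have := It; rewrite /I/= in_itv/= => /andP[at_ tb].
  rewrite hf//; apply: (le_trans (le_normr_Rintegral _ _)) => //.
    exact: loc_integrable_itv.
  exact: in_ext.
pose B := `|h a| + A + 1.
have key n : dl n <= 1 ->
  `|expR (- h b) - expR (- h a) + \int[mu]_(t in I) (f t * expR (- h t))| <=
  (expR B * (2 + A)) * dl n.
  move=> d1.
  have [k k0 kg] := primitive_exists (continuous_loc (cg n)).
  have dk := increment_derive (cg n) kg.
  pose H t := h a + (k t - k a).
  have dH t : derivable (fun t => expR (- H t)) t 1 /\
      derive1 (fun t => expR (- H t)) t = - (g n t * expR (- H t)).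
    have [dk1 dk2] := dk t.
    have dkt : is_derive t 1 k (g n t) by rewrite -dk2 derive1E; apply: DeriveDef.
    have dHt : is_derive t 1 H (g n t).
      rewrite -[g n t](subr0) -[X in is_derive _ _ _ X](add0r); rewrite /H.
      by apply: is_deriveD; apply: is_deriveB.
    have dE : is_derive t 1 (fun y => expR (- H y)) (expR (- H t) * - g n t).
      by apply: is_derive1_comp.
    have [dE1 dE2] := dE; split; first exact: dE1.
    by rewrite derive1E dE2 mulrN mulrC.
  have cH : continuous H.
    have ck : continuous k by apply: derivable_continuous => x; case: (dk x).
    move=> x; apply: cvgD; first exact: cvg_cst.
    by apply: cvgB; [exact: ck|exact: cvg_cst].
  have Hh t : I t -> `|H t - h t| <= dl n.
    move=> It; have := It; rewrite /I/= in_itv/= => /andP[at_ tb].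
    have lg := continuous_loc (cg n).
    have -> : H t - h t = - \int[mu]_(s in `[a, t]) (f s - g n s).
      rewrite RintegralB//; [|exact: loc_integrable_itv|exact: loc_integrable_itv].
      rewrite -hf// -kg// /H; ring.
    rewrite normrN; apply: (le_trans (le_normr_Rintegral _ _)) => //.
      by apply: integrable_EFinB => //; exact: loc_integrable_itv.
    by apply: in_ext => //; exact: integrable_EFinB.
  have FTCn : expR (- H b) - expR (- H a) = - \int[mu]_(t in I) (g n t * expR (- H t)).
    have cge : continuous (fun t => g n t * expR (- H t)).
      move=> x; apply: cvgM; first exact: cg.
      apply: (@continuous_comp _ _ _ (fun x => - H x) expR).
        by apply: cvgN; exact: cH.
      exact: continuous_expR.
    rewrite -(FTC_C1 ab (fun x => (dH x).1)).
      rewrite -Rintegral_opp//; last exact: loc_integrable_itv (continuous_loc cge).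
      by apply: Rintegral_congr => x _; case: (dH x).
    by rewrite (funext (fun x => (dH x).2)) => x; apply: cvgN; exact: cge.
  have hB t : I t -> - h t <= B.
    move=> /hb; rewrite ler_norml /B => /andP[h1 h2].
    by have := ler_norm (- h a); rewrite normrN; lra.
  have HB t : I t -> - H t <= B.
    move=> It; have := hb t It; have := Hh t It.
    rewrite !ler_norml /B => /andP[h1 h2] /andP[h3 h4].
    by have := ler_norm (- h a); rewrite normrN; lra.
  have Ha : H a = h a by rewrite /H subrr addr0.
  have e1 : `|expR (- h b) - expR (- H b)| <= expR B * dl n.
    have Ib : I b by rewrite /I/= in_itv/= ab lexx.
    apply: (le_trans (expR_lipschitz (hB _ Ib) (HB _ Ib))).
    rewrite ler_wpM2l ?expR_ge0//.
    have -> : - h b - - H b = H b - h b by ring.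
    exact: Hh.
  have ie (u v : R -> R) : mu.-integrable I (EFin \o u) -> continuous v -> (forall t, I t -> - v t <= B) ->
      mu.-integrable I (EFin \o (fun t => u t * expR (- v t))).
    move=> iu cv vB.
    rewrite (_ : (fun t => u t * _) = fun t => expR (- v t) * u t); last first.
      by apply/funext => t; rewrite mulrC.
    apply: (@integrable_boundedM _ _ _ mu I _ _ (expR B)) => //.
    - apply: (@measurable_funS _ _ _ _ setT) => //; apply: measurable_continuous => x.
      apply: (@continuous_comp _ _ _ (fun x => - v x) expR).
        by apply: cvgN; exact: cv.
      exact: continuous_expR.
    - by move=> t It; rewrite ger0_norm ?expR_ge0// ler_expR vB.
  have e2 : `|\int[mu]_(t in I) (f t * expR (- h t)) - \int[mu]_(t in I) (g n t * expR (- H t))|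
     <= expR B * (1 + A) * dl n.
    have i1 := ie f h ifI ch hB; have i2 := ie (g n) H (ig n) cH HB.
    rewrite -RintegralB//.
    apply: (le_trans (le_normr_Rintegral _ _)) => //; first exact: integrable_EFinB.
    have -> : expR B * (1 + A) * dl n =
      \int[mu]_(t in I) (expR B * `|f t - g n t| + expR B * dl n * `|f t|).
      rewrite RintegralD//; [|exact: integrable_EFinZ|apply: integrable_EFinZ => //; exact: integrable_norm].
      rewrite RintegralZl// RintegralZl//; last exact: integrable_norm.
      rewrite -/(dl n) -/A; ring.
    apply: le_Rintegral => //.
    - by apply: integrable_norm; exact: integrable_EFinB.
    - by apply: integrable_EFinD => //; apply: integrable_EFinZ => //; exact: integrable_norm.
    move=> t It.
    have -> : f t * expR (- h t) - g n t * expR (- H t) =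
      (f t - g n t) * expR (- H t) + f t * (expR (- h t) - expR (- H t)) by ring.
    apply: (le_trans (ler_normD _ _)); rewrite !normrM; apply: lerD.
      by rewrite mulrC ler_wpM2r// ger0_norm ?expR_ge0// ler_expR HB.
    rewrite [leRHS]mulrC ler_wpM2l//.
    apply: (le_trans (expR_lipschitz (hB _ It) (HB _ It))).
    rewrite ler_wpM2l ?expR_ge0//.
    have -> : - h t - - H t = H t - h t by ring.
    exact: Hh.
  have -> : expR (- h b) - expR (- h a) + \int[mu]_(t in I) (f t * expR (- h t)) =
     (expR (- h b) - expR (- H b)) + (\int[mu]_(t in I) (f t * expR (- h t)) -
       \int[mu]_(t in I) (g n t * expR (- H t))).
    rewrite -[X in _ - X](opprK) -FTCn Ha; ring.
  apply: (le_trans (ler_normD _ _)); lra.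
apply/eqP; rewrite -subr_eq0 opprK -normr_le0.
apply/ler_addgt0Pr => e e0; rewrite add0r.
have [n [dn1 dn2]] : exists n, dl n <= 1 /\ expR B * (2 + A) * dl n <= e.
  have e1 : 0 < e / (expR B * (2 + A)) by rewrite divr_gt0// mulr_gt0 ?expR_gt0//; lra.
  move/cvgr0Pnorm_le : dl0 => h0.
  have [n _ /(_ n (leqnn n))] := filterI (h0 _ ltr01) (h0 _ e1).
  rewrite /= => -[]; rewrite ger0_norm// => n1 n2; exists n; split => //.
  by rewrite mulrC -ler_pdivlMr// mulr_gt0 ?expR_gt0//; lra.
exact: le_trans (key n dn1) dn2.
Qed.

End ExponentialChainRule.

(** * Time evolution of exponential integrals *)

Section ProductIntegrals.
Context {R : realType}.
Notation mu := (@lebesgue_measure R).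

Lemma measurable_Rintegral_param d (X : measurableType d) (F : X * R -> R) :
  measurable_fun setT F -> measurable_fun setT (fun x => \int[mu]_s F (x, s)).
Proof.
move=> mF.
have mp : measurable_fun setT (EFin \o F) by exact/measurable_EFinP.
have e x : (\int[mu]_s (F (x, s))%:E =
   \int[mu]_s ((EFin \o F)^\+ (x, s)) - \int[mu]_s ((EFin \o F)^\- (x, s)))%E.
  rewrite [LHS]integralE; congr (_ - _)%E; apply: eq_integral => s _.
    by rewrite !funeposE.
  by rewrite !funenegE.
rewrite /Rintegral; under eq_fun do rewrite e.
apply: measurableT_comp; first exact: fine_measurable.
apply: emeasurable_funB.
  apply: (measurable_fun_fubini_tonelli_F (m2 := mu)) => //.
  exact: measurable_funepos.
apply: (measurable_fun_fubini_tonelli_F (m2 := mu)) => //.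
exact: measurable_funeneg.
Qed.

Lemma measurable_section1 (F : R * R -> R) x : measurable_fun setT F ->
  measurable_fun setT (fun y => F (x, y)).
Proof. by move=> mF; apply: (measurableT_comp mF); exact: pair1_measurable. Qed.

Lemma measurable_section2 (F : R * R -> R) y : measurable_fun setT F ->
  measurable_fun setT (fun x => F (x, y)).
Proof. by move=> mF; apply: (measurableT_comp mF); exact: pair2_measurable. Qed.

Lemma fine_integral_ae (u : R -> \bar R) : measurable_fun setT u ->
  {ae mu, forall x, u x \is a fin_num} ->
  (\int[mu]_x (fine (u x))%:E = \int[mu]_x u x)%E.
Proof.
move=> mu_ fu; apply: ae_eq_integral => //.
- by apply/measurable_EFinP; apply: measurableT_comp => //; exact: fine_measurable.
- by apply: ae_mono fu _ => x ux _; rewrite fineK.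
Qed.

Lemma Rintegral_fubini (F : R * R -> R) :
  (mu \x mu)%E.-integrable setT (EFin \o F) ->
  \int[mu]_x \int[mu]_y F (x, y) = \int[mu]_y \int[mu]_x F (x, y).
Proof.
move=> iF; rewrite /Rintegral fine_integral_ae.
- rewrite fine_integral_ae; first by rewrite (Fubini iF).
    exact: measurable_fubini_G iF.
  by apply: ae_mono (ae_integrable2 iF) _ => x ix; exact: integrable_fin_num ix.
- exact: measurable_fubini_F iF.
- by apply: ae_mono (ae_integrable1 iF) _ => x ix; exact: integrable_fin_num ix.
Qed.

Lemma integrable_fine (u : R -> \bar R) : mu.-integrable setT u ->
  mu.-integrable setT (EFin \o (fine \o u)).
Proof.
move=> iu; apply: (le_integrable measurableT _ _ iu).
- apply/measurable_EFinP; apply: measurableT_comp; first exact: fine_measurable.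
  by case/integrableP : iu.
- by move=> x _ /=; case: (u x) => [r||]//=; rewrite normr0 ?lee_fin// leey.
Qed.

Lemma integrable_Rfubini1 (F : R * R -> R) :
  (mu \x mu)%E.-integrable setT (EFin \o F) ->
  mu.-integrable setT (EFin \o (fun x => \int[mu]_y F (x, y))).
Proof. by move=> iF; exact: integrable_fine (integrable_fubini_F iF). Qed.

Lemma integrable_Rfubini2 (F : R * R -> R) :
  (mu \x mu)%E.-integrable setT (EFin \o F) ->
  mu.-integrable setT (EFin \o (fun y => \int[mu]_x F (x, y))).
Proof.
move=> iF; apply: integrable_fine; apply/integrableP; split.
  exact: measurable_fubini_G iF.
have mF : measurable_fun setT (EFin \o F) by case/integrableP : iF.
have mGG := measurable_fubini_G iF.
have /(integrable21ltyP mu mu mF) := iF; apply: le_lt_trans.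
apply: ge0_le_integral => //.
- exact: measurableT_comp mGG.
- have ma : measurable_fun setT (abse \o (EFin \o F)) by exact: measurableT_comp.
  have h := @measurable_fun_fubini_tonelli_G _ _ _ _ R mu (abse \o (EFin \o F)) ma.
  exact: (h (fun p => abse_ge0 _)).
- move=> y _; apply: le_abse_integral => //.
  apply/measurable_EFinP; apply: measurable_section2; exact/measurable_EFinP.
Qed.

Lemma integrable_tensor (u v : R -> R) : mu.-integrable setT (EFin \o u) ->
  mu.-integrable setT (EFin \o v) ->
  (mu \x mu)%E.-integrable setT (EFin \o (fun p => u p.1 * v p.2)).
Proof.
move=> iu iv.
have mu_ := integrable_measurable iu; have mv := integrable_measurable iv.
apply/integrable12ltyP.
  apply/measurable_EFinP; apply: measurable_funM; first exact: measurableT_comp.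
  exact: measurableT_comp.
have c x : (\int[mu]_y `|(u x * v y)%:E| = `|u x|%:E * \int[mu]_y `|v y|%:E)%E.
  under eq_integral do rewrite /= normrM EFinM.
  by rewrite ge0_integralZl//; apply/measurable_EFinP; exact: measurableT_comp.
rewrite /=; under eq_integral do rewrite c.
have v0 : (0 <= \int[mu]_y `|v y|%:E)%E by apply: integral_ge0 => y _; rewrite lee_fin.
rewrite ge0_integralZr//; last by apply/measurable_EFinP; exact: measurableT_comp.
have /integrableP[_ iu'] := iu; have /integrableP[_ iv'] := iv.
by apply: lte_mul_pinfty => //; [apply: integral_ge0 => y _; rewrite lee_fin|rewrite ge0_fin_numE//; apply: integral_ge0 => y _; rewrite lee_fin].
Qed.

Lemma measurable_cumulative (f : R * R -> R) : measurable_fun setT f ->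
  measurable_fun setT (fun p : R * R => \int[mu]_(s in `[0, p.1]) f (s, p.2)).
Proof.
move=> mf.
pose F (q : (R * R) * R) := if (0 <= q.2) && (q.2 <= q.1.1) then f (q.2, q.1.2) else 0.
have mF : measurable_fun setT F.
  apply: measurable_fun_ifT.
  - apply: measurable_and; apply: measurable_fun_ler => //.
    exact: measurableT_comp measurable_fst measurable_fst.
  - apply: (measurableT_comp mf); apply: measurable_fun_pair => //.
    exact: measurableT_comp measurable_snd measurable_fst.
  - exact: measurable_cst.
rewrite (_ : (fun p : R * R => _) = fun p => \int[mu]_s F (p, s)).
  exact: measurable_Rintegral_param.
apply/funext => p; rewrite Rintegral_mkcond; apply: Rintegral_congr => s _.
rewrite patchE /F /=; case: ifPn; rewrite ?notin_setE ?inE/= in_itv/=.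
  by move=> ->.
by move=> /negP/negbTE ->.
Qed.

(** For fixed x the chain rule writes exp(- G(t)) - exp(- Phi) as a time integral;
    by Fubini its integral in x has the sign given by the assumption at each time. *)
Lemma evolution (f : R * R -> R) (K w Phi : R -> R) (M T t : R) :
  measurable_fun setT f -> mu.-integrable setT (EFin \o K) ->
  (forall s x, `|f (s, x)| <= K s) -> measurable_fun setT Phi ->
  (forall x, `|Phi x| <= M) -> (forall x, 0 <= w x) ->
  mu.-integrable setT (EFin \o w) ->
  (let G s x := Phi x + \int[mu]_(r in `[0, s]) f (r, x) in
  {ae mu, forall s, 0 < s < T ->
     0 <= \int[mu]_x (f (s, x) * expR (- G s x) * w x)} ->
  0 < t < T ->
  \int[mu]_x (expR (- G t x) * w x) <= \int[mu]_x (expR (- Phi x) * w x)).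
Proof.
move=> mf iK fK mPhi PhiM w0 iw G Hs t0T.
have /andP[t0 tT] := t0T.
have if_ x : mu.-integrable setT (EFin \o (fun s => f (s, x))).
  apply: (@le_integrableR _ _ _ mu _ _ K) => //; exact: measurable_section2.
have lf x : locally_integrable setT (fun s => f (s, x)).
  apply: loc_integrableP; first exact: measurable_section2.
  by move=> a b; exact: integrableS (if_ x).
pose A := \int[mu]_s `|K s|.
have GB s x : `|G s x| <= M + A.
  rewrite (le_trans (ler_normD _ _))// lerD//.
  apply: (le_trans (le_normr_Rintegral _ _)) => //; first exact: integrableS (if_ x).
  apply: (@le_trans _ _ (\int[mu]_(r in `[0, s]) `|K r|)).
    apply: le_Rintegral => //.
    - by apply: integrable_norm; exact: integrableS (if_ x).
    - by apply: integrable_norm; exact: integrableS iK.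
    - by move=> r _; rewrite (le_trans (fK _ _))// ler_norm.
  by apply: ge0_le_RintegralS => //; exact: integrable_norm.
have mG : measurable_fun setT (fun p : R * R => G p.1 p.2).
  apply: measurable_funD; first exact: measurableT_comp.
  exact: measurable_cumulative.
have chain x : expR (- G t x) - expR (- Phi x) =
    - \int[mu]_(s in `[0, t]) (f (s, x) * expR (- G s x)).
  have [h h0 hi] := primitive_exists (lf x).
  have e s : 0 <= s -> G s x = Phi x + h s by move=> s0; rewrite /G -hi// h0 subr0.
  have hP a b : a <= b -> Phi x + h b - (Phi x + h a) = \int[mu]_(r in `[a, b]) f (r, x).
    by move=> ab; rewrite -hi//; ring.
  have := exp_chain_rule (ltW t0) (lf x) hP.
  rewrite -(e t (ltW t0)) h0 addr0 => ->.
  congr (- _); apply: Rintegral_congr => s; rewrite /= in_itv/= => /andP[s0 _].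
  by rewrite (e s s0).
pose F (p : R * R) := if (0 <= p.2) && (p.2 <= t) then
   f (p.2, p.1) * expR (- G p.2 p.1) * w p.1 else 0.
have mw := integrable_measurable iw.
have mF : measurable_fun setT F.
  apply: measurable_fun_ifT.
  - by apply: measurable_and; exact: measurable_fun_ler.
  - apply: measurable_funM; last exact: measurableT_comp.
    have msw : measurable_fun [set: R * R] (fun p : R * R => (p.2, p.1)) by exact: measurable_swap.
    apply: measurable_funM; first exact: (measurableT_comp mf msw).
    apply: measurableT_comp => //; apply: measurableT_comp => //.
    exact: (measurableT_comp mG msw).
  - exact: measurable_cst.
have Ksgn s : 0 <= K s by exact: le_trans (fK s 0).
have bnd s x : `|expR (- G s x)| <= expR (M + A).
  rewrite ger0_norm ?expR_ge0// ler_expR.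
  by have := GB s x; rewrite ler_norml => /andP[]; lra.
have iF : (mu \x mu)%E.-integrable setT (EFin \o F).
  apply: (@le_integrableR _ _ _ (mu \x mu)%E setT F
     (fun p => (expR (M + A) * w p.1) * K p.2)) => //.
    move=> [x s] _; rewrite /F/=; case: ifPn => _; last first.
      by rewrite normr0 !mulr_ge0// expR_ge0.
    rewrite !normrM (ger0_norm (w0 x)).
    have -> : expR (M + A) * w x * K s = K s * expR (M + A) * w x by ring.
    by apply: ler_wpM2r; [exact: w0|apply: ler_pM].
  exact: (@integrable_tensor (fun x => expR (M + A) * w x) K (integrable_EFinZ _ _ iw) iK).
have i1 s : mu.-integrable setT (EFin \o (fun x => expR (- G s x) * w x)).
  apply: (@integrable_boundedM _ _ _ mu setT _ _ (expR (M + A))) => //.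
  apply: measurableT_comp => //; apply: measurableT_comp => //.
  exact: (measurable_section1 s mG).
have i0 : mu.-integrable setT (EFin \o (fun x => expR (- Phi x) * w x)).
  apply: (@integrable_boundedM _ _ _ mu setT _ _ (expR M)) => //.
    by apply: measurableT_comp => //; exact: measurableT_comp.
  move=> x _; rewrite ger0_norm ?expR_ge0// ler_expR.
  by have := PhiM x; rewrite ler_norml => /andP[]; lra.
rewrite -subr_le0 -RintegralB//.
have -> : \int[mu]_x (expR (- G t x) * w x - expR (- Phi x) * w x) =
    - \int[mu]_x \int[mu]_s F (x, s).
  rewrite -Rintegral_opp//; last exact: integrable_Rfubini1.
  apply: Rintegral_congr => x _; rewrite -mulrBl chain mulNr; congr (- _).
  rewrite -RintegralZr//; last first.
    apply: (@le_integrableR _ _ _ mu _ _ (fun s => expR (M + A) * K s)) => //.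
    - apply: measurable_funM; first exact: measurable_funS (measurable_section2 x mf).
      apply: measurableT_comp => //; apply: measurableT_comp => //.
      exact: measurable_funS (measurable_section2 x mG).
    - by move=> s _; rewrite normrM mulrC ler_pM.
    - by apply: integrable_EFinZ => //; exact: integrableS iK.
  rewrite Rintegral_mkcond; apply: Rintegral_congr => s _.
  rewrite patchE /F /=; case: ifPn; rewrite ?notin_setE ?inE/= in_itv/=.
    by move=> ->.
  by move=> /negP/negbTE ->.
rewrite Rintegral_fubini// oppr_le0.
rewrite -(@Rintegral_eq0 _ _ _ mu setT (fun=> 0))//.
have iz : mu.-integrable setT (EFin \o (fun=> 0 : R)) by exact: integrable0.
apply: (ae_le_Rintegral measurableT iz (integrable_Rfubini2 iF)).
apply: ae_mono2 Hs (ae_neq 0) _ => s Hs s0; rewrite /F /=.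
have [/andP[s0' st]|_] := boolP (0 <= s <= t); last by rewrite Rintegral_eq0.
by apply: Hs; rewrite lt_neqAle eq_sym s0 s0' (le_lt_trans st).
Qed.

End ProductIntegrals.

(** * Exchanging almost everywhere quantifiers *)

Section SwapAlmostEverywhere.
Context {R : realType}.
Notation mu := (@lebesgue_measure R).

Lemma integral_abs_eq0_ae (u : R -> \bar R) : measurable_fun setT u ->
  (\int[mu]_x `|u x| = 0)%E -> {ae mu, forall x, u x = 0%E}.
Proof.
move=> mu_ u0; have := (ae_eq_integral_abs mu measurableT mu_).1 u0.
by move=> h; apply: ae_mono h _ => x; apply.
Qed.

Lemma ae_integral_eq0 (u : R -> \bar R) : measurable_fun setT u ->
  {ae mu, forall x, u x = 0%E} -> (\int[mu]_x u x = 0)%E.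
Proof.
move=> mu_ u0; rewrite (ae_eq_integral (cst 0%E)) ?integral0//.
by apply: ae_mono u0 _ => x ->.
Qed.

Section swap.
Variables (f g : R * R -> R).
Hypotheses (mf : measurable_fun setT f) (mg : measurable_fun setT g).
Let h p := (`|(f p - g p)%:E|)%E.
Let mh : measurable_fun setT h.
Proof. by apply: measurableT_comp => //; apply/measurable_EFinP; exact: measurable_funB. Qed.
Let h0 p : (0 <= h p)%E. Proof. exact: abse_ge0. Qed.
Let mF := @measurable_fun_fubini_tonelli_F _ _ _ _ R mu h mh h0.
Let mG := @measurable_fun_fubini_tonelli_G _ _ _ _ R mu h mh h0.

(** Both sides say that the integral of |f - g| over the plane vanishes. *)
Lemma ae_swap : {ae mu, forall s, {ae mu, forall x, f (s, x) = g (s, x)}} ->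
  {ae mu, forall x, {ae mu, forall s, f (s, x) = g (s, x)}}.
Proof.
move=> fg.
have e : (\int[mu]_x \int[mu]_s h (s, x) = 0)%E.
  rewrite -(@fubini_tonelli _ _ _ _ R mu mu h mh h0); apply: ae_integral_eq0; first exact: mF.
  apply: ae_mono fg _ => s fgs; apply: ae_integral_eq0.
    by apply: (measurableT_comp mh); exact: pair1_measurable.
  by apply: ae_mono fgs _ => x; rewrite /h => ->; rewrite subrr abse0.
have h1 : {ae mu, forall x, fubini_G mu h x = 0%E}.
  apply: integral_abs_eq0_ae; first exact: mG.
  rewrite -[RHS]e; apply: eq_integral => x _; rewrite gee0_abs//.
  exact: integral_ge0.
apply: ae_mono h1 _ => x hx.
have h2 : {ae mu, forall s, (f (s, x) - g (s, x))%:E = 0%E}.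
  apply: integral_abs_eq0_ae; last exact: hx.
  apply/measurable_EFinP; apply: measurable_funB; exact: measurable_section2.
apply: ae_mono h2 _ => s; move=> [] /eqP; rewrite subr_eq0 => /eqP; exact.
Qed.

End swap.

Lemma ae_swap_inv (f g : R * R -> R) : measurable_fun setT f -> measurable_fun setT g ->
  {ae mu, forall x, {ae mu, forall s, f (s, x) = g (s, x)}} ->
  {ae mu, forall s, {ae mu, forall x, f (s, x) = g (s, x)}}.
Proof.
move=> mf mg; apply: (@ae_swap (fun p => f (p.2, p.1)) (fun p => g (p.2, p.1))).
  by apply: (measurableT_comp mf); exact: measurable_swap.
by apply: (measurableT_comp mg); exact: measurable_swap.
Qed.

End SwapAlmostEverywhere.

(** * The exponential energy estimate *)

Section ExponentialEnergy.
Context {R : realType}.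
Notation mu := (@lebesgue_measure R).

Definition sqint (f : R * R -> R) :=
  measurable_fun setT f /\ (mu \x mu)%E.-integrable setT (EFin \o (fun p => f p ^+ 2)).

(** The constant is uniform in the slice, so that the flux below has a bound
    that depends on time alone. *)
Lemma weak_diff_sup_bound (f g : R -> R) : @has_bump R -> L2fun f -> L2fun g ->
  weak_diff f g ->
  {ae mu, forall x, f x ^+ 2 <= 2 * (\int[mu]_y (f y ^+ 2) + \int[mu]_y (g y ^+ 2))}.
Proof.
move=> bump Lf Lg fg.
have [h [ch hg fh]] := weak_diff_prim bump (L2_loc Lf) (L2_loc Lg) fg.
have mh := measurable_continuous ch.
have Lh := L2_ae Lf mh fh.
have e : \int[mu]_y (f y ^+ 2) = \int[mu]_y (h y ^+ 2).
  apply: ae_eq_Rintegral => //.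
  - by apply: measurable_funX; case: Lf.
  - exact: measurable_funX.
  - by apply: ae_mono fh _ => x ->.
rewrite e; apply: ae_mono fh _ => x ->; exact: increment_sup_bound.
Qed.

Lemma sqint_slices f : sqint f -> {ae mu, forall s, L2fun (fun x => f (s, x))}.
Proof.
move=> [mf f2]; apply: ae_mono (ae_integrable1 f2) _ => s fs; split => //.
exact: measurable_section1.
Qed.

Lemma sqint_norm_integrable f : sqint f ->
  mu.-integrable setT (EFin \o (fun s => \int[mu]_x (f (s, x) ^+ 2))).
Proof. by move=> [mf f2]; exact: (integrable_Rfubini1 f2). Qed.

Lemma slice_norm_ge0 (u : R * R -> R) (s : R) : 0 <= \int[mu]_x (u (s, x) ^+ 2).
Proof. by apply: Rintegral_ge0 => x _; exact: sqr_ge0. Qed.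

Lemma le_add_expR (s M : R) : s <= M + expR (s - M).
Proof. by have := expR_ge1Dx (s - M); lra. Qed.

Lemma shift_cancel (a b c : R) : b - c - (a + b) = - a - c.
Proof. lra. Qed.

Section energy.
Variables (T C M : R) (w Phi : R -> R) (a0 a1 a2 b0 b1 : R * R -> R).
Hypotheses (bump : @has_bump R) (T0 : 0 < T) (wC : weight C w)
  (mPhi : measurable_fun setT Phi) (PhiM : forall x, `|Phi x| <= M).
Hypotheses (sa0 : sqint a0) (sa1 : sqint a1) (sa2 : sqint a2) (sb0 : sqint b0)
  (sb1 : sqint b1).
Hypothesis slices : {ae mu, forall s, 0 < s < T ->
  [/\ weak_diff (fun x => a0 (s, x)) (fun x => a1 (s, x)),
      weak_diff (fun x => a1 (s, x)) (fun x => a2 (s, x)) &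
      weak_diff (fun x => b0 (s, x)) (fun x => b1 (s, x))]}.
Definition flux p := a1 p - (a0 p ^+ 2 - b0 p ^+ 2) / 2.
(** The real part of the Cole-Hopf potential of a solution with real part a0 and
    imaginary part b0. *)
Definition height (t x : R) := Phi x + \int[mu]_(s in `[0, t]) flux (s, x).
Hypothesis slicesG : {ae mu, forall s, 0 < s < T ->
  weak_diff (height s) (fun x => a0 (s, x))}.

Definition rate := C ^+ 2 / 2.
(** The Sobolev embedding bounds the flux on almost every time slice by this
    integrable function of time. *)
Definition flux_bound (s : R) := 1 + 2 * (\int[mu]_x (a1 (s, x) ^+ 2) + \int[mu]_x (a2 (s, x) ^+ 2)) +
  (\int[mu]_x (a0 (s, x) ^+ 2) + \int[mu]_x (a1 (s, x) ^+ 2)) +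
  (\int[mu]_x (b0 (s, x) ^+ 2) + \int[mu]_x (b1 (s, x) ^+ 2)).
Definition in_time (s : R) := (0 < s) && (s < T).
(** The flux shifted by the growth rate and set to zero on a null set, so that the
    bound by a function of time holds at every point. *)
Definition flux_cut p := if in_time p.1 && (`|flux p| <= flux_bound p.1) then flux p + rate else 0.
Definition flux_shift p := if in_time p.1 then flux p + rate else 0.
Definition cut_bound (s : R) := if in_time s then flux_bound s + rate else 0.
Definition height_cut (t x : R) := Phi x + \int[mu]_(s in `[0, t]) flux_cut (s, x).

Lemma rate_ge0 : 0 <= rate. Proof. by rewrite divr_ge0// sqr_ge0. Qed.

Lemma flux_bound_ge1 (s : R) : 1 <= flux_bound s.
Proof.
have := slice_norm_ge0 a0 s; have := slice_norm_ge0 a1 s; have := slice_norm_ge0 a2 s.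
have := slice_norm_ge0 b0 s; have := slice_norm_ge0 b1 s; rewrite /flux_bound; lra.
Qed.

Lemma measurable_flux : measurable_fun setT flux.
Proof.
rewrite /flux; apply: measurable_funB; first by case: sa1.
apply: measurable_funM; last exact: measurable_cst.
by apply: measurable_funB; apply: measurable_funX; [case: sa0|case: sb0].
Qed.

Lemma measurable_flux_bound : measurable_fun setT flux_bound.
Proof.
have m (u : R * R -> R) : sqint u -> measurable_fun setT (fun s => \int[mu]_x (u (s, x) ^+ 2)).
  by move=> /sqint_norm_integrable/integrable_measurable.
rewrite /flux_bound; apply: measurable_funD; last by apply: measurable_funD; exact: m.
apply: measurable_funD; last by apply: measurable_funD; exact: m.
apply: measurable_funD => //; apply: measurable_funM => //.
by apply: measurable_funD; exact: m.
Qed.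

Lemma measurable_in_time : measurable_fun setT (fun s : R => in_time s).
Proof. by apply: measurable_and; exact: measurable_fun_ltr. Qed.

Lemma measurable_flux_cut : measurable_fun setT flux_cut.
Proof.
have mfl := measurable_flux.
apply: measurable_fun_ifT; [|exact: measurable_funD|exact: measurable_cst].
apply: measurable_and; first exact: measurableT_comp measurable_in_time measurable_fst.
apply: measurable_fun_ler; first exact: measurableT_comp.
exact: measurableT_comp measurable_flux_bound measurable_fst.
Qed.

Lemma measurable_flux_shift : measurable_fun setT flux_shift.
Proof.
have mfl := measurable_flux.
apply: measurable_fun_ifT; [|exact: measurable_funD|exact: measurable_cst].
exact: measurableT_comp measurable_in_time measurable_fst.
Qed.

Lemma in_timeE (s : R) : (in_time s) = (s \in `]0, T[).
Proof. by rewrite in_itv. Qed.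

Lemma integrable_cut_bound : mu.-integrable setT (EFin \o cut_bound).
Proof.
have n (u : R * R -> R) (su : sqint u) :
    mu.-integrable `]0, T[ (EFin \o (fun s => \int[mu]_x (u (s, x) ^+ 2))).
  by apply: integrableS (sqint_norm_integrable su).
have c (r : R) : mu.-integrable `]0, T[ (EFin \o (fun=> r)).
  apply: measurable_bounded_integrable => //.
  - by rewrite /= lebesgue_measure_itv/=; case: ifPn => // _; rewrite -EFinB ltry.
  - exists `|r|; split; first by rewrite num_real.
    by move=> z rz x _ /=; exact: ltW.
have ik : mu.-integrable `]0, T[ (EFin \o (fun s => flux_bound s + rate)).
  apply: integrable_EFinD => //.
  do 2 (apply: integrable_EFinD; [by []| |by apply: integrable_EFinD; [by []|exact: n|exact: n]]).
  apply: integrable_EFinD => //; apply: integrable_EFinZ => //.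
  by apply: integrable_EFinD => //; exact: n.
rewrite (_ : EFin \o cut_bound = (EFin \o (fun s => flux_bound s + rate)) \_ `]0, T[).
  by rewrite -integrable_mkcond.
apply/funext => s; rewrite patchE /cut_bound /= in_timeE.
by case: ifPn => h; [rewrite mem_set|rewrite memNset//=; exact/negP].
Qed.

Lemma flux_cut_le (s x : R) : `|flux_cut (s, x)| <= cut_bound s.
Proof.
have r0 := rate_ge0.
rewrite /flux_cut /cut_bound /=; case: ifPn => [/andP[-> h]|_].
  by rewrite (le_trans (ler_normD _ _))// lerD// ger0_norm.
rewrite normr0; case: ifPn => // _; rewrite addr_ge0//; exact: le_trans (flux_bound_ge1 s).
Qed.

Lemma flux_cutE : {ae mu, forall s, {ae mu, forall x, flux_cut (s, x) = flux_shift (s, x)}}.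
Proof.
have h := ae_and (ae_and (ae_and (sqint_slices sa0) (sqint_slices sa1))
  (ae_and (sqint_slices sa2) (sqint_slices sb0))) (ae_and (sqint_slices sb1) slices).
apply: ae_mono h _ => s [[[L0 L1] [L2 M0]] [M1 ws]].
rewrite /flux_cut /flux_shift /=; have [sT|_] := boolP (in_time s); last exact: aeW.
have [w1 w2 w3] := ws sT.
have B0 := weak_diff_sup_bound bump L0 L1 w1.
have B1 := weak_diff_sup_bound bump L1 L2 w2.
have D0 := weak_diff_sup_bound bump M0 M1 w3.
apply: ae_mono (ae_and (ae_and B0 B1) D0) _ => x [[h0 h1] h2] /=.
have -> // : `|flux (s, x)| <= flux_bound s.
rewrite /flux /flux_bound.
have n1 : `|a1 (s, x)| <= 1 + a1 (s, x) ^+ 2.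
  by rewrite -[a1 (s, x) ^+ 2]real_normK ?num_real//; have := normr_ge0 (a1 (s, x)); nra.
have n2 : `|(a0 (s, x) ^+ 2 - b0 (s, x) ^+ 2) / 2| <= a0 (s, x) ^+ 2 / 2 + b0 (s, x) ^+ 2 / 2.
  by rewrite ler_norml; have := sqr_ge0 (a0 (s, x)); have := sqr_ge0 (b0 (s, x)); lra.
apply: (le_trans (ler_normB _ _)); lra.
Qed.

Lemma height_cutE : {ae mu, forall x, forall t, 0 < t < T ->
  [/\ mu.-integrable `[0, t] (EFin \o (fun s => flux (s, x))) & height_cut t x = height t x + rate * t]}.
Proof.
have r0 := rate_ge0; have iK := integrable_cut_bound.
have mf := measurable_flux; have mfl := measurable_flux_cut.
have h := ae_swap measurable_flux_cut measurable_flux_shift flux_cutE.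
apply: ae_mono h _ => x hx t /andP[t0 tT].
have I0 : {ae mu, forall s, `[0, t]%classic s -> flux_cut (s, x) = flux (s, x) + rate}.
  apply: ae_mono2 hx (ae_neq 0) _ => s -> s0; rewrite /= in_itv/= => /andP[s1 s2].
  by rewrite /flux_shift /in_time /= lt_neqAle eq_sym s0 s1 (le_lt_trans s2 tT).
have mfx := measurable_section2 x measurable_flux; have mflx := measurable_section2 x measurable_flux_cut.
have c0 : mu.-integrable `[0, t] (EFin \o (fun=> rate)).
  exact: loc_integrable_itv (continuous_loc (fun x => cvg_cst rate)).
have iflx : mu.-integrable `[0, t] (EFin \o (fun s => flux_cut (s, x))).
  apply: (@le_integrableR _ _ _ mu _ _ cut_bound).
  - exact: measurable_itv.
  - exact: measurable_funS mflx.
  - by move=> s _; exact: flux_cut_le.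
  - exact: integrableS iK.
have ifx : mu.-integrable `[0, t] (EFin \o (fun s => flux (s, x))).
  apply: (@ae_le_integrableR _ _ _ mu _ _ (fun s => `|flux_cut (s, x)| + rate)) => //.
  - exact: measurable_funS mfx.
  - apply: ae_mono I0 _ => s hs Is; rewrite hs// -[X in _ <= _ + X]ger0_norm//.
    by rewrite -{1}[flux (s, x)](addrK rate) (le_trans (ler_normB _ _)).
  - by apply: integrable_EFinD => //; exact: integrable_norm.
split => //; rewrite /height_cut /height -addrA; congr (_ + _).
rewrite (@ae_eq_Rintegral _ _ _ mu _ _ (fun s => flux (s, x) + rate))//.
- have mt : fine (mu `[0, t]%classic) = t.
    by rewrite lebesgue_measure_itv/= lte_fin t0 -EFinB subr0.
  by rewrite RintegralD// Rintegral_cst// mt.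
- exact: measurable_funS mflx.
- by apply: measurable_funD => //; exact: measurable_funS mfx.
Qed.

Lemma measurable_height_cut : measurable_fun setT (fun p : R * R => height_cut p.1 p.2).
Proof.
have mfl := measurable_flux_cut.
by apply: measurable_funD; [exact: measurableT_comp|exact: measurable_cumulative].
Qed.

Lemma measurable_height : measurable_fun setT (fun p : R * R => height p.1 p.2).
Proof.
have mf := measurable_flux.
by apply: measurable_funD; [exact: measurableT_comp|exact: measurable_cumulative].
Qed.

Definition cut_mass := \int[mu]_s `|cut_bound s|.
Lemma height_cut_le (s x : R) : `|height_cut s x| <= M + cut_mass.
Proof.
have iK := integrable_cut_bound; have mfl := measurable_flux_cut.
rewrite (le_trans (ler_normD _ _))// lerD//.
have ix : mu.-integrable `[0, s] (EFin \o (fun r => flux_cut (r, x))).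
  apply: (@le_integrableR _ _ _ mu _ _ cut_bound).
  - exact: measurable_itv.
  - exact: measurable_funS (measurable_section2 x mfl).
  - by move=> r _; exact: flux_cut_le.
  - exact: integrableS iK.
apply: (le_trans (le_normr_Rintegral _ _)) => //.
apply: (@le_trans _ _ (\int[mu]_(r in `[0, s]) `|cut_bound r|)).
  apply: le_Rintegral => //.
  - exact: integrable_norm.
  - by apply: integrable_norm; exact: integrableS integrable_cut_bound.
  - by move=> r _; rewrite (le_trans (flux_cut_le _ _))// ler_norm.
by apply: ge0_le_RintegralS => //; exact: integrable_norm.
Qed.

(** The shift by rate * s of the potential cancels at a fixed time, because it only
    multiplies the integral by a positive constant; what remains is the slice
    inequality. *)
Lemma slice_nonneg : {ae mu, forall s, 0 < s < T ->
  0 <= \int[mu]_x (flux_cut (s, x) * expR (- height_cut s x) * w x)}.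
Proof.
have GB := height_cut_le; have KB := flux_cut_le.
have r0 := rate_ge0; have mf := measurable_flux; have mfl := measurable_flux_cut.
have h := ae_and (ae_and (ae_and (sqint_slices sa0) (sqint_slices sa1))
  (ae_and (sqint_slices sa2) (sqint_slices sb0))) (ae_and slices slicesG).
apply: ae_mono2 h flux_cutE _ => s [[[L0 L1] [L2 [mb0 _]]] [ws wsG]] fE sT.
have [w1 w2 _] := ws sT.
have [s0 sT'] := andP sT.
have iw : mu.-integrable setT (EFin \o w) by case: wC => -[].
have w_ge0 x : 0 <= w x by case: wC => -[w0 _ _ _ _] _; exact: ltW.
have mw := integrable_measurable iw.
(* the height itself, almost everywhere *)
pose G0 x := height_cut s x - rate * s.
have mGls : measurable_fun setT (height_cut s) by exact: (measurable_section1 s measurable_height_cut).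
have mG0 : measurable_fun setT G0 by exact: measurable_funB.
have mfs := measurable_section1 s measurable_flux; have mfls := measurable_section1 s measurable_flux_cut.
have G0B x : `|G0 x| <= M + cut_mass + rate * s.
  by rewrite (le_trans (ler_normB _ _))// lerD// ger0_norm// mulr_ge0// ltW.
have wG0 : weak_diff G0 (fun x => a0 (s, x)).
  apply: weak_diff_ae (wsG sT) => //.
  - exact: (measurable_section1 s measurable_height).
  - by case: L0.
  - by case: L0.
  - by apply: ae_mono height_cutE _ => x /(_ s sT)[_ e]; rewrite /G0 e addrK.
  - exact: aeW.
have fE' : {ae mu, forall x, flux_cut (s, x) = flux (s, x) + rate}.
  by apply: ae_mono fE _ => x ->; rewrite /flux_shift /= /in_time sT.
have ifw : mu.-integrable setT (EFin \o (fun x => flux (s, x) * w x)).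
  apply: (@ae_le_integrableR _ _ _ mu _ _ (fun x => (cut_bound s + rate) * w x)) => //.
  - exact: measurable_funM.
  - apply: ae_mono fE' _ => x e _; rewrite normrM (ger0_norm (w_ge0 x)) ler_wpM2r//.
    have := flux_cut_le s x; rewrite e => h'; rewrite -[flux (s, x)](addrK rate).
    by rewrite (le_trans (ler_normB _ _))// lerD// ger0_norm.
  - exact: integrable_EFinZ.
have := slice_inequality bump wC L0 L1 L2 mb0 mG0 G0B w1 w2 wG0 ifw.
have -> : \int[mu]_x (flux_cut (s, x) * expR (- height_cut s x) * w x) =
  \int[mu]_x (expR (- (rate * s)) * ((a1 (s, x) - (a0 (s, x) ^+ 2 - b0 (s, x) ^+ 2) / 2 + rate) *
     expR (- G0 x) * w x)).
  apply: ae_eq_Rintegral => //.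
  - apply: measurable_funM => //; apply: measurable_funM => //.
    by apply: measurableT_comp => //; exact: measurableT_comp.
  - apply: measurable_funM => //; apply: measurable_funM => //; apply: measurable_funM => //.
      exact: measurable_funD.
    by apply: measurableT_comp => //; exact: measurableT_comp.
  - apply: ae_mono fE' _ => x -> _; rewrite -/(flux (s, x)).
    have -> : expR (- height_cut s x) = expR (- (rate * s)) * expR (- G0 x).
      by rewrite -expRD /G0; congr expR; lra.
    ring.
move=> h0; rewrite RintegralZl//; first by rewrite mulr_ge0// expR_ge0.
rewrite (_ : (fun x => _) = fun x => expR (- G0 x) * (flux (s, x) * w x + rate * w x)); last first.
  by apply/funext => x; rewrite -/(flux (s, x)); ring.
apply: (@integrable_boundedM _ _ _ mu setT _ _ (expR (M + cut_mass + rate * s))) => //.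
- by apply: measurableT_comp => //; exact: measurableT_comp.
- move=> x _; rewrite ger0_norm ?expR_ge0// ler_expR.
  by have := G0B x; rewrite ler_norml => /andP[]; lra.
- by apply: integrable_EFinD => //; exact: integrable_EFinZ.
Qed.

(** Combines the growth estimate for the integral of exp(- height) w with the
    inequality - s <= M + exp(- s - M), which needs no control of the sign of the
    height. *)
Lemma exp_energy (t : R) : 0 < t < T ->
  mu.-integrable setT (EFin \o (fun x => height t x * w x)) /\
  - (\int[mu]_x (height t x * w x)) <= (M + expR (rate * T)) * \int[mu]_x w x.
Proof.
have GB := height_cut_le; have KB := flux_cut_le.
have r0 := rate_ge0; have mf := measurable_flux; have mfl := measurable_flux_cut.
move=> tT; have [t0 tT'] := andP tT.
have iw : mu.-integrable setT (EFin \o w) by case: wC => -[].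
have w_ge0 x : 0 <= w x by case: wC => -[w0 _ _ _ _] _; exact: ltW.
have mw := integrable_measurable iw.
have E := evolution measurable_flux_cut integrable_cut_bound flux_cut_le mPhi PhiM w_ge0 iw slice_nonneg tT.
have mGlt : measurable_fun setT (height_cut t) by exact: (measurable_section1 t measurable_height_cut).
have mGt : measurable_fun setT (height t) by exact: (measurable_section1 t measurable_height).
have iGw : mu.-integrable setT (EFin \o (fun x => height t x * w x)).
  apply: (@ae_le_integrableR _ _ _ mu _ _ (fun x => (M + cut_mass + rate * t) * w x)) => //.
  - exact: measurable_funM.
  - apply: ae_mono height_cutE _ => x /(_ t tT)[_ e] _; rewrite normrM (ger0_norm (w_ge0 x)) ler_wpM2r//.
    rewrite -[height t x](addrK (rate * t)) -e (le_trans (ler_normB _ _))// lerD//.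
    by rewrite ger0_norm// mulr_ge0// ltW.
  - exact: integrable_EFinZ.
split => //.
have ie : mu.-integrable setT (EFin \o (fun x => expR (- height_cut t x) * w x)).
  apply: (@integrable_boundedM _ _ _ mu setT _ _ (expR (M + cut_mass))) => //.
  - by apply: measurableT_comp => //; exact: measurableT_comp.
  - move=> x _; rewrite ger0_norm ?expR_ge0// ler_expR.
    by have := height_cut_le t x; rewrite ler_norml => /andP[]; lra.
have iP : mu.-integrable setT (EFin \o (fun x => expR (- Phi x) * w x)).
  apply: (@integrable_boundedM _ _ _ mu setT _ _ (expR M)) => //.
  - by apply: measurableT_comp => //; exact: measurableT_comp.
  - move=> x _; rewrite ger0_norm ?expR_ge0// ler_expR.
    by have := PhiM x; rewrite ler_norml => /andP[]; lra.
have E1 : \int[mu]_x (expR (- Phi x) * w x) <= expR M * \int[mu]_x w x.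
  rewrite -(RintegralZl (expR M) measurableT iw).
  apply: le_Rintegral; [exact: measurableT|exact: iP|exact: integrable_EFinZ|].
  move=> x _; rewrite ler_wpM2r// ler_expR.
  by have := PhiM x; rewrite ler_norml => /andP[]; lra.
have E2 : - (\int[mu]_x (height t x * w x)) <=
    \int[mu]_x (M * w x + expR (rate * t - M) * (expR (- height_cut t x) * w x)).
  rewrite -Rintegral_opp//; apply: ae_le_Rintegral => //.
  - exact: integrable_EFinN.
  - by apply: integrable_EFinD => //; exact: integrable_EFinZ.
  apply: ae_mono height_cutE _ => x /(_ t tT)[_ e].
  rewrite -mulNr mulrA -mulrDl ler_wpM2r// -expRD e.
  by rewrite (le_trans (le_add_expR _ M))// lerD2l ler_expR shift_cancel.
apply: (le_trans E2).
rewrite RintegralD//; [|exact: integrable_EFinZ|exact: integrable_EFinZ].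
rewrite !RintegralZl// mulrDl lerD2l.
apply: (@le_trans _ _ (expR (rate * t - M) * (expR M * \int[mu]_x w x))).
  by rewrite ler_wpM2l ?expR_ge0//; exact: le_trans E E1.
rewrite mulrA -expRD subrK ler_wpM2r//; first exact: Rintegral_ge0.
by rewrite ler_expR ler_wpM2l// ltW.
Qed.

End energy.
End ExponentialEnergy.

(** * Absolutely convergent complex series *)

Section ComplexSeries.
Context {R : realType}.
Local Open Scope complex_scope.
Notation Re := complex.Re.
Notation Im := complex.Im.
Implicit Types (z w : R[i]) (c d : nat -> R[i]) (u v : nat -> R).

(** A norm equivalent to the modulus; unlike the modulus of R[i] it takes its values
    in R, where the theory of series is available. *)
Definition cab z : R := `|Re z| + `|Im z|.

Lemma cab_ge0 z : 0 <= cab z. Proof. exact: addr_ge0. Qed.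

Lemma ReD z w : Re (z + w) = Re z + Re w. Proof. by case: z => ? ?; case: w. Qed.
Lemma ImD z w : Im (z + w) = Im z + Im w. Proof. by case: z => ? ?; case: w. Qed.
Lemma ReM z w : Re (z * w) = Re z * Re w - Im z * Im w.
Proof. by case: z => ? ?; case: w. Qed.
Lemma ImM z w : Im (z * w) = Re z * Im w + Im z * Re w.
Proof. by case: z => ? ?; case: w. Qed.
Lemma ReN z : Re (- z) = - Re z. Proof. by case: z. Qed.
Lemma ImN z : Im (- z) = - Im z. Proof. by case: z. Qed.
Lemma Re_sum I (r : seq I) (P : pred I) (F : I -> R[i]) :
  Re (\sum_(i <- r | P i) F i) = \sum_(i <- r | P i) Re (F i).
Proof. by elim/big_rec2: _ => // i x y _ <-; rewrite ReD. Qed.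
Lemma Im_sum I (r : seq I) (P : pred I) (F : I -> R[i]) :
  Im (\sum_(i <- r | P i) F i) = \sum_(i <- r | P i) Im (F i).
Proof. by elim/big_rec2: _ => // i x y _ <-; rewrite ImD. Qed.

Lemma cabD z w : cab (z + w) <= cab z + cab w.
Proof. by rewrite /cab ReD ImD addrACA lerD// ler_normD. Qed.

Lemma cabM z w : cab (z * w) <= cab z * cab w.
Proof.
rewrite /cab ReM ImM (le_trans (lerD (ler_normB _ _) (ler_normD _ _)))//.
by rewrite !normrM mulrDl !mulrDr; lra.
Qed.

Lemma cab1 : cab 1 = 1. Proof. by rewrite /cab/= normr1 normr0 addr0. Qed.
Lemma cab0 : cab 0 = 0. Proof. by rewrite /cab/= normr0 addr0. Qed.

Lemma cabX z n : cab (z ^+ n) <= cab z ^+ n.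
Proof.
elim: n => [|n ih]; first by rewrite !expr0 cab1.
by rewrite !exprS (le_trans (cabM _ _))// ler_wpM2l ?cab_ge0.
Qed.

Lemma Re_le_cab z : `|Re z| <= cab z. Proof. by rewrite lerDl. Qed.
Lemma Im_le_cab z : `|Im z| <= cab z. Proof. by rewrite lerDr. Qed.

Lemma cab_sum I (r : seq I) (P : pred I) (F : I -> R[i]) :
  cab (\sum_(i <- r | P i) F i) <= \sum_(i <- r | P i) cab (F i).
Proof.
elim/big_rec2: _ => [|i x y _ h]; first by rewrite cab0.
by rewrite (le_trans (cabD _ _))// lerD2l.
Qed.

Lemma sqr_cab_le z : cab z ^+ 2 <= 2 * sqmod z.
Proof.
rewrite /cab /sqmod -[Re z ^+ 2]real_normK ?num_real// -[Im z ^+ 2]real_normK ?num_real//.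
by have := sqr_ge0 (`|Re z| - `|Im z|); lra.
Qed.

Lemma complex_eq z w : Re z = Re w -> Im z = Im w -> z = w.
Proof. by case: z => ? ?; case: w => ? ? /= -> ->. Qed.

Definition csummable c := cvgn (series (fun n => cab (c n))).
Definition csum c : R[i] :=
  limn (series (fun n => Re (c n))) +i* limn (series (fun n => Im (c n))).

Lemma cab_series_nd c : nondecreasing_seq (series (fun n => cab (c n))).
Proof. by apply: nondecreasing_series => i _ _; exact: cab_ge0. Qed.

Lemma csummable_bounded c (B : R) : (forall N, series (fun n => cab (c n)) N <= B) ->
  csummable c /\ limn (series (fun n => cab (c n))) <= B.
Proof.
move=> h; have cv : csummable c.
  apply: nondecreasing_is_cvgn; first exact: cab_series_nd.
  by exists B => _ [N _ <-].
by split => //; apply: limr_le => //; exact: nearW.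
Qed.

Lemma csummable_le c v : (forall n, cab (c n) <= v n) -> cvgn (series v) -> csummable c.
Proof.
move=> cv; apply: (series_le_cvg (fun n => cab_ge0 _) _ cv) => n.
exact: le_trans (cab_ge0 _) (cv n).
Qed.

Lemma is_cvg_real_series u c : (forall n, `|u n| <= cab (c n)) -> csummable c ->
  cvgn (series u).
Proof.
move=> uc cc; apply: (@normed_cvg R R^o).
exact: (series_le_cvg (fun n => normr_ge0 _) (fun n => cab_ge0 _) uc cc).
Qed.

Lemma csum_cvgRe c : csummable c -> series (fun n => Re (c n)) @ \oo --> Re (csum c).
Proof. by move=> cc; apply: is_cvg_real_series cc => n; exact: Re_le_cab. Qed.

Lemma csum_cvgIm c : csummable c -> series (fun n => Im (c n)) @ \oo --> Im (csum c).
Proof. by move=> cc; apply: is_cvg_real_series cc => n; exact: Im_le_cab. Qed.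

Lemma csum_eq c z : series (fun n => Re (c n)) @ \oo --> Re z ->
  series (fun n => Im (c n)) @ \oo --> Im z -> csum c = z.
Proof.
move=> hr hi; apply: complex_eq; first exact: (cvg_lim (@Rhausdorff R) hr).
exact: (cvg_lim (@Rhausdorff R) hi).
Qed.

Lemma cab_csum_le c : csummable c -> cab (csum c) <= 2 * limn (series (fun n => cab (c n))).
Proof.
move=> cc.
have h u : (forall n, `|u n| <= cab (c n)) -> `|limn (series u)| <= limn (series (fun n => cab (c n))).
  move=> uc; have cu : cvgn [normed series u].
    exact: (series_le_cvg (fun n => normr_ge0 _) (fun n => cab_ge0 _) uc cc).
  apply: (le_trans (@lim_series_norm R R^o _ cu)).
  by apply: lim_series_le.
rewrite /cab mulrDl mul1r; apply: lerD; apply: h => n; [exact: Re_le_cab|exact: Im_le_cab].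
Qed.

Lemma csummableD c d : csummable c -> csummable d -> csummable (fun n => c n + d n).
Proof.
move=> cc cd; apply: (@csummable_le _ (fun n => cab (c n) + cab (d n))) => [n|].
  exact: cabD.
exact: (is_cvg_seriesD cc cd).
Qed.

Lemma csumD c d : csummable c -> csummable d ->
  csum (fun n => c n + d n) = csum c + csum d.
Proof.
move=> cc cd; apply: csum_eq.
- rewrite ReD (_ : series _ = series (fun n => Re (c n)) \+ series (fun n => Re (d n))).
    by apply: cvgD; exact: csum_cvgRe.
  by apply/funext => n; rewrite /series /= -big_split/=; apply: eq_bigr => i _; rewrite ReD.
- rewrite ImD (_ : series _ = series (fun n => Im (c n)) \+ series (fun n => Im (d n))).
    by apply: cvgD; exact: csum_cvgIm.
  by apply/funext => n; rewrite /series /= -big_split/=; apply: eq_bigr => i _; rewrite ImD.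
Qed.

Lemma csummableZ (k : R[i]) c : csummable c -> csummable (fun n => k * c n).
Proof.
move=> cc; apply: (@csummable_le _ (fun n => cab k * cab (c n))) => [n|].
  exact: cabM.
exact: (@is_cvg_seriesZ _ (fun n => cab (c n)) (cab k) cc).
Qed.

Lemma csumZ (k : R[i]) c : csummable c -> csum (fun n => k * c n) = k * csum c.
Proof.
move=> cc; have hr := csum_cvgRe cc; have hi := csum_cvgIm cc.
have e (a b : R) (u v w : nat -> R) (x y : R) : (forall n, w n = a * u n + b * v n) ->
    series u @ \oo --> x -> series v @ \oo --> y -> series w @ \oo --> a * x + b * y.
  move=> wE ux vy; rewrite (_ : series w = (fun n => a * series u n + b * series v n)).
    by apply: cvgD; apply: cvgMr.
  apply/funext => n; rewrite /series /= !mulr_sumr -big_split/=.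
  by apply: eq_bigr => i _; exact: wE.
apply: csum_eq.
- rewrite ReM -mulNr; apply: e hr hi => n; by rewrite ReM mulNr.
- rewrite ImM; apply: e hi hr => n; by rewrite ImM.
Qed.

End ComplexSeries.

(** * Cauchy products *)

Section CauchyProduct.

Definition conv (A : pzRingType) (a b : nat -> A) (n : nat) : A :=
  \sum_(i < n.+1) a i * b (n - i)%N.

Lemma series_conv (A : pzRingType) (a b : nat -> A) N :
  \sum_(0 <= n < N) conv a b n = \sum_(i < N) a i * \sum_(0 <= j < N - i) b j.
Proof.
elim: N => [|N ih]; first by rewrite big_nil big_ord0.
rewrite big_nat_recr//= ih big_ord_recr/= subSnn big_nat1 /conv big_ord_recr/= subnn.
rewrite addrA; congr (_ + _); rewrite -big_split/=; apply: eq_bigr => i _.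
by rewrite subSn ?big_nat_recr ?mulrDr//=; exact: ltnW.
Qed.

Lemma sum_nat_sub (A : pzRingType) (f : nat -> A) k N : (k <= N)%N ->
  \sum_(0 <= j < N) f j - \sum_(0 <= j < k) f j = \sum_(k <= j < N) f j.
Proof. by move=> kN; apply/eqP; rewrite subr_eq addrC -big_cat_nat. Qed.

Context {R : realType}.
Local Open Scope complex_scope.
Notation Re := complex.Re.
Notation Im := complex.Im.

(** For nonnegative terms the partial sums satisfy W_N <= U_N V_N <= W_2N; in general the
    error is at most the difference U_N V_N - W_N formed with absolute values. *)
Lemma cauchy_product (a b : nat -> R) :
  cvgn (series (fun n => `|a n|)) -> cvgn (series (fun n => `|b n|)) ->
  [/\ cvgn (series (conv (fun n => `|a n|) (fun n => `|b n|))),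
   limn (series (conv (fun n => `|a n|) (fun n => `|b n|))) <=
     limn (series (fun n => `|a n|)) * limn (series (fun n => `|b n|)) &
   series (conv a b) @ \oo --> limn (series a) * limn (series b)].
Proof.
move=> ca cb; set u := fun n => `|a n|; set v := fun n => `|b n|.
pose U N : R := \sum_(0 <= i < N) u i; pose V N : R := \sum_(0 <= i < N) v i.
pose W N : R := \sum_(0 <= n < N) conv u v n.
have u0 n : 0 <= u n by exact: normr_ge0.
have v0 n : 0 <= v n by exact: normr_ge0.
have Vmono m n : (m <= n)%N -> V m <= V n.
  by move=> mn; rewrite -subr_ge0 /V sum_nat_sub// sumr_ge0.
have V0 n : 0 <= V n by apply: sumr_ge0.
have U0 n : 0 <= U n by apply: sumr_ge0.
have WE N : W N = \sum_(i < N) u i * V (N - i)%N by exact: series_conv.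
have UE N : U N = \sum_(i < N) u i by rewrite /U big_mkord.
have WU N : W N <= U N * V N.
  rewrite WE UE mulr_suml; apply: ler_sum => i _; rewrite ler_wpM2l// Vmono//.
  exact: leq_subr.
have W2 N : U N * V N <= W N.*2.
  rewrite WE UE mulr_suml -addnn big_split_ord/= -[leLHS]addr0; apply: lerD.
    apply: ler_sum => i _; rewrite ler_wpM2l// Vmono//.
    by rewrite -addnBA ?leq_addr// ltnW.
  by apply: sumr_ge0 => i _; exact: mulr_ge0.
have cU : U @ \oo --> limn (series u) by exact: ca.
have cV : V @ \oo --> limn (series v) by exact: cb.
have nds (w : nat -> R) : (forall n, 0 <= w n) -> nondecreasing_seq (series w).
  by move=> w0; apply: nondecreasing_series => i _ _.
have UL n : U n <= limn (series u) by exact: (nondecreasing_cvgn_le (nds u u0) ca).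
have VL n : V n <= limn (series v) by exact: (nondecreasing_cvgn_le (nds v v0) cb).
have ndW : nondecreasing_seq W.
  apply: nds => n; apply: sumr_ge0 => i _; exact: mulr_ge0.
have WB N : W N <= limn (series u) * limn (series v).
  by rewrite (le_trans (WU N))// ler_pM.
have cW : cvgn W.
  by apply: nondecreasing_is_cvgn ndW _; exists (limn (series u) * limn (series v)) => _ [N _ <-].
have cUV : (fun N => U N * V N) @ \oo --> limn (series u) * limn (series v) by exact: cvgM.
have Wlim : limn W = limn (series u) * limn (series v).
  apply/eqP; rewrite eq_le; apply/andP; split.
    by apply: limr_le => //; exact: nearW.
  apply: (@ler_cvg_to _ _ _ _ (fun N => U N * V N) (fun=> limn W) _ _ cUV (cvg_cst _)).
  by apply: nearW => N; rewrite (le_trans (W2 N))//; exact: nondecreasing_cvgn_le.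
split; [exact: cW|by rewrite -/W Wlim|].
have cA : cvgn (series a) by apply: (@normed_cvg R R^o); exact: ca.
have cB : cvgn (series b) by apply: (@normed_cvg R R^o); exact: cb.
have cAB : (fun N => series a N * series b N) @ \oo --> limn (series a) * limn (series b).
  exact: cvgM.
have d0 : (fun N => U N * V N - W N) @ \oo --> (0 : R).
  rewrite -[X in _ --> X](subrr (limn (series u) * limn (series v))).
  apply: cvgB => //; rewrite -Wlim; exact: cW.
have key N : `|series a N * series b N - series (conv a b) N| <= U N * V N - W N.
  have -> : series a N * series b N - series (conv a b) N =
      \sum_(i < N) a i * \sum_(N - i <= j < N) b j.
    rewrite /series /= series_conv [\sum_(0 <= k < N) a k]big_mkord mulr_suml.
    rewrite -sumrB; apply: eq_bigr => i _; rewrite -mulrBr; congr (_ * _).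
    by rewrite sum_nat_sub// leq_subr.
  rewrite WE UE mulr_suml -sumrB (le_trans (ler_norm_sum _ _ _))//.
  apply: ler_sum => i _; rewrite normrM -mulrBr ler_wpM2l//.
  rewrite /V sum_nat_sub ?leq_subr//.
  exact: ler_norm_sum.
rewrite (_ : series (conv a b) = fun N => series a N * series b N -
    (series a N * series b N - series (conv a b) N)); last first.
  by apply/funext => N; rewrite opprB addrC subrK.
rewrite -[X in _ --> X]subr0; apply: cvgB => //.
apply/cvgr0Pnorm_le => e e0; move/cvgr0Pnorm_le : d0 => /(_ e e0).
apply: filterS => N h; apply: (le_trans (key N)); exact: le_trans (ler_norm _) h.
Qed.

Lemma csummable_conv (a b : nat -> R[i]) : csummable a -> csummable b ->
  csummable (conv a b) /\ limn (series (fun n => cab (conv a b n))) <=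
    limn (series (fun n => cab (a n))) * limn (series (fun n => cab (b n))).
Proof.
move=> ca cb.
have cE (c : nat -> R[i]) : (fun n => `|cab (c n)|) = (fun n => cab (c n)).
  by apply/funext => n; rewrite ger0_norm// cab_ge0.
have := @cauchy_product (fun n => cab (a n)) (fun n => cab (b n)).
rewrite !cE => /(_ ca cb)[c1 c2 _].
have le n : cab (conv a b n) <= conv (fun n => cab (a n)) (fun n => cab (b n)) n.
  by rewrite (le_trans (cab_sum _ _ _))//; apply: ler_sum => i _; exact: cabM.
have cc := csummable_le le c1.
by split => //; apply: le_trans c2; apply: lim_series_le.
Qed.

Lemma csum_conv (a b : nat -> R[i]) : csummable a -> csummable b ->
  csum (conv a b) = csum a * csum b.
Proof.
move=> ca cb.
have sR (c : nat -> R[i]) : csummable c -> cvgn (series (fun n => `|Re (c n)|)).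
  by move=> cc; apply: (series_le_cvg (fun n => normr_ge0 _) (fun n => cab_ge0 _) (fun n => Re_le_cab _) cc).
have sI (c : nat -> R[i]) : csummable c -> cvgn (series (fun n => `|Im (c n)|)).
  by move=> cc; apply: (series_le_cvg (fun n => normr_ge0 _) (fun n => cab_ge0 _) (fun n => Im_le_cab _) cc).
have [_ _ rr] := cauchy_product (sR _ ca) (sR _ cb).
have [_ _ ii] := cauchy_product (sI _ ca) (sI _ cb).
have [_ _ ri] := cauchy_product (sR _ ca) (sI _ cb).
have [_ _ ir] := cauchy_product (sI _ ca) (sR _ cb).
apply: csum_eq.
- rewrite ReM (_ : series _ = fun n => series (conv (fun n => Re (a n)) (fun n => Re (b n))) n -
     series (conv (fun n => Im (a n)) (fun n => Im (b n))) n); first exact: cvgB.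
  apply/funext => n; rewrite /series /= -sumrB; apply: eq_bigr => i _.
  by rewrite /conv Re_sum -sumrB; apply: eq_bigr => j _; rewrite ReM.
- rewrite ImM (_ : series _ = fun n => series (conv (fun n => Re (a n)) (fun n => Im (b n))) n +
     series (conv (fun n => Im (a n)) (fun n => Re (b n))) n); first exact: cvgD.
  apply/funext => n; rewrite /series /= -big_split/=; apply: eq_bigr => i _.
  by rewrite /conv Im_sum -big_split/=; apply: eq_bigr => j _; rewrite ImM.
Qed.

Lemma conv_pow (A : comPzRingType) (z : A) (a b : nat -> A) n :
  conv (fun i => z ^+ i * a i) (fun i => z ^+ i * b i) n = z ^+ n * conv a b n.
Proof.
rewrite /conv mulr_sumr; apply: eq_bigr => i _.
have -> : z ^+ n = z ^+ i * z ^+ (n - i) by rewrite -exprD subnKC// -ltnS.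
ring.
Qed.

End CauchyProduct.

(** * Entire functions with real part bounded below *)

Section RootsOfUnity.
Context {R : realType}.
Local Open Scope complex_scope.
Notation Re := complex.Re.
Notation Im := complex.Im.
Implicit Types (z w : R[i]) (c : nat -> R[i]).

Lemma sqmodM z w : sqmod (z * w) = sqmod z * sqmod w.
Proof. by rewrite /sqmod ReM ImM; ring. Qed.

Lemma sqmodX z n : sqmod (z ^+ n) = sqmod z ^+ n.
Proof.
elim: n => [|n ih]; first by rewrite !expr0 /sqmod/= expr1n expr0n addr0.
by rewrite !exprS sqmodM ih.
Qed.

Lemma sqmod_ge0 z : 0 <= sqmod z. Proof. by rewrite addr_ge0// sqr_ge0. Qed.

(** An iterated square root of -1 has order exactly a power of two, which avoids any
    appeal to trigonometric functions. *)
Lemma unit_root_exists m : exists zeta : R[i],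
  [/\ zeta ^+ (2 ^ m.+1) = 1, sqmod zeta = 1 &
      forall j, (0 < j < 2 ^ m.+1)%N -> zeta ^+ j != 1].
Proof.
have m0 : (0 < 2 ^ m)%N by rewrite expn_gt0.
pose zeta : R[i] := (2 ^ m).-root (-1).
have zm : zeta ^+ (2 ^ m) = -1 by exact: rootCK.
have z1 : zeta ^+ (2 ^ m.+1) = 1 by rewrite expnSr exprM zm sqrrN expr1n.
exists zeta; split => //.
  apply/eqP; rewrite -(@pexpr_eq1 _ (sqmod zeta) (2 ^ m) m0 (sqmod_ge0 _)).
  by rewrite -sqmodX zm /sqmod/= sqrrN expr1n oppr0 expr0n addr0.
move=> j /andP[j0 jN]; apply/negP => /eqP zj.
have [k kp kd] := prim_order_exists (expn_gt0 2 m.+1 : (0 < 2 ^ m.+1)%N) z1.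
have kj : (k %| j)%N by rewrite (prim_order_dvd kp) zj eqxx.
have [l lm kE] := dvdn_pfactor _ _ (isT : prime 2) kd.
have := lm; rewrite leq_eqVlt => /predU1P[lmE|lm'].
  have := dvdn_leq j0 kj; by rewrite kE lmE leqNgt jN.
have : zeta ^+ (2 ^ m) == 1 by rewrite -(prim_order_dvd kp) kE dvdn_exp2l.
rewrite zm -subr_eq0 -opprD oppr_eq0 (_ : 1 + 1 = 2%:R :> R[i])// pnatr_eq0 => /eqP; discriminate.

Qed.

End RootsOfUnity.

Section RootAverages.
Context {R : realType}.
Local Open Scope complex_scope.
Notation Re := complex.Re.
Notation Im := complex.Im.
Implicit Types (z w : R[i]) (c : nat -> R[i]).

Section average.
Variables (N : nat) (zeta : R[i]) (r : R) (c : nat -> R[i]).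
Hypotheses (N4 : (4 < N)%N) (zN : zeta ^+ N = 1) (z1 : sqmod zeta = 1)
  (zj : forall j, (0 < j < N)%N -> zeta ^+ j != 1) (r0 : 0 <= r).

Lemma root_sum0 j : zeta ^+ j != 1 -> \sum_(k < N) zeta ^+ (k * j) = 0.
Proof.
move=> j1; apply/eqP; have := subrX1 (zeta ^+ j) N.
rewrite -exprM mulnC exprM zN expr1n subrr => /esym/eqP.
rewrite mulf_eq0 subr_eq0 (negbTE j1)/= => /eqP h; apply/eqP; rewrite -[RHS]h.
by apply: eq_bigr => i _; rewrite -exprM mulnC.
Qed.

Lemma root_sumN j : zeta ^+ j = 1 -> \sum_(k < N) zeta ^+ (k * j) = N%:R.
Proof.
move=> j1; rewrite (eq_bigr (fun=> 1)) ?sumr_const ?card_ord//.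
by move=> k _; rewrite mulnC exprM j1 expr1n.
Qed.

Definition node k : R[i] := r%:C * zeta ^+ k.
(** The nonnegative kernel 2 + zeta^(2k) + zeta^(-2k): averaging a power series over
    the nodes with these weights keeps only the coefficients of order 0 and 2 (up to
    aliasing), and positivity preserves one-sided bounds. *)
Definition fejer k : R := 2 + 2 * Re (zeta ^+ (k * 2)).

Lemma sqmod_root k : sqmod (zeta ^+ k) = 1.
Proof. by rewrite sqmodX z1 expr1n. Qed.

Lemma sqmod1_bound z : sqmod z = 1 -> `|Re z| <= 1 /\ `|Im z| <= 1.
Proof.
rewrite /sqmod => h; split; rewrite -(@ler_pXn2r _ 2) ?nnegrE// expr1n real_normK ?num_real//.
  by have := sqr_ge0 (Im z); lra.
by have := sqr_ge0 (Re z); lra.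
Qed.

Lemma fejer_ge0 k : 0 <= fejer k <= 4.
Proof.
have [h _] := sqmod1_bound (sqmod_root (k * 2)).
by move: h; rewrite /fejer ler_norml => /andP[]; lra.
Qed.

Lemma fejerE k : (fejer k)%:C = 2 + zeta ^+ (k * 2) + zeta ^+ (k * (N - 2)).
Proof.
have sm := sqmod_root (k * 2).
have N2 : (2 <= N)%N by apply: leq_trans N4.
have e : zeta ^+ (k * (N - 2)) * zeta ^+ (k * 2) = 1.
  by rewrite -exprD -mulnDr subnK // mulnC exprM zN expr1n.
have -> : zeta ^+ (k * (N - 2)) = Re (zeta ^+ (k * 2)) -i* Im (zeta ^+ (k * 2)).
  set w := zeta ^+ (k * 2) in sm e *.
  have w0 : w != 0 by apply: contra_eq_neq e => ->; rewrite mulr0 eq_sym oner_neq0.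
  apply: (mulIf w0); rewrite e; apply: complex_eq; rewrite ?ReM ?ImM/=.
    by rewrite -sm /sqmod; ring.
  by ring.
by apply: complex_eq; rewrite !(ReD, ImD) /fejer /=; ring.
Qed.

Lemma node_average n : \sum_(k < N) fejer k * Re (node k ^+ n * c n) =
  Re (r%:C ^+ n * c n * (2 * (\sum_(k < N) zeta ^+ (k * n)) + \sum_(k < N) zeta ^+ (k * (n + 2)) +
     \sum_(k < N) zeta ^+ (k * (n + (N - 2))))).
Proof.
rewrite mulr_sumr -!big_split/= mulr_sumr Re_sum; apply: eq_bigr => k _.
transitivity (Re ((fejer k)%:C * (node k ^+ n * c n))).
  by rewrite ReM/=; ring.
rewrite fejerE /node exprMn -exprM !mulnDr !exprD; congr Re; ring.
Qed.

Lemma node_average_low n : (n + 2 < N)%N ->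
  \sum_(k < N) fejer k * Re (node k ^+ n * c n) =
  N%:R * (if n == 0%N then 2 * Re (c 0%N) else if n == 2%N then r ^+ 2 * Re (c 2%N) else 0).
Proof.
move=> nN; rewrite node_average.
have N2 : (2 <= N)%N by apply: leq_trans N4.
rewrite (@root_sum0 (n + 2)) ?zj ?nN ?addn2// addr0.
have ReNat (x : R[i]) : Re (x * N%:R) = N%:R * Re x.
  by rewrite mulr_natr [RHS]mulr_natl; elim: N => [|k ih]; rewrite ?mulr0n// !mulrS ReD ih.
case: eqVneq => [->|n0].
  rewrite root_sumN ?expr0// add0n root_sum0; last first.
    by apply: zj; apply/andP; split; lia.
  by rewrite addr0 mul1r mulrA ReNat [c _ * 2]mulr_natr mulr2n ReD; ring.
rewrite root_sum0 ?mulr0 ?add0r; last by apply: zj; apply/andP; split; lia.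
case: eqVneq => [->|n2].
  rewrite root_sumN ?subnKC// ReNat; congr (_ * _).
  by rewrite -rmorphXn ReM/= mul0r subr0.
rewrite root_sum0 ?mulr0//.
have [n2'|] := ltnP n 2.
  by apply: zj; apply/andP; split; lia.
move=> n2'; rewrite (_ : (n + (N - 2) = N + (n - 2))%N); last by lia.
by rewrite exprD zN mul1r zj//; apply/andP; split; lia.
Qed.

Lemma cab_node k n : cab (node k ^+ n) <= 2 * r ^+ n.
Proof.
rewrite /node exprMn -exprM.
have [h1 h2] := sqmod1_bound (sqmod_root (k * n)).
have -> : r%:C ^+ n * zeta ^+ (k * n) = (r ^+ n * Re (zeta ^+ (k * n))) +i* (r ^+ n * Im (zeta ^+ (k * n))).
  by rewrite -rmorphXn; apply: complex_eq; rewrite ?ReM ?ImM/=; ring.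
rewrite /cab /= !normrM ger0_norm ?exprn_ge0// -mulrDr mulrC ler_wpM2r ?exprn_ge0//.
lra.
Qed.

Lemma node_average_bound n : `|\sum_(k < N) fejer k * Re (node k ^+ n * c n)| <=
  N%:R * (8 * (r ^+ n * cab (c n))).
Proof.
rewrite (le_trans (ler_norm_sum _ _ _))//.
rewrite (_ : N%:R * _ = \sum_(k < N) (8 * (r ^+ n * cab (c n)))); last first.
  by rewrite sumr_const card_ord mulr_natl.
apply: ler_sum => k _; have /andP[f0 f4] := fejer_ge0 k.
rewrite normrM (ger0_norm f0).
apply: (@le_trans _ _ (4 * (2 * r ^+ n * cab (c n)))); last by lra.
apply: ler_pM => //; apply: (le_trans (Re_le_cab _)); apply: (le_trans (cabM _ _)).
by rewrite ler_wpM2r ?cab_ge0// cab_node.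
Qed.

Lemma fejer_sum : \sum_(k < N) fejer k = 2 * N%:R.
Proof.
rewrite /fejer big_split/= sumr_const card_ord -mulr_sumr -Re_sum root_sum0 ?mulr0 ?addr0.
  by rewrite mulr_natr.
by rewrite zj//= (ltn_trans _ N4).
Qed.

End average.
End RootAverages.

Section CoefficientExtraction.
Context {R : realType}.
Local Open Scope complex_scope.
Notation Re := complex.Re.
Notation Im := complex.Im.
Implicit Types (z w : R[i]) (c : nat -> R[i]).

Lemma cab_realX (r : R) n z : 0 <= r -> cab (r%:C ^+ n * z) = r ^+ n * cab z.
Proof.
move=> r0; rewrite -rmorphXn /cab ReM ImM /= !mul0r subr0 addr0 !normrM.
by rewrite (ger0_norm (exprn_ge0 n r0)) -mulrDr.
Qed.

Lemma cvg_sum_seq (I : Type) (s : seq I) (u : I -> nat -> R) (l : I -> R) :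
  (forall i, u i @ \oo --> l i) ->
  (fun n => \sum_(i <- s) u i n) @ \oo --> \sum_(i <- s) l i.
Proof.
move=> ul; elim: s => [|i s ih].
  by under eq_fun do rewrite big_nil; rewrite big_nil; exact: cvg_cst.
by under eq_fun do rewrite big_cons; rewrite big_cons; exact: cvgD.
Qed.

(** The last term is the aliasing error: coefficients of order N - 2 and higher are
    not separated by the N-th roots of unity, but they form the tail of a convergent
    series. *)
Lemma fejer_estimate c (A B r : R) m :
  (forall z, csummable (fun n => z ^+ n * c n)) -> 0 <= A ->
  (forall z, - Re (csum (fun n => z ^+ n * c n)) <= A * cab z + B) ->
  0 <= r -> (1 < m)%N ->
  0 <= 2 * (2 * A * r + B) + 2 * Re (c 0%N) + r ^+ 2 * Re (c 2%N) +
    8 * (limn (series (fun n => r ^+ n * cab (c n))) - series (fun n => r ^+ n * cab (c n)) (2 ^ m.+1 - 2)%N).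
Proof.
move=> cs A0 cB r0 m1.
have [zeta [zN z1 zj]] := @unit_root_exists R m.
set N := (2 ^ m.+1)%N in zN zj *.
have N4 : (4 < N)%N.
  by apply: (@leq_trans (2 ^ 3)) => //; rewrite leq_exp2l// !ltnS.
set b := fun n => r ^+ n * cab (c n).
have bs : cvgn (series b).
  have := cs r%:C; rewrite /csummable (_ : (fun n => cab _) = b)//.
  by apply/funext => n; rewrite cab_realX.
have b0 n : 0 <= b n by rewrite mulr_ge0 ?exprn_ge0 ?cab_ge0.
pose z k := node zeta r k.
pose f k := fejer zeta k.
have NR : 0 < N%:R :> R by rewrite ltr0n (leq_trans _ N4).
have up : - (\sum_(k < N) f k * Re (csum (fun n => z k ^+ n * c n))) <= N%:R * (2 * (2 * A * r + B)).
  rewrite -sumrN (_ : N%:R * _ = \sum_(k < N) f k * (2 * A * r + B)); last first.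
    by rewrite -mulr_suml fejer_sum//; ring.
  apply: ler_sum => k _; have /andP[f0 _] := fejer_ge0 z1 k.
  rewrite -mulrN ler_wpM2l// (le_trans (cB _))// lerD2r.
  rewrite [2 * A]mulrC -mulrA ler_wpM2l//.
  by have := cab_node z1 r0 k 1; rewrite !expr1.
have cvg1 : series (fun i => \sum_(k < N) f k * Re (z k ^+ i * c i)) @ \oo -->
    \sum_(k < N) f k * Re (csum (fun n => z k ^+ n * c n)).
  rewrite (_ : series _ = fun n => \sum_(k < N) f k * series (fun i => Re (z k ^+ i * c i)) n); last first.
    apply/funext => n; rewrite /series /= exchange_big/=; apply: eq_bigr => k _.
    by rewrite mulr_sumr.
  apply: (@cvg_sum_seq) => k; apply: cvgM; first exact: cvg_cst.
  exact: csum_cvgRe.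
set L := \sum_(k < N) _ in up cvg1.
have lo : L <= N%:R * (2 * Re (c 0%N) + r ^+ 2 * Re (c 2%N) + 8 * (limn (series b) - series b (N - 2)%N)).
  rewrite -(cvg_lim (@Rhausdorff R) cvg1).
  apply: limr_le; first by apply/cvg_ex; exists L.
  exists (N - 2)%N => // n /= Nn.
  have Sn : series b n <= limn (series b).
    by apply: nondecreasing_cvgn_le => //; apply: nondecreasing_series => i _ _.
  rewrite {1}/series/= (big_cat_nat (leq0n _) Nn)/= mulrDr; apply: lerD.
    rewrite (eq_big_nat _ _ (F2 := fun i => N%:R * (if i == 0%N then 2 * Re (c 0%N) else if i == 2%N then r ^+ 2 * Re (c 2%N) else 0))); last first.
      by move=> i /andP[_ iN]; apply: node_average_low => //; lia.
    rewrite -mulr_sumr ler_wpM2l ?ler0n//.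
    have -> : (N - 2 = (N - 5).+3)%N by lia.
    by rewrite big_nat_recl// big_nat_recl// big_nat_recl//= big1 ?addr0 ?add0r.
  apply: (@le_trans _ _ (\sum_(N - 2 <= i < n) N%:R * (8 * b i))).
    apply: ler_sum => i _; apply: le_trans (ler_norm _) _.
    exact: node_average_bound.
  rewrite -!mulr_sumr ler_wpM2l ?ler0n// ler_wpM2l// lerBrDl.
  by rewrite /series/= in Sn *; rewrite -(big_cat_nat (leq0n _) Nn).
have : 0 <= N%:R * (2 * (2 * A * r + B)) + N%:R * (2 * Re (c 0%N) + r ^+ 2 * Re (c 2%N) + 8 * (limn (series b) - series b (N - 2)%N)).
  by move: up lo; set X := N%:R * _; set Y := N%:R * _; move=> *; lra.
by rewrite -mulrDr pmulr_rge0// !addrA.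
Qed.

(** Without aliasing error (let N tend to infinity) the estimate is a
    quadratic polynomial in r that must stay nonnegative as r grows, while its lower
    order terms are linear. *)
Lemma second_coefficient_Re_ge0 c (A B : R) :
  (forall z, csummable (fun n => z ^+ n * c n)) -> 0 <= A ->
  (forall z, - Re (csum (fun n => z ^+ n * c n)) <= A * cab z + B) ->
  0 <= Re (c 2%N).
Proof.
move=> cs A0 cB.
have H (r : R) : 0 <= r -> 0 <= 2 * (2 * A * r + B) + 2 * Re (c 0%N) + r ^+ 2 * Re (c 2%N).
  move=> r0; rewrite -oppr_le0 leNgt; apply/negP; set K := - _ => K0.
  set b := fun n => r ^+ n * cab (c n).
  have bs : cvgn (series b).
    have := cs r%:C; rewrite /csummable (_ : (fun n => cab _) = b)//.
    by apply/funext => n; rewrite cab_realX.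
  have K80 : 0 < K / 16 by rewrite divr_gt0.
  have /cvgrPdist_lt /(_ _ K80) [n0 _ near] := bs.
  have := @fejer_estimate c A B r (n0 + 2) cs A0 cB r0 _; rewrite -/b => /(_ _).
  have n0l : (n0 <= 2 ^ (n0 + 2).+1 - 2)%N.
    have : (n0 + 2 < 2 ^ (n0 + 2).+1)%N by apply: ltn_trans (ltnSn _) (ltn_expl _ _).
    lia.
  have := near _ n0l => /=; rewrite ltr_norml => /andP[_ h] /(_ _) => h2.
  have := h2 (ltn_addl _ (isT : (1 < 2)%N)); rewrite /K in h *.
  by move: h K0; rewrite /K; set X := limn _ - _; set Y := _ + r ^+ 2 * _; move=> *; lra.
rewrite leNgt; apply/negP => d0.
set d := - Re (c 2%N); have d1 : 0 < d by rewrite oppr_gt0.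
set K1 := 4 * A; set K2 := 2 * B + 2 * Re (c 0%N).
(* large enough for - d r^2 to outweigh the linear terms K1 r + K2 *)
pose r := 1 + (K1 + `|K2|) / d.
have q0 : 0 <= (K1 + `|K2|) / d by apply: divr_ge0 (ltW d1); rewrite addr_ge0// mulr_ge0.
have r1 : 1 <= r by rewrite lerDl.
have dr : d * r = d + K1 + `|K2| by rewrite /r; field; rewrite gt_eqF.
have := H r (le_trans ler01 r1).
rewrite (_ : _ + _ = K1 * r + K2 - r * (d * r)); last by rewrite /K1 /K2 /d; ring.
rewrite dr; have := ler_norm K2; have := normr_ge0 K2; set k := `|K2|.
move=> k0 kK; nra.
Qed.

(** A Liouville theorem: rotating z by a square root of the opposite of the
    conjugate of c 2 makes the second coefficient equal to - |c 2|^2, whose real part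
    must be nonnegative. *)
Lemma second_coefficient c (A B : R) :
  (forall z, csummable (fun n => z ^+ n * c n)) -> 0 <= A ->
  (forall z, - Re (csum (fun n => z ^+ n * c n)) <= A * cab z + B) ->
  c 2%N = 0.
Proof.
move=> cs A0 cB.
(* a^2 c_2 = - |c_2|^2 *)
pose a : R[i] := sqrtC (- (Re (c 2%N) -i* Im (c 2%N))).
have a2 : a ^+ 2 = - (Re (c 2%N) -i* Im (c 2%N)) by rewrite sqrtCK.
pose c' n := a ^+ n * c n.
have ce z : (fun n => z ^+ n * c' n) = (fun n => (z * a) ^+ n * c n).
  by apply/funext => n; rewrite /c' mulrA exprMn.
have : 0 <= Re (c' 2%N).
  apply: (@second_coefficient_Re_ge0 c' (A * cab a) B).
  - by move=> z; rewrite ce.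
  - by rewrite mulr_ge0 ?cab_ge0.
  - move=> z; rewrite ce (le_trans (cB _))// lerD2r -mulrA ler_wpM2l//.
    by rewrite [leRHS]mulrC; apply: cabM.
rewrite /c' a2 mulNr ReN ReM/=.
rewrite mulNr opprK -!expr2 oppr_ge0 => h.
have h1 : Re (c 2%N) ^+ 2 = 0 by have := sqr_ge0 (Re (c 2%N)); have := sqr_ge0 (Im (c 2%N)); lra.
have h2 : Im (c 2%N) ^+ 2 = 0 by have := sqr_ge0 (Re (c 2%N)); have := sqr_ge0 (Im (c 2%N)); lra.
apply: complex_eq; [move/eqP: h1|move/eqP: h2]; by rewrite sqrf_eq0 => /eqP.
Qed.

End CoefficientExtraction.

(** * Uniqueness for power series *)

Section PowerSeriesZeros.
Context {R : realType}.

(** The first nonzero coefficient would dominate the series near 0. *)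
Lemma power_series_zeros (c : nat -> R) (r : R) (z : nat -> R) : 0 < r ->
  cvgn (series (fun n => r ^+ n * `|c n|)) ->
  (forall k, z k != 0) -> (forall k, `|z k| <= r) -> z @ \oo --> (0 : R) ->
  (forall k, series (fun n => z k ^+ n * c n) @ \oo --> (0 : R)) ->
  forall n, c n = 0.
Proof.
move=> r0 cc z0 zr zc cz n; elim/ltn_ind: n => n ih.
set S := limn (series (fun n => r ^+ n * `|c n|)).
have S_ge N : series (fun n => r ^+ n * `|c n|) N <= S.
  by apply: nondecreasing_cvgn_le => //; apply: nondecreasing_series => i _ _; rewrite mulr_ge0 ?exprn_ge0// ltW.
have step k : `|c n| <= `|z k| * (S / r ^+ n.+1).
  have zk : 0 < `|z k| by rewrite normr_gt0.
  have part N : (n < N)%N ->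
      `|z k| ^+ n * `|c n| <= `|series (fun n => z k ^+ n * c n) N| + `|z k| ^+ n.+1 * (S / r ^+ n.+1).
    move=> nN; have E : series (fun n => z k ^+ n * c n) N =
        z k ^+ n * c n + \sum_(n.+1 <= i < N) z k ^+ i * c i.
      rewrite /series/= (big_cat_nat (leq0n n) (ltnW nN))/= big_nat big1 ?add0r.
        by rewrite (big_ltn nN).
      by move=> i /andP[_ /ih ->]; rewrite mulr0.
    rewrite -normrX -normrM (_ : z k ^+ n * c n = series (fun n => z k ^+ n * c n) N - \sum_(n.+1 <= i < N) z k ^+ i * c i); last first.
      by rewrite E addrK.
    apply: le_trans (ler_normB _ _) _; rewrite lerD2l.
    apply: le_trans (ler_norm_sum _ _ _) _.
    apply: (@le_trans _ _ (\sum_(n.+1 <= i < N) `|z k| ^+ n.+1 * ((r ^+ i * `|c i|) / r ^+ n.+1))).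
      apply: ler_sum_nat => i /andP[ni _].
      rewrite normrM normrX mulrAC mulrA mulrA ler_wpM2r//.
      rewrite -{1}(subnKC ni) exprD -mulrA ler_wpM2l ?exprn_ge0//.
      rewrite -{2}(subnKC ni) exprD mulrAC mulfV ?mul1r; last by rewrite expf_neq0// gt_eqF.
      by rewrite lerXn2r// nnegrE ltW.
    rewrite -mulr_sumr ler_wpM2l ?exprn_ge0// -mulr_suml ler_wpM2r ?invr_ge0 ?exprn_ge0 ?(ltW r0)//.
    apply: le_trans (S_ge N); rewrite /series/= (big_cat_nat (leq0n n.+1) nN)/= lerDr.
    by apply: sumr_ge0 => i _; rewrite mulr_ge0 ?exprn_ge0 ?(ltW r0).
  have : `|z k| ^+ n * `|c n| <= `|z k| ^+ n * (`|z k| * (S / r ^+ n.+1)).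
    rewrite mulrA -exprSr -[leRHS]add0r -(normr0 R).
    have cN : (fun N => `|series (fun n => z k ^+ n * c n) N| + `|z k| ^+ n.+1 * (S / r ^+ n.+1)) @ \oo -->
        `|0 : R| + `|z k| ^+ n.+1 * (S / r ^+ n.+1).
      by apply: cvgD; [exact: cvg_norm | exact: cvg_cst].
    rewrite -(cvg_lim (@Rhausdorff R) cN); apply: limr_ge; first by apply/cvg_ex; eexists; exact: cN.
    by exists n.+1 => // N; exact: part.
  by rewrite ler_pM2l// exprn_gt0.
apply/normr0_eq0/eqP; rewrite eq_le normr_ge0 andbT.
have cN : (fun k => `|z k| * (S / r ^+ n.+1)) @ \oo --> (0 : R).
  rewrite -(mul0r (S / r ^+ n.+1)) -(normr0 R).
  by apply: cvgM; [exact: cvg_norm | exact: cvg_cst].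
rewrite -(cvg_lim (@Rhausdorff R) cN); apply: limr_ge; first by apply/cvg_ex; eexists; exact: cN.
exact: nearW.
Qed.

End PowerSeriesZeros.

(** * Series with a geometric majorant *)

Section Dominated.
Context {R : realType}.
Local Open Scope complex_scope.
Notation Re := complex.Re.
Notation Im := complex.Im.
Implicit Types (z : R[i]) (a b c : nat -> R[i]) (r : R).

(** Stated through partial sums, so that B controls both summability at radius r
    and the size of the sum. *)
Definition dominated c r (B : R) := forall N, series (fun n => r ^+ n * cab (c n)) N <= B.

Lemma dominated_csum c z (B : R) : dominated c (cab z) B ->
  csummable (fun n => z ^+ n * c n) /\ cab (csum (fun n => z ^+ n * c n)) <= 2 * B.
Proof.
move=> cB.
have [cs le] : csummable (fun n => z ^+ n * c n) /\ limn (series (fun n => cab (z ^+ n * c n))) <= B.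
  apply: csummable_bounded => N; apply: le_trans (cB N); rewrite /series/=.
  apply: ler_sum => i _; apply: le_trans (cabM _ _) _; rewrite ler_wpM2r ?cab_ge0//.
  exact: cabX.
by split => //; apply: le_trans (cab_csum_le cs) _; rewrite ler_wpM2l.
Qed.

Lemma dominated_ge0 c r (B : R) : dominated c r B -> 0 <= B.
Proof. by move=> /(_ 0%N); rewrite /series/= big_geq. Qed.

Lemma dominated_term c r (B : R) n : 0 <= r -> dominated c r B -> r ^+ n * cab (c n) <= B.
Proof.
move=> r0 /(_ n.+1); rewrite /series/= big_nat_recr//=; apply: le_trans.
by rewrite lerDr sumr_ge0// => i _; rewrite mulr_ge0 ?cab_ge0 ?exprn_ge0.
Qed.

Lemma dominatedW c r (B B' : R) : B <= B' -> dominated c r B -> dominated c r B'.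
Proof. by move=> BB cB N; exact: le_trans (cB N) BB. Qed.

Lemma dominatedD a b r (A B : R) : 0 <= r -> dominated a r A -> dominated b r B ->
  dominated (fun n => a n + b n) r (A + B).
Proof.
move=> r0 aA bB N; apply: le_trans (lerD (aA N) (bB N)).
rewrite /series/= -big_split/=; apply: ler_sum => i _.
by rewrite -mulrDr ler_wpM2l ?exprn_ge0// cabD.
Qed.

Lemma dominatedZ a z r (A : R) : 0 <= r -> dominated a r A ->
  dominated (fun n => z * a n) r (cab z * A).
Proof.
move=> r0 aA N; apply: le_trans (ler_wpM2l (cab_ge0 z) (aA N)).
rewrite /series/= mulr_sumr; apply: ler_sum => i _.
by rewrite mulrCA ler_wpM2l ?exprn_ge0// cabM.
Qed.

Lemma dominated_conv a b r (A B : R) : 0 <= r -> dominated a r A -> dominated b r B ->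
  dominated (conv a b) r (A * B).
Proof.
move=> r0 aA bB N.
pose a' n := r ^+ n * cab (a n); pose b' n := r ^+ n * cab (b n).
have a0 n : 0 <= a' n by rewrite mulr_ge0 ?cab_ge0 ?exprn_ge0.
have b0 n : 0 <= b' n by rewrite mulr_ge0 ?cab_ge0 ?exprn_ge0.
apply: (@le_trans _ _ (\sum_(0 <= n < N) conv a' b' n)).
  rewrite /series/=; apply: ler_sum => n _; rewrite /a' /b' conv_pow ler_wpM2l ?exprn_ge0//.
  by apply: le_trans (cab_sum _ _ _) _; apply: ler_sum => i _; exact: cabM.
rewrite series_conv; apply: (@le_trans _ _ (\sum_(i < N) a' i * B)).
  by apply: ler_sum => i _; rewrite ler_wpM2l//; exact: bB.
by rewrite -mulr_suml -(big_mkord xpredT a') ler_wpM2r ?(dominated_ge0 bB)//; exact: aA.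
Qed.

End Dominated.

(** * Majorants from square sums *)

Section SquareMajorant.
Context {R : realType}.
Local Open Scope complex_scope.
Implicit Types (c : nat -> R[i]) (r G : R).

Lemma geometric_half N : \sum_(0 <= n < N) ((2:R)^-1) ^+ n <= 2.
Proof.
have -> : \sum_(0 <= n < N) ((2:R)^-1) ^+ n = 2 - 2 * (2^-1) ^+ N.
  elim: N => [|N ih]; first by rewrite big_geq// expr0 mulr1 subrr.
  by rewrite big_nat_recr//= ih exprS; field.
by rewrite lerBlDr lerDl mulr_ge0// exprn_ge0// invr_ge0.
Qed.

(** Cauchy-Schwarz with the geometric weights 2^-n: square sums at radius
    sqrt 2 r control absolute sums at radius r. *)
Lemma dominated_sqmod c r G : 0 <= r ->
  (forall N, series (fun n => (2 * r ^+ 2) ^+ n * sqmod (c n)) N <= G) ->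
  dominated c r (2 * Num.sqrt G).
Proof.
move=> r0 cG N.
have G0 : 0 <= G by have := cG 0%N; rewrite /series/= big_geq.
have term (l : R) n : 0 < l -> r ^+ n * cab (c n) <=
    l / 2 * (2^-1) ^+ n + l^-1 * ((2 * r ^+ 2) ^+ n * sqmod (c n)).
  move=> l0; have h := sqr_cab_le (c n).
  have p0 : 0 < (2:R)^-1 ^+ n by rewrite exprn_gt0.
  have -> : (2 * r ^+ 2) ^+ n = (r ^+ n) ^+ 2 / (2^-1) ^+ n.
    by rewrite exprMn exprAC exprVn invrK mulrC.
  set p := (2^-1) ^+ n in p0 *; set a := r ^+ n; set b := cab (c n) in h *; set S := sqmod (c n) in h *.
  have lp : 0 < l * p by rewrite mulr_gt0.
  rewrite -(ler_pM2l lp).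
  have -> : l * p * (l / 2 * p + l^-1 * (a ^+ 2 / p * S)) = (l * p) ^+ 2 / 2 + a ^+ 2 * S.
    by field; rewrite !gt_eqF.
  have : a ^+ 2 * b ^+ 2 <= a ^+ 2 * (2 * S) by rewrite ler_wpM2l// sqr_ge0.
  have := sqr_ge0 (l * p - a * b); move: (l * p) => u.
  by move=> h1 h2; nra.
have bound (l : R) : 0 < l -> series (fun n => r ^+ n * cab (c n)) N <= l + l^-1 * G.
  move=> l0; apply: le_trans (ler_sum _ (fun n _ => term l n l0)) _.
  rewrite big_split/= -!mulr_sumr; apply: lerD.
    have l2 : 0 <= l / 2 by lra.
    apply: le_trans (ler_wpM2l l2 (geometric_half N)) _; by rewrite divfK ?pnatr_eq0 ?lexx.
  by rewrite ler_wpM2l ?invr_ge0 ?(ltW l0)//; exact: cG.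
move: G0; rewrite le_eqVlt => /predU1P[G0|G0].
  rewrite -G0 sqrtr0 mulr0; apply/ler_addgt0Pr => e e0.
  by rewrite add0r; apply: le_trans (bound e e0) _; rewrite -G0 mulr0 addr0.
have s0 : 0 < Num.sqrt G by rewrite sqrtr_gt0.
apply: le_trans (bound _ s0) _.
have e : Num.sqrt G * Num.sqrt G = G by rewrite -expr2 sqr_sqrtr// ltW.
by move: s0 e; move: (Num.sqrt G) => s s0 <-; rewrite mulKf ?gt_eqF// mulrDl mul1r.
Qed.

End SquareMajorant.

(** * Complex integrals *)

Section ComplexIntegral.
Context d (X : measurableType d) (R : realType) (mu : {measure set X -> \bar R}).
Local Open Scope complex_scope.
Notation Re := complex.Re.
Notation Im := complex.Im.
Variable (D : set X).
Hypothesis mD : measurable D.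
Implicit Types (f g : X -> R[i]).

Definition cintegrable f := mu.-integrable D (EFin \o (fun x => Re (f x))) /\
  mu.-integrable D (EFin \o (fun x => Im (f x))).

Lemma cintegrable_measurable f : cintegrable f -> cmeasurable_fun D f.
Proof. by move=> [f1 f2]; split; apply: integrable_measurable; [exact: f1|exact: f2]. Qed.

Lemma cintegrable_le f (G : X -> R) : cmeasurable_fun D f ->
  (forall x, D x -> cab (f x) <= G x) -> mu.-integrable D (EFin \o G) -> cintegrable f.
Proof.
move=> [m1 m2] fG iG; split; apply: (le_integrableR _ _ _ iG) => // x Dx;
  apply: le_trans (fG x Dx); [exact: Re_le_cab|exact: Im_le_cab].
Qed.

Lemma cintegrableD f g : cintegrable f -> cintegrable g -> cintegrable (fun x => f x + g x).
Proof.
move=> [f1 f2] [g1 g2]; split.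
  by under eq_fun do rewrite /= ReD; exact: integrable_EFinD.
by under eq_fun do rewrite /= ImD; exact: integrable_EFinD.
Qed.

Lemma cintegralD f g : cintegrable f -> cintegrable g ->
  cintegral mu D (fun x => f x + g x) = cintegral mu D f + cintegral mu D g.
Proof.
move=> [f1 f2] [g1 g2]; apply: complex_eq; rewrite ?ReD ?ImD/= -RintegralD//;
  by apply: Rintegral_congr => x _; rewrite ?ReD ?ImD.
Qed.

Lemma cintegrableZ z f : cintegrable f -> cintegrable (fun x => z * f x).
Proof.
move=> [f1 f2]; split.
  under eq_fun do rewrite /= ReM; apply: integrable_EFinB => //; exact: integrable_EFinZ.
under eq_fun do rewrite /= ImM; apply: integrable_EFinD => //; exact: integrable_EFinZ.
Qed.

Lemma cintegralZ z f : cintegrable f ->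
  cintegral mu D (fun x => z * f x) = z * cintegral mu D f.
Proof.
move=> [f1 f2]; apply: complex_eq.
  rewrite ReM /= -!RintegralZl// -RintegralB//; try exact: integrable_EFinZ.
  by apply: Rintegral_congr => x _; rewrite ReM.
rewrite ImM /= -!RintegralZl// -RintegralD//; try exact: integrable_EFinZ.
by apply: Rintegral_congr => x _; rewrite ImM.
Qed.

Lemma cab_cintegral_le f : cintegrable f ->
  cab (cintegral mu D f) <= \int[mu]_(x in D) cab (f x).
Proof.
move=> [f1 f2].
have n1 : mu.-integrable D (EFin \o (fun x => `|Re (f x)|)) by exact: (integrable_norm f1).
have n2 : mu.-integrable D (EFin \o (fun x => `|Im (f x)|)) by exact: (integrable_norm f2).
by rewrite /cab/= RintegralD//; apply: lerD; exact: le_normr_Rintegral.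
Qed.

Lemma integrable_cab f : cintegrable f -> mu.-integrable D (EFin \o (fun x => cab (f x))).
Proof.
move=> [f1 f2]; apply: integrable_EFinD => //.
  exact: (integrable_norm f1).
exact: (integrable_norm f2).
Qed.

Lemma integrable_sum (I : Type) (s : seq I) (F : I -> X -> R) :
  (forall i, mu.-integrable D (EFin \o F i)) ->
  mu.-integrable D (EFin \o (fun x => \sum_(i <- s) F i x)) /\
  \int[mu]_(x in D) \sum_(i <- s) F i x = \sum_(i <- s) \int[mu]_(x in D) F i x.
Proof.
move=> Fi; elim: s => [|i s [ih1 ih2]].
  split; last by rewrite big_nil; apply: Rintegral_eq0 => x _; rewrite big_nil.
  by under eq_fun do rewrite /= big_nil; exact: integrable0.
under eq_fun do rewrite big_cons; split; first exact: integrable_EFinD.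
by rewrite big_cons -ih2 -RintegralD//; apply: Rintegral_congr => x _; rewrite big_cons.
Qed.

(** * Integration of series *)

Section Series.
Variables (f : nat -> X -> R[i]) (r : R) (G : X -> R).
Hypotheses (mf : forall n, cmeasurable_fun D (f n)) (r0 : 0 <= r)
  (fG : forall x, D x -> dominated (f ^~ x) r (G x))
  (iG : mu.-integrable D (EFin \o G)).

Lemma dominated_cintegral : 0 < r ->
  (forall n, cintegrable (f n)) /\
  dominated (fun n => cintegral mu D (f n)) r (\int[mu]_(x in D) G x).
Proof.
move=> r1.
have fi n : cintegrable (f n).
  apply: (@cintegrable_le _ (fun x => r ^- n * G x)) => //.
    move=> x Dx; rewrite ler_pdivlMl ?exprn_gt0//; exact: dominated_term (fG Dx).
  exact: integrable_EFinZ.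
split => // N.
have ci n : mu.-integrable D (EFin \o (fun x => r ^+ n * cab (f n x))).
  by apply: integrable_EFinZ => //; exact: integrable_cab.
apply: (@le_trans _ _ (\sum_(0 <= n < N) \int[mu]_(x in D) (r ^+ n * cab (f n x)))).
  apply: ler_sum => n _; rewrite RintegralZl//; last exact: integrable_cab.
  by rewrite ler_wpM2l ?exprn_ge0//; exact: cab_cintegral_le.
have [ii <-] := @integrable_sum _ (index_iota 0 N) _ ci.
by apply: le_Rintegral => // x Dx; exact: fG.
Qed.

Lemma cintegral_csum z : 0 < r -> cab z <= r ->
  cintegrable (fun x => csum (fun n => z ^+ n * f n x)) /\
  cintegral mu D (fun x => csum (fun n => z ^+ n * f n x)) =
  csum (fun n => z ^+ n * cintegral mu D (f n)).
Proof.
move=> r1 zr.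
have [fi _] := dominated_cintegral r1.
have zf n : cintegrable (fun x => z ^+ n * f n x) by exact: cintegrableZ.
have bd x N : D x -> series (fun n => cab (z ^+ n * f n x)) N <= G x.
  move=> Dx; apply: le_trans (fG Dx N); apply: ler_sum => i _.
  apply: le_trans (cabM _ _) _; rewrite ler_wpM2r ?cab_ge0//.
  by apply: le_trans (cabX _ _) _; rewrite lerXn2r// ?nnegrE ?cab_ge0.
have cs x : D x -> csummable (fun n => z ^+ n * f n x).
  by move=> Dx; have [] := csummable_bounded (bd x ^~ Dx).
have [|x Dx||n x Dx|iR cR] := @Rintegral_dominated _ _ _ mu
    (fun N x => series (fun n => Re (z ^+ n * f n x)) N)
    (fun x => Re (csum (fun n => z ^+ n * f n x))) G D mD.
- move=> N; apply: measurable_sum => n; exact: (cintegrable_measurable (zf n)).1.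
- exact: csum_cvgRe (cs x Dx).
- exact: iG.
- apply: le_trans (ler_norm_sum _ _ _) _; apply: le_trans (bd x n Dx).
  by apply: ler_sum => i _; exact: Re_le_cab.
have [|x Dx||n x Dx|iI cI] := @Rintegral_dominated _ _ _ mu
    (fun N x => series (fun n => Im (z ^+ n * f n x)) N)
    (fun x => Im (csum (fun n => z ^+ n * f n x))) G D mD.
- move=> N; apply: measurable_sum => n; exact: (cintegrable_measurable (zf n)).2.
- exact: csum_cvgIm (cs x Dx).
- exact: iG.
- apply: le_trans (ler_norm_sum _ _ _) _; apply: le_trans (bd x n Dx).
  by apply: ler_sum => i _; exact: Im_le_cab.
split; first by split.
symmetry; apply: csum_eq.
  rewrite [X in X @ _ --> _](_ : _ = fun N => \int[mu]_(x in D) series (fun n => Re (z ^+ n * f n x)) N); first exact: cR.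
  apply/funext => N; rewrite /series/=.
  have [_ ->] := @integrable_sum _ (index_iota 0 N) _ (fun n => (zf n).1).
  by apply: eq_bigr => n _; rewrite -cintegralZ.
rewrite [X in X @ _ --> _](_ : _ = fun N => \int[mu]_(x in D) series (fun n => Im (z ^+ n * f n x)) N); first exact: cI.
apply/funext => N; rewrite /series/=.
have [_ ->] := @integrable_sum _ (index_iota 0 N) _ (fun n => (zf n).2).
by apply: eq_bigr => n _; rewrite -cintegralZ.
Qed.

End Series.
End ComplexIntegral.

(** * Weights *)

Section CauchyWeight.
Context {R : realType}.
Notation mu := (@lebesgue_measure R).
Implicit Types psi : R -> R.

(** An integrable weight with |w'| <= w, so that adding a small multiple of a test
    function leaves a weight. *)
Definition cauchy_weight (x : R) : R := (1 + x ^+ 2)^-1.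

Lemma oneDsqr_ge1' (x : R) : 1 <= 1 + x ^+ 2. Proof. by rewrite lerDl sqr_ge0. Qed.

Lemma oneDsqr_gt0' (x : R) : 0 < 1 + x ^+ 2.
Proof. exact: lt_le_trans (oneDsqr_ge1' x). Qed.

Lemma is_derive_cauchy_weight (x : R) :
  is_derive x 1 cauchy_weight (- (2 * x) * cauchy_weight x ^+ 2).
Proof.
have h : 1 + x ^+ 2 != 0 by rewrite gt_eqF// oneDsqr_gt0'.
have d : is_derive x 1 (fun x : R => 1 + x ^+ 2) (2 * x).
  by apply: is_derive_eq; rewrite /GRing.scale/= !mulr1; ring.
rewrite (_ : _ * _ = - (1 + x ^+ 2) ^- 2 *: (2 * x)); first exact: (@is_deriveV _ (fun x : R => 1 + x ^+ 2) _ _ _ h d).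
by rewrite /cauchy_weight /GRing.scale/= exprVn; ring.
Qed.

Lemma cauchy_weight_gt0 (x : R) : 0 < cauchy_weight x.
Proof. by rewrite invr_gt0 oneDsqr_gt0'. Qed.

Lemma cauchy_weight_le1 (x : R) : cauchy_weight x <= 1.
Proof. by rewrite invf_le1 ?oneDsqr_gt0' ?oneDsqr_ge1'. Qed.

Lemma derive1_cauchy_weight (x : R) :
  derive1 cauchy_weight x = - (2 * x) * cauchy_weight x ^+ 2.
Proof. by rewrite derive1E (@derive_val _ _ _ _ _ _ _ (is_derive_cauchy_weight x)). Qed.

Lemma continuous_cauchy_weight : continuous cauchy_weight.
Proof. exact: (@continuous_oneDsqrV R). Qed.

Lemma derive1_cauchy_weight_le (x : R) : `|derive1 cauchy_weight x| <= cauchy_weight x.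
Proof.
have w0 := cauchy_weight_gt0 x.
have e : (1 + x ^+ 2) * cauchy_weight x = 1 by rewrite mulfV// gt_eqF// oneDsqr_gt0'.
rewrite derive1_cauchy_weight normrM normrN (ger0_norm (sqr_ge0 (cauchy_weight x))).
rewrite expr2 mulrA ler_piMl ?(ltW w0)//.
rewrite normrM (ger0_norm (ler0n R 2)) -[leRHS]e ler_wpM2r ?(ltW w0)//.
by have := sqr_ge0 (1 - `|x|); rewrite -(real_normK (num_real x)); lra.
Qed.

Lemma continuous_derive1_cauchy_weight : continuous (derive1 cauchy_weight).
Proof.
rewrite (_ : derive1 cauchy_weight = fun x => - (2 * x) * cauchy_weight x ^+ 2); last first.
  by apply/funext => x; exact: derive1_cauchy_weight.
move=> x; apply: cvgM; first by apply: cvgN; apply: cvgM; [exact: cvg_cst|exact: cvg_id].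
by apply: cvgM; exact: continuous_cauchy_weight.
Qed.

Lemma integrable_cauchy_weight : mu.-integrable setT (EFin \o cauchy_weight).
Proof.
apply/integrableP; split.
  by apply/measurable_EFinP; apply: measurable_continuous; exact: continuous_cauchy_weight.
have -> : (\int[mu]_x `|(EFin \o cauchy_weight) x| = \int[mu]_x (cauchy_weight x)%:E)%E.
  by apply: eq_integral => x _ /=; rewrite ger0_norm// ltW// cauchy_weight_gt0.
rewrite ge0_symfun_integralT; last 3 first.
- by move=> x; exact/ltW/cauchy_weight_gt0.
- exact: continuous_cauchy_weight.
- by move=> x; rewrite /cauchy_weight/= sqrrN.
rewrite (_ : [set x | (0 <= x)%R] = `[0%R, +oo[%classic); last first.
  by apply/seteqP; split => x /=; rewrite in_itv/= andbT.
have := @integral0y_oneDsqr R; rewrite /oneDsqr /cauchy_weight => ->.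
by rewrite -EFinM ltry.
Qed.

Lemma cauchy_weight_cvg0 (u : nat -> R) : (forall n, u n ^+ 2 = n%:R ^+ 2) ->
  (fun n => cauchy_weight (u n)) @ \oo --> (0 : R).
Proof.
move=> un.
apply: (@squeeze_cvgr _ _ _ _ (fun=> 0) (fun n : nat => n.+1%:R^-1)).
- apply: nearW => n; rewrite ltW ?cauchy_weight_gt0//= /cauchy_weight un lef_pV2 ?posrE//.
    by rewrite -natr1 addrC lerD2l -natrX ler_nat; case: (n) => // k; rewrite -mulnn leq_pmulr.
- exact: cvg_cst.
- exact: cvg_harmonic.
Qed.

Lemma weight_perturbation psi : smooth_compact_support psi ->
  exists2 e : R, 0 < e & forall s : R, 0 <= s <= e ->
    weight 2 (fun x => cauchy_weight x + s * psi x) /\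
    (forall x, cauchy_weight x + s * psi x <= 2 * cauchy_weight x).
Proof.
move=> tpsi.
have [M [B [M0 psi0 psiB]]] := test_bound tpsi.
have [M1 [B1 [M10 psi10 psiB1]]] := test_bound (test_derive1 tpsi).
pose m := (1 + (M + M1) ^+ 2)^-1; pose K := B + B1 + 1.
have B0 : 0 <= B by exact: le_trans (psiB 0).
have B10 : 0 <= B1 by exact: le_trans (psiB1 0).
have K0 : 0 < K by rewrite /K; lra.
have m0 : 0 < m by rewrite invr_gt0 oneDsqr_gt0'.
have wm (x : R) : `|x| <= M + M1 -> m <= cauchy_weight x.
  move=> xM; rewrite lef_pV2 ?posrE ?oneDsqr_gt0'// lerD2l -(real_normK (num_real x)).
  by rewrite lerXn2r// ?nnegrE//; lra.
exists (m / (4 * K)); first by rewrite divr_gt0// mulr_gt0.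
move=> s /andP[s0 se].
have sK : s * K <= m / 4.
  apply: le_trans (ler_wpM2r (ltW K0) se) _; rewrite le_eqVlt; apply/orP; left; apply/eqP.
  by move: K0; move: (K) (m) => k l k0; field; rewrite gt_eqF.
have small x : s * `|psi x| <= cauchy_weight x / 4.
  have w0 := cauchy_weight_gt0 x.
  have [xM|xM] := leP `|x| (M + M1).
    have := ler_wpM2l s0 (psiB x); have := wm x xM.
    have : s * B <= s * K by rewrite ler_wpM2l// /K; lra.
    by lra.
  by rewrite psi0 ?normr0 ?mulr0; lra.
have small1 x : s * `|derive1 psi x| <= cauchy_weight x / 4.
  have w0 := cauchy_weight_gt0 x.
  have [xM|xM] := leP `|x| (M + M1).
    have := ler_wpM2l s0 (psiB1 x); have := wm x xM.
    have : s * B1 <= s * K by rewrite ler_wpM2l// /K; lra.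
    by lra.
  by rewrite psi10 ?normr0 ?mulr0; lra.
have lo x : 3 / 4 * cauchy_weight x <= cauchy_weight x + s * psi x.
  have := small x; rewrite -{1}(ger0_norm s0) -normrM ler_norml => /andP[h _].
  by move: h; move: (s * psi x) (cauchy_weight x) => a b; lra.
have hi x : cauchy_weight x + s * psi x <= 2 * cauchy_weight x.
  have := small x; rewrite -{1}(ger0_norm s0) -normrM ler_norml => /andP[_ h].
  by have := cauchy_weight_gt0 x; move: h; move: (s * psi x) (cauchy_weight x) => a b; lra.
have dpsi (x : R) : derivable psi x 1 by exact: (smooth_derivable tpsi.1).
have dw (x : R) : derivable cauchy_weight x 1 by have [] := is_derive_cauchy_weight x.
have ds (x : R) : derivable (fun y => s * psi y) x 1 by apply: derivableM; [exact: derivable_cst|exact: dpsi].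
have d1 x : derive1 (fun x => cauchy_weight x + s * psi x) x = derive1 cauchy_weight x + s * derive1 psi x.
  rewrite derive1E deriveD// !derive1E; congr (_ + _).
  by rewrite (deriveZ s (dpsi x)).
split; last exact: hi.
split; last split.
- split.
  + by move=> x; apply: lt_le_trans (lo x); rewrite mulr_gt0// cauchy_weight_gt0.
  + by move=> x; apply: derivableD; [exact: dw|exact: ds].
  + rewrite (_ : derive1 _ = fun x => derive1 cauchy_weight x + s * derive1 psi x); last exact/funext.
    move=> x; apply: cvgD; first exact: continuous_derive1_cauchy_weight.
    by apply: cvgM; [exact: cvg_cst|exact: (test_continuous (test_derive1 tpsi))].
  + move=> x; rewrite d1; apply: le_trans (ler_normD _ _) _.
    rewrite normrM (ger0_norm s0).
    have := small1 x; have := derive1_cauchy_weight_le x; have := lo x.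
    by have := cauchy_weight_gt0 x; lra.
  + apply: integrable_EFinD => //; first exact: integrable_cauchy_weight.
    apply: integrable_EFinZ => //.
    by apply: compact_support_integrable psi0; exact: test_continuous.
- rewrite -[X in _ --> X](addr0 0); apply: cvgD; first exact: cauchy_weight_cvg0.
  rewrite -(mulr0 s); apply: cvgM; first exact: cvg_cst.
  apply: cvg_near_cst; near=> n; apply: psi0; rewrite ger0_norm//.
  by near: n; exact: nbhs_infty_ger.
- rewrite -[X in _ --> X](addr0 0); apply: cvgD; first by apply: cauchy_weight_cvg0 => n; rewrite sqrrN.
  rewrite -(mulr0 s); apply: cvgM; first exact: cvg_cst.
  apply: cvg_near_cst; near=> n; apply: psi0; rewrite normrN ger0_norm//.
  by near: n; exact: nbhs_infty_ger.
Unshelve. all: end_near. Qed.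

End CauchyWeight.

(** * Integration of series defined almost everywhere *)

Section AlmostEverywhereInterchange.
Context d (X : measurableType d) (R : realType) (mu : {measure set X -> \bar R}).
Local Open Scope complex_scope.
Notation Re := complex.Re.
Notation Im := complex.Im.
Variable (D : set X).
Hypothesis mD : measurable D.

Lemma cintegrable_ae (f g : X -> R[i]) : cintegrable mu D f -> cmeasurable_fun D g ->
  {ae mu, forall x, D x -> f x = g x} ->
  cintegrable mu D g /\ cintegral mu D f = cintegral mu D g.
Proof.
move=> [f1 f2] [g1 g2] fg; split.
  split.
    apply: ae_le_integrableR (integrable_norm f1) => //.
    by apply: ae_mono fg _ => x h /h <-.
  apply: ae_le_integrableR (integrable_norm f2) => //.
  by apply: ae_mono fg _ => x h /h <-.
have m1 := integrable_measurable f1; have m2 := integrable_measurable f2.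
by apply: complex_eq => /=; apply: ae_eq_Rintegral => //; apply: ae_mono fg _ => x h /h <-.
Qed.

Lemma dominated_le c (r r' B : R) : 0 <= r <= r' -> dominated c r' B -> dominated c r B.
Proof.
move=> /andP[r0 rr] cB N; apply: le_trans (cB N); apply: ler_sum => n _.
by rewrite ler_wpM2r ?cab_ge0// lerXn2r// ?nnegrE// (le_trans r0).
Qed.

Lemma dominated0 (r : R) : dominated (fun=> 0) r 0.
Proof. by move=> N; rewrite /series/= big1// => i _; rewrite cab0 mulr0. Qed.

Lemma cmeasurable_csum (f : nat -> X -> R[i]) : (forall n, cmeasurable_fun D (f n)) ->
  (forall x, D x -> csummable (f ^~ x)) -> cmeasurable_fun D (fun x => csum (f ^~ x)).
Proof.
move=> mf cs; split.
  have m1 N : measurable_fun D (fun x => series (fun n => Re (f n x)) N).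
    by apply: measurable_sum => n; exact: (mf n).1.
  by apply: measurable_fun_cvg m1 _ => x Dx; exact: csum_cvgRe (cs x Dx).
have m2 N : measurable_fun D (fun x => series (fun n => Im (f n x)) N).
  by apply: measurable_sum => n; exact: (mf n).2.
by apply: measurable_fun_cvg m2 _ => x Dx; exact: csum_cvgIm (cs x Dx).
Qed.

Lemma cintegral_csum_ae (f : nat -> X -> R[i]) (r : R) (G : X -> R) (h : X -> R[i]) z :
  (forall n, cmeasurable_fun D (f n)) -> cmeasurable_fun D h -> 0 < r -> cab z <= r ->
  mu.-integrable D (EFin \o G) ->
  {ae mu, forall x, D x -> dominated (f ^~ x) r (G x) /\ h x = csum (fun n => z ^+ n * f n x)} ->
  [/\ forall n, cintegrable mu D (f n), cintegrable mu D h, dominated (fun n => cintegral mu D (f n)) r (\int[mu]_(x in D) G x) &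
   cintegral mu D h = csum (fun n => z ^+ n * cintegral mu D (f n))].
Proof.
move=> mf mh r0 zr iG [A [mA A0 hA]].
have good x : ~ A x -> D x -> dominated (f ^~ x) r (G x) /\ h x = csum (fun n => z ^+ n * f n x).
  by move=> nA Dx; apply: contrapT => n; apply: nA; apply: hA => /= H; apply: n; exact: H.
pose k n x := if x \in A then 0 else f n x.
pose H x := if x \in A then 0 else G x.
have mdec : measurable_fun D (fun x => x \in A) .
  apply: (@measurable_fun_bool _ _ D _ true); rewrite (_ : _ @^-1` _ = A); first exact: measurableI.
  by apply/seteqP; split => x /=; [move/set_mem|move/mem_set].
have mif (u : X -> R) : measurable_fun D u -> measurable_fun D (fun x => if x \in A then 0 else u x).
  move=> mu'; apply: measurable_fun_if => //.
  by apply: measurable_funS mu' => //; exact: subIsetl.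
have mk n : cmeasurable_fun D (k n).
  have [m1 m2] := mf n; split.
    rewrite (_ : (fun x => _) = fun x => if x \in A then 0 else Re (f n x)); last first.
      by apply/funext => x; rewrite /k; case: ifP.
    exact: mif.
  rewrite (_ : (fun x => _) = fun x => if x \in A then 0 else Im (f n x)); last first.
    by apply/funext => x; rewrite /k; case: ifP.
  exact: mif.
have aeA : {ae mu, forall x, ~ A x} by exists A; split => // x /= /contrapT.
have mG := integrable_measurable iG.
have mH : measurable_fun D H by exact: mif.
have iH : mu.-integrable D (EFin \o H).
  apply: ae_le_integrableR (integrable_norm iG) => //.
  by apply: ae_mono aeA _ => x nA _; rewrite /H memNset.
have kH x : D x -> dominated (k ^~ x) r (H x).
  move=> Dx; rewrite /k /H; case: ifPn; first by move=> _; exact: dominated0.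
  by move=> /negP nA; have [] := good x _ Dx; first by move=> Ax; apply: nA; rewrite inE.
have [ik dk] := dominated_cintegral mD mk (ltW r0) kH iH r0.
have kf n : {ae mu, forall x, D x -> k n x = f n x}.
  by apply: ae_mono aeA _ => x nA _; rewrite /k memNset.
have kfE n : cintegral mu D (k n) = cintegral mu D (f n).
  by have [] := cintegrable_ae (ik n) (mf n) (kf n).
have [ic cE] := cintegral_csum mD mk (ltW r0) kH iH r0 zr.
have ch : {ae mu, forall x, D x -> csum (fun n => z ^+ n * k n x) = h x}.
  apply: ae_mono aeA _ => x nA Dx; have [_ ->] := good x nA Dx.
  by congr csum; apply/funext => n; rewrite /k memNset.
have [ih hE] := cintegrable_ae ic mh ch.
have fkE : (fun n => cintegral mu D (f n)) = (fun n => cintegral mu D (k n)).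
  by apply/funext => n; rewrite kfE.
split => //; first by move=> n; have [] := cintegrable_ae (ik n) (mf n) (kf n).
  rewrite fkE; apply: dominatedW dk; rewrite (@ae_eq_Rintegral _ _ _ mu D H G)//.
  by apply: ae_mono aeA _ => x nA _; rewrite /H memNset.
by rewrite -hE cE; congr csum; apply/funext => n; rewrite kfE.
Qed.

End AlmostEverywhereInterchange.

(** * Weak derivatives of series *)

Section EntireFamilies.
Context {R : realType}.
Notation mu := (@lebesgue_measure R).
Local Open Scope complex_scope.
Notation Re := complex.Re.
Notation Im := complex.Im.
Implicit Types (z : R[i]).

Lemma weak_derivativeP (f g : R -> R[i]) : weak_derivative f g <->
  weak_diff (fun x => Re (f x)) (fun x => Re (g x)) /\
  weak_diff (fun x => Im (f x)) (fun x => Im (g x)).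
Proof.
have ReC (h : R -> R[i]) (psi : R -> R) :
    Re (cintegral mu setT (fun x => h x * (psi x)%:C)) = \int[mu]_x (Re (h x) * psi x).
  by apply: Rintegral_congr => x _; rewrite ReM/= mulr0 subr0.
have ImC (h : R -> R[i]) (psi : R -> R) :
    Im (cintegral mu setT (fun x => h x * (psi x)%:C)) = \int[mu]_x (Im (h x) * psi x).
  by apply: Rintegral_congr => x _; rewrite ImM/= mulr0 add0r.
split=> [fg|[fgR fgI] psi tpsi].
  split=> psi tpsi; have e := fg psi tpsi.
    by rewrite -ReC e ReN ReC.
  by rewrite -ImC e ImN ImC.
apply: complex_eq; first by rewrite ReN !ReC; exact: fgR.
by rewrite ImN !ImC; exact: fgI.
Qed.

Lemma cmeasurableM d (X : measurableType d) (D : set X) (f g : X -> R[i]) :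
  cmeasurable_fun D f -> cmeasurable_fun D g -> cmeasurable_fun D (fun x => f x * g x).
Proof.
move=> [f1 f2] [g1 g2]; split.
  by under eq_fun do rewrite ReM; apply: measurable_funB; exact: measurable_funM.
by under eq_fun do rewrite ImM; apply: measurable_funD; exact: measurable_funM.
Qed.

Lemma cmeasurableD d (X : measurableType d) (D : set X) (f g : X -> R[i]) :
  cmeasurable_fun D f -> cmeasurable_fun D g -> cmeasurable_fun D (fun x => f x + g x).
Proof.
move=> [f1 f2] [g1 g2]; split.
  by under eq_fun do rewrite ReD; exact: measurable_funD.
by under eq_fun do rewrite ImD; exact: measurable_funD.
Qed.

Lemma cmeasurable_cst d (X : measurableType d) (D : set X) z : cmeasurable_fun D (fun _ : X => z).
Proof. by split; exact: measurable_cst. Qed.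

Lemma cmeasurable_real d (X : measurableType d) (D : set X) (f : X -> R) :
  measurable_fun D f -> cmeasurable_fun D (fun x => (f x)%:C).
Proof. by move=> mf; split => //=; exact: measurable_cst. Qed.

Lemma cab_real (a : R) : cab a%:C = `|a|.
Proof. by rewrite /cab/= normr0 addr0. Qed.

Lemma dominatedMr (c : nat -> R[i]) (r B : R) z : 0 <= r -> dominated c r B ->
  dominated (fun n => c n * z) r (B * cab z).
Proof.
move=> r0 cB; rewrite mulrC (_ : (fun n => _) = fun n => z * c n); first exact: dominatedZ.
by apply/funext => n; rewrite mulrC.
Qed.

Lemma dominated_csummable (c : nat -> R[i]) (r B : R) z : cab z <= r -> dominated c r B ->
  csummable (fun n => z ^+ n * c n).
Proof.
move=> zr cB; suff /dominated_csum[] : dominated c (cab z) B by [].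
by apply: dominated_le cB; rewrite cab_ge0.
Qed.

Lemma cintegral_test_csum (f : nat -> R -> R[i]) (h : R -> R[i]) (G psi : R -> R) (r : R) z :
  (forall n, cmeasurable_fun setT (f n)) -> cmeasurable_fun setT h ->
  0 < r -> cab z <= r -> locally_integrable setT G ->
  {ae mu, forall x, dominated (f ^~ x) r (G x) /\ h x = csum (fun n => z ^+ n * f n x)} ->
  smooth_compact_support psi ->
  dominated (fun n => cintegral mu setT (fun x => f n x * (psi x)%:C)) r
    (\int[mu]_x (G x * `|psi x|)) /\
  cintegral mu setT (fun x => h x * (psi x)%:C) =
  csum (fun n => z ^+ n * cintegral mu setT (fun x => f n x * (psi x)%:C)).
Proof.
move=> mf mh r0 zr lG df tpsi.
have mpsi : measurable_fun setT psi by apply: measurable_continuous; exact: test_continuous.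
have [||||||_ _ dd ->//] := @cintegral_csum_ae _ _ _ mu setT measurableT
  (fun n x => f n x * (psi x)%:C) r (fun x => G x * `|psi x|) (fun x => h x * (psi x)%:C) z.
- by move=> n; apply: (cmeasurableM (mf n)); exact: (cmeasurable_real mpsi).
- by apply: (cmeasurableM mh); exact: (cmeasurable_real mpsi).
- exact: r0.
- exact: zr.
- have iGpsi := loc_test_integrable lG tpsi.
  apply: (le_integrableR _ _ _ (integrable_norm iGpsi)) => //.
    by apply: measurable_funM; [case: lG|exact: measurableT_comp].
  by move=> x _ /=; rewrite !normrM normr_id.
- apply: ae_mono df _ => x [dx Hx] _; split.
    by rewrite -cab_real; apply: dominatedMr => //; exact: ltW.
  rewrite Hx mulrC -csumZ; last exact: dominated_csummable dx.
  by congr csum; apply/funext => n; rewrite mulrCA [_%:C * _]mulrC.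
Qed.

Lemma weak_derivative_csum (f f' : nat -> R -> R[i]) (h h' : R -> R[i]) (G G' : R -> R) (r : R) z :
  (forall n, cmeasurable_fun setT (f n)) -> (forall n, cmeasurable_fun setT (f' n)) ->
  cmeasurable_fun setT h -> cmeasurable_fun setT h' ->
  0 < r -> cab z <= r -> locally_integrable setT G -> locally_integrable setT G' ->
  {ae mu, forall x, dominated (f ^~ x) r (G x) /\ h x = csum (fun n => z ^+ n * f n x)} ->
  {ae mu, forall x, dominated (f' ^~ x) r (G' x) /\ h' x = csum (fun n => z ^+ n * f' n x)} ->
  (forall n, weak_derivative (f n) (f' n)) -> weak_derivative h h'.
Proof.
move=> mf mf' mh mh' r0 zr lG lG' df df' wd psi tpsi.
have [_ ->] := cintegral_test_csum mf mh r0 zr lG df (test_derive1 tpsi).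
have [dd ->] := cintegral_test_csum mf' mh' r0 zr lG' df' tpsi.
rewrite -mulN1r -csumZ; last exact: dominated_csummable dd.
by congr csum; apply/funext => n; rewrite wd// mulN1r mulrN.
Qed.

End EntireFamilies.

(** * Rigidity of entire families of solutions *)

Section EntireSolutions.
Context {R : realType}.
Notation mu := (@lebesgue_measure R).
Local Open Scope complex_scope.
Notation Re := complex.Re.
Notation Im := complex.Im.
Implicit Types (z : R[i]).

(** The condition that makes wsum an entire function of z with values in L^2 of the
    strip. *)
Definition majorized (w : nat -> R * R -> R[i]) :=
  (forall n, cmeasurable_fun setT (w n)) /\
  forall r, 0 < r -> exists2 g : R * R -> R, sqint g & forall p, dominated (w ^~ p) r (g p).

Definition wsum (w : nat -> R * R -> R[i]) z p : R[i] := csum (fun n => z ^+ n * w n p).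

Lemma cab_lt_radius z : 0 < cab z + 1. Proof. by rewrite ltr_wpDl ?cab_ge0. Qed.

Lemma majorized_csummable w z p : majorized w -> csummable (fun n => z ^+ n * w n p).
Proof.
move=> [_ mj]; have [g _ gw] := mj _ (cab_lt_radius z).
by apply: dominated_csummable (gw p); rewrite lerDl.
Qed.

Lemma cmeasurable_wsum w z : majorized w -> cmeasurable_fun setT (wsum w z).
Proof.
move=> mw; apply: cmeasurable_csum => [n|p _]; last exact: majorized_csummable.
by apply: cmeasurableM; [exact: cmeasurable_cst|exact: mw.1].
Qed.

Lemma sqint_le (f g : R * R -> R) : measurable_fun setT f -> sqint g ->
  (forall p, `|f p| <= g p) -> sqint f.
Proof.
move=> mf [mg g2] fg; split => //.
apply: (le_integrableR _ _ _ g2) => //; first exact: measurable_funX.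
move=> p _; rewrite normrX; apply: (lerXn2r 2 _ _ (fg p)); rewrite nnegrE//.
exact: le_trans (fg p).
Qed.

Lemma sqintZ (k : R) (f : R * R -> R) : sqint f -> sqint (fun p => k * f p).
Proof.
move=> [mf f2]; split; first exact: measurable_funM.
under eq_fun do rewrite /= exprMn; exact: integrable_EFinZ.
Qed.

Lemma sqint_wsum w z : majorized w ->
  sqint (fun p => Re (wsum w z p)) /\ sqint (fun p => Im (wsum w z p)).
Proof.
move=> mw; have [m1 m2] := cmeasurable_wsum z mw.
have [g sg gw] := mw.2 _ (cab_lt_radius z).
have s2 := sqintZ 2 sg.
have le p : cab (wsum w z p) <= 2 * g p.
  have gz : dominated (w ^~ p) (cab z) (g p).
    by apply: dominated_le (gw p); rewrite cab_ge0 lerDl ler01.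
  by have [] := dominated_csum gz.
split; apply: sqint_le s2 _ => // p; apply: le_trans (le p); first exact: Re_le_cab.
exact: Im_le_cab.
Qed.

Lemma cmeasurable_conv d (X : measurableType d) (D : set X) (f g : nat -> X -> R[i]) n :
  (forall n, cmeasurable_fun D (f n)) -> (forall n, cmeasurable_fun D (g n)) ->
  cmeasurable_fun D (fun x => conv (f ^~ x) (g ^~ x) n).
Proof.
move=> mf mg; split.
  under eq_fun do rewrite /conv Re_sum; apply: measurable_sum => i.
  exact: (cmeasurableM (mf i) (mg _)).1.
under eq_fun do rewrite /conv Im_sum; apply: measurable_sum => i.
exact: (cmeasurableM (mf i) (mg _)).2.
Qed.

Section core.
Variables (T K : R) (Phi : R -> R[i]) (w0 w1 w2 : nat -> R * R -> R[i]).
Hypotheses (bump : @has_bump R) (T0 : 0 < T).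
Hypotheses (mPhi : cmeasurable_fun setT Phi) (PhiK : forall x, cab (Phi x) <= K).
Hypotheses (M0 : majorized w0) (M1 : majorized w1) (M2 : majorized w2).
Hypothesis slices : {ae mu, forall s, 0 < s < T -> forall n,
  weak_derivative (fun x => w0 n (s, x)) (fun x => w1 n (s, x)) /\
  weak_derivative (fun x => w1 n (s, x)) (fun x => w2 n (s, x))}.

(** The coefficient of z^n in W_x - W^2 / 2. *)
Definition cflux n p : R[i] := w1 n p + (- 2^-1)%:C * conv (w0 ^~ p) (w0 ^~ p) n.
(** The coefficient of z^n of the potential; the initial value z Phi contributes to
    the first one only. *)
Definition cheight n t x : R[i] :=
  (n == 1%N)%:R * Phi x + cintegral mu `[0, t] (fun s => cflux n (s, x)).

Hypothesis slicesG : {ae mu, forall t, 0 < t < T -> forall n,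
  weak_derivative (cheight n t) (fun x => w0 n (t, x))}.

Lemma K_ge0 : 0 <= K. Proof. exact: le_trans (cab_ge0 _) (PhiK 0). Qed.

Lemma cmeasurable_cflux n : cmeasurable_fun setT (cflux n).
Proof.
apply: cmeasurableD; first exact: M1.1.
apply: cmeasurableM; first exact: cmeasurable_cst.
by apply: cmeasurable_conv; exact: M0.1.
Qed.

Lemma cmeasurable_cumulative (f : R * R -> R[i]) t : cmeasurable_fun setT f ->
  cmeasurable_fun setT (fun x => cintegral mu `[0, t] (fun s => f (s, x))).
Proof.
move=> [f1 f2]; split.
  exact: (measurable_section1 t (measurable_cumulative f1)).
exact: (measurable_section1 t (measurable_cumulative f2)).
Qed.

Lemma cmeasurable_cheight n t : cmeasurable_fun setT (cheight n t).
Proof.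
apply: cmeasurableD; last exact: (cmeasurable_cumulative t (cmeasurable_cflux n)).
by apply: cmeasurableM => //; exact: cmeasurable_cst.
Qed.

Lemma flux_series z p :
  csummable (fun n => z ^+ n * cflux n p) /\
  csum (fun n => z ^+ n * cflux n p) = wsum w1 z p + (- 2^-1)%:C * wsum w0 z p ^+ 2.
Proof.
have c0 : csummable (fun n => z ^+ n * w0 n p) by exact: majorized_csummable.
have c1 : csummable (fun n => z ^+ n * w1 n p) by exact: majorized_csummable.
have [cc _] := csummable_conv c0 c0.
have e : (fun n => z ^+ n * cflux n p) = fun n => z ^+ n * w1 n p +
    (- 2^-1)%:C * conv (fun n => z ^+ n * w0 n p) (fun n => z ^+ n * w0 n p) n.
  by apply/funext => n; rewrite conv_pow mulrDr mulrCA.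
rewrite e; split; first by apply: csummableD => //; exact: csummableZ.
by rewrite csumD ?csumZ ?csum_conv ?expr2//; exact: csummableZ.
Qed.

Lemma flux_young (a b v : R) : 0 <= v <= 1 ->
  (a + 2^-1 * (b * b)) * v <= a ^+ 2 + v + b ^+ 2.
Proof.
move=> /andP[v0 v1].
have h1 : 0 <= v * (a ^+ 2 - a + 1) by rewrite mulr_ge0//; have := sqr_ge0 (a - 2^-1); nra.
have h2 : 0 <= (1 - v) * a ^+ 2 by rewrite mulr_ge0 ?subr_ge0// sqr_ge0.
have h3 : 0 <= (1 - v) * b ^+ 2 by rewrite mulr_ge0 ?subr_ge0// sqr_ge0.
have h4 : 0 <= v * b ^+ 2 by rewrite mulr_ge0// sqr_ge0.
by lra.
Qed.

Lemma flux_majorant r : 0 < r -> exists G : R * R -> R,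
  [/\ measurable_fun setT G, forall p, dominated (cflux ^~ p) r (G p),
   {ae mu, forall x, mu.-integrable `[0, T] (EFin \o (fun s => G (s, x)))} &
   mu.-integrable setT (EFin \o (fun x => (\int[mu]_(s in `[0, T]) G (s, x)) * cauchy_weight x))].
Proof.
move=> r0; have [g0 [mg0 ig0] gw0] := M0.2 r r0; have [g1 [mg1 ig1] gw1] := M1.2 r r0.
pose G p := g1 p + 2^-1 * (g0 p * g0 p).
have mG : measurable_fun setT G.
  by apply: measurable_funD => //; apply: measurable_funM => //; exact: measurable_funM.
have G0 p : 0 <= G p.
  rewrite addr_ge0 ?(dominated_ge0 (gw1 p))// mulr_ge0 ?invr_ge0//.
  by rewrite -expr2 sqr_ge0.
pose w : R -> R := @cauchy_weight R.
have w_ge0 x : 0 <= w x by exact/ltW/cauchy_weight_gt0.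
pose F p := \1_`[0, T] p.1 * (G p * w p.2).
have mw : measurable_fun setT w.
  by apply: measurable_continuous; exact: continuous_cauchy_weight.
have mI : measurable_fun setT (fun p : R * R => \1_`[0, T] p.1 : R).
  by apply: (measurableT_comp (measurable_indic _)) => //; exact: measurable_itv.
have mF : measurable_fun setT F.
  apply: measurable_funM => //; apply: measurable_funM => //.
  exact: (measurableT_comp mw).
have iI : mu.-integrable setT (EFin \o (\1_`[0, T] : R -> R)).
  exact: integrable_indic_itv.
have iF : (mu \x mu)%E.-integrable setT (EFin \o F).
  have iIw := integrable_tensor iI (integrable_cauchy_weight (R := R)).
  have ib := integrable_EFinD measurableT (integrable_EFinD measurableT ig1 iIw) ig0.
  apply: (le_integrableR _ _ _ ib) => // -[s x] _ /=.
  rewrite ger0_norm; last by rewrite /F mulr_ge0 ?mulr_ge0//= indicE ler0n.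
  rewrite /F /= indicE; case: (_ \in _); rewrite ?mul1r ?mul0r ?addr0.
    by apply: flux_young; rewrite cauchy_weight_le1 w_ge0.
  by rewrite addr_ge0// sqr_ge0.
have iG : {ae mu, forall x, mu.-integrable `[0, T] (EFin \o (fun s => G (s, x)))}.
  apply: ae_mono (ae_integrable2 iF) _ => x ix.
  have w0x : w x != 0 by rewrite gt_eqF ?cauchy_weight_gt0.
  have ix' : mu.-integrable setT (EFin \o (fun s => (w x)^-1 * F (s, x))) by exact: integrable_EFinZ.
  have ixT : mu.-integrable `[0, T] (EFin \o (fun s => (w x)^-1 * F (s, x))).
    by apply: integrableS ix' => //; exact: measurable_itv.
  apply: eq_integrable ixT => // s; rewrite inE /F /= => sT; rewrite indicE mem_set// mul1r.
  by rewrite mulrCA mulVf ?mulr1.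
exists G; split => //.
- move=> p; apply: dominatedD (ltW r0) (gw1 p) _.
  have := dominatedZ (- 2^-1)%:C (ltW r0) (dominated_conv (ltW r0) (gw0 p) (gw0 p)).
  by rewrite cab_real normrN gtr0_norm ?invr_gt0.
- have iE := integrable_Rfubini2 iF.
  apply: (ae_le_integrableR _ _ _ (integrable_norm iE)) => //.
    apply: measurable_funM; last exact: mw.
    exact: (measurable_section1 T (measurable_cumulative mG)).
  apply: ae_mono iG _ => x ix _; rewrite -RintegralZr//= Rintegral_mkcond.
  rewrite le_eqVlt; apply/orP; left; apply/eqP; congr `|_|.
  apply: Rintegral_congr => s _; rewrite patchE /F /= indicE.
  by case: ifPn => _; rewrite ?mul1r ?mul0r.
Qed.

Lemma csum_single (c : nat -> R[i]) k : (forall n, n != k -> c n = 0) -> csum c = c k.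
Proof.
move=> ck.
have key (u : R[i] -> R) : u 0 = 0 -> series (fun n => u (c n)) @ \oo --> u (c k).
  move=> u0; apply: cvg_near_cst; exists k.+1 => // N /= kN.
  rewrite /series/= (bigD1_seq k) ?mem_index_iota ?iota_uniq//= big1 ?addr0// => n nk.
  by rewrite ck.
by apply: csum_eq; exact: key.
Qed.

(** For almost every x the series may be integrated term by term in time, at all times
    simultaneously, because its majorant does not depend on t. *)
Lemma height_series r z : 0 < r -> cab z <= r -> exists H : R -> R,
  [/\ locally_integrable setT H,
   mu.-integrable setT (EFin \o (fun x => H x * cauchy_weight x)) &
   {ae mu, forall x, forall t, 0 < t < T ->
     dominated (fun n => cheight n t x) r (H x) /\
     z * Phi x + cintegral mu `[0, t] (fun s => csum (fun n => z ^+ n * cflux n (s, x))) =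
       csum (fun n => z ^+ n * cheight n t x)}].
Proof.
move=> r0 zr; have [G [mG dG iG iGw]] := flux_majorant r0.
pose E x := \int[mu]_(s in `[0, T]) G (s, x).
have mE : measurable_fun setT E by exact: (measurable_section1 T (measurable_cumulative mG)).
have G0 p : 0 <= G p by exact: dominated_ge0 (dG p).
have iH : mu.-integrable setT (EFin \o (fun x => (r * K + E x) * cauchy_weight x)).
  under eq_fun do rewrite /= mulrDl; apply: integrable_EFinD => //.
  by apply: integrable_EFinZ => //; exact: integrable_cauchy_weight.
exists (fun x => r * K + E x); split => //.
  apply: loc_integrableP => [|a b]; first by apply: measurable_funD.
  have iHab : mu.-integrable `[a, b] (EFin \o (fun x => (r * K + E x) * cauchy_weight x)).
    by apply: integrableS iH => //; exact: measurable_itv.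
  have cw : continuous (fun x : R => 1 + x ^+ 2) by exact: continuous_oneDsqr.
  have := @integrable_boundedM _ _ _ mu `[a, b] (fun x => 1 + x ^+ 2)
    (fun x => (r * K + E x) * cauchy_weight x) (1 + (`|a| + `|b|) ^+ 2) _ _ _ iHab.
  have -> : (fun x : R => (1 + x ^+ 2) * ((r * K + E x) * cauchy_weight x)) = (fun x => r * K + E x).
    apply/funext => x; rewrite mulrCA /cauchy_weight mulfV ?mulr1// gt_eqF//.
    exact: oneDsqr_gt0'.
  apply; first exact: measurable_itv.
  - by apply: (@measurable_funS _ _ _ _ setT) => //; exact: measurable_continuous.
  - move=> x /=; rewrite in_itv/= => /andP[ax xb].
    rewrite ger0_norm ?(ltW (oneDsqr_gt0' x))// lerD2l -(real_normK (num_real x)).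
    rewrite lerXn2r// ?nnegrE// ?addr_ge0// ler_norml.
    have := ler_norm a; have := ler_norm (- a); have := ler_norm b; have := ler_norm (- b).
    by rewrite !normrN => ? ? ? ?; lra.
apply: ae_mono iG _ => x ix t /andP[t0 tT].
have sub : `[0, t]%classic `<=` `[0, T]%classic.
  by move=> s /=; rewrite !in_itv/= => /andP[-> st]; rewrite (le_trans st)// ltW.
have ixt : mu.-integrable `[0, t] (EFin \o (fun s => G (s, x))).
  by apply: integrableS ix => //; exact: measurable_itv.
have mfx n : cmeasurable_fun `[0, t] (fun s => cflux n (s, x)).
  have [m1 m2] := cmeasurable_cflux n; split.
    exact: measurable_funS (measurable_section2 x m1).
  exact: measurable_funS (measurable_section2 x m2).
have dx s : `[0, t]%classic s -> dominated (fun n => cflux n (s, x)) r (G (s, x)).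
  by move=> _; exact: dG.
have [ci di] := @dominated_cintegral _ _ _ mu `[0, t]%classic (measurable_itv _) _ _ _ mfx (ltW r0) dx ixt r0.
have [_ ->] := @cintegral_csum _ _ _ mu `[0, t]%classic (measurable_itv _) _ _ _ mfx (ltW r0) dx ixt _ r0 zr.
have hE : \int[mu]_(s in `[0, t]) G (s, x) <= E x.
  by apply: ge0_le_RintegralS => //; exact: measurable_itv.
have dP : dominated (fun n => (n == 1%N)%:R * Phi x) r (r * K).
  move=> N; rewrite /series/=.
  apply: (@le_trans _ _ (\sum_(0 <= n < N) (n == 1%N)%:R * (r * K))).
    apply: ler_sum => n _; case: eqVneq => [->|_]; rewrite ?mul0r ?cab0 ?mulr0//.
    by rewrite !mul1r expr1 ler_wpM2l ?(ltW r0)//.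
  rewrite -mulr_suml ler_piMl ?mulr_ge0 ?(ltW r0) ?K_ge0//.
  elim: N => [|N ih]; first by rewrite big_geq.
  rewrite big_nat_recr//=; case: eqVneq => [->|_]; last by rewrite addr0.
  by rewrite big_nat1 add0r.
split; first by apply: dominatedD (ltW r0) dP (dominatedW hE di).
rewrite /cheight.
have cP := dominated_csummable zr dP; have cI := dominated_csummable zr di.
under [in RHS]eq_fun do rewrite mulrDr.
rewrite csumD//; congr (_ + _).
rewrite (@csum_single _ 1%N) ?mul1r ?expr1// => n n1.
by rewrite (negbTE n1) mul0r mulr0.
Qed.

Definition full_height z t x : R[i] :=
  z * Phi x + cintegral mu `[0, t] (fun s => csum (fun n => z ^+ n * cflux n (s, x))).

Lemma full_height_Re z t x : Re (full_height z t x) =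
  height (fun x => Re (z * Phi x)) (fun p => Re (wsum w0 z p)) (fun p => Re (wsum w1 z p))
    (fun p => Im (wsum w0 z p)) t x.
Proof.
rewrite /full_height ReD /height; congr (_ + _).
have cE s : Re (csum (fun n => z ^+ n * cflux n (s, x))) =
    flux (fun p => Re (wsum w0 z p)) (fun p => Re (wsum w1 z p)) (fun p => Im (wsum w0 z p)) (s, x).
  by have [_ ->] := flux_series z (s, x); rewrite /flux ReD expr2 !ReM; case: (wsum w1 z _) (wsum w0 z _) => a a' [b b'] /=; field.
by apply: Rintegral_congr => s _; exact: cE.
Qed.

Lemma cmeasurable_full_height z t : cmeasurable_fun setT (full_height z t).
Proof.
apply: cmeasurableD; first by apply: cmeasurableM => //; exact: cmeasurable_cst.
apply: (@cmeasurable_cumulative (fun p => csum (fun n => z ^+ n * cflux n p))).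
apply: cmeasurable_csum => [n|p _]; last by have [] := flux_series z p.
by apply: cmeasurableM; [exact: cmeasurable_cst|exact: cmeasurable_cflux].
Qed.

Lemma cmeasurable_slice (f : R * R -> R[i]) s : cmeasurable_fun setT f ->
  cmeasurable_fun setT (fun x => f (s, x)).
Proof. by move=> [m1 m2]; split; [exact: (measurable_section1 s m1)|exact: (measurable_section1 s m2)]. Qed.

Lemma majorant_slice (w : nat -> R * R -> R[i]) r : majorized w -> 0 < r ->
  {ae mu, forall s, exists2 G : R -> R, locally_integrable setT G &
    forall z, cab z <= r -> forall x, dominated (fun n => w n (s, x)) r (G x) /\
      wsum w z (s, x) = csum (fun n => z ^+ n * w n (s, x))}.
Proof.
move=> [_ mj] r0; have [g sg gw] := mj r r0.
apply: ae_mono (sqint_slices sg) _ => s /L2_loc lg.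
by exists (fun x => g (s, x)) => // z zr x; split => //; exact: gw.
Qed.

Lemma slice_wsum (w v : nat -> R * R -> R[i]) z : majorized w -> majorized v ->
  {ae mu, forall s, (forall n, weak_derivative (fun x => w n (s, x)) (fun x => v n (s, x))) ->
    weak_derivative (fun x => wsum w z (s, x)) (fun x => wsum v z (s, x))}.
Proof.
move=> Mw Mv; have r0 := cab_lt_radius z; have zr : cab z <= cab z + 1 by rewrite lerDl.
apply: ae_mono2 (majorant_slice Mw r0) (majorant_slice Mv r0) _ => s [G lG hG] [G' lG' hG'] wd.
apply: (weak_derivative_csum _ _ _ _ r0 zr lG lG' _ _ wd).
- by move=> n; exact/cmeasurable_slice/Mw.1.
- by move=> n; exact/cmeasurable_slice/Mv.1.
- exact/cmeasurable_slice/cmeasurable_wsum.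
- exact/cmeasurable_slice/cmeasurable_wsum.
- by apply: aeW => x; exact: hG.
- by apply: aeW => x; exact: hG'.
Qed.

Lemma slice_height z : {ae mu, forall s, 0 < s < T ->
  (forall n, weak_derivative (cheight n s) (fun x => w0 n (s, x))) ->
  weak_derivative (full_height z s) (fun x => wsum w0 z (s, x))}.
Proof.
have r0 := cab_lt_radius z; have zr : cab z <= cab z + 1 by rewrite lerDl.
have [H [lH _ aeH]] := height_series r0 zr.
apply: ae_mono (majorant_slice M0 r0) _ => s [G lG hG] sT wd.
apply: (weak_derivative_csum _ _ _ _ r0 zr lH lG _ _ wd).
- by move=> n; exact: cmeasurable_cheight.
- by move=> n; exact/cmeasurable_slice/M0.1.
- exact: cmeasurable_full_height.
- exact/cmeasurable_slice/cmeasurable_wsum.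
- by apply: ae_mono aeH _ => x hx; have [] := hx s sT.
- by apply: aeW => x; exact: hG.
Qed.

Lemma slices_csum z : {ae mu, forall s, 0 < s < T ->
  [/\ weak_derivative (fun x => wsum w0 z (s, x)) (fun x => wsum w1 z (s, x)),
      weak_derivative (fun x => wsum w1 z (s, x)) (fun x => wsum w2 z (s, x)) &
      weak_derivative (full_height z s) (fun x => wsum w0 z (s, x))]}.
Proof.
have h := ae_and (ae_and (slice_wsum z M0 M1) (slice_wsum z M1 M2)) (slice_height z).
apply: ae_mono (ae_and h (ae_and slices slicesG)) _ => s [[[h1 h2] h3] [sl slG]] sT.
split; last exact: (h3 sT (slG sT)).
  by apply: h1 => n; have [] := sl sT n.
by apply: h2 => n; have [] := sl sT n.
Qed.

(** Both sides of the tested relation are power series in z with the coefficients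
    tested separately; they agree at a sequence of nonzero points tending to 0. *)
Lemma heights_from_sums (z : nat -> R) :
  (forall k, z k != 0) -> (forall k, `|z k| <= 1) -> z @ \oo --> (0 : R) ->
  {ae mu, forall t, 0 < t < T ->
    (forall k, weak_derivative (full_height (z k)%:C t) (fun x => wsum w0 (z k)%:C (t, x))) ->
    forall n, weak_derivative (cheight n t) (fun x => w0 n (t, x))}.
Proof.
move=> z0 z1 zc; have cz k : cab (z k)%:C <= 1 by rewrite cab_real.
apply: ae_mono (majorant_slice M0 ltr01) _ => t [G lG hG] tT wd n psi tpsi.
pose A n := cintegral mu setT (fun x => cheight n t x * (derive1 psi x)%:C).
pose B n := cintegral mu setT (fun x => w0 n (t, x) * (psi x)%:C).
have hA k : exists2 C : R, dominated A 1 C &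
    cintegral mu setT (fun x => full_height (z k)%:C t x * (derive1 psi x)%:C) =
    csum (fun n => (z k)%:C ^+ n * A n).
  have [H [lH _ aeH]] := height_series ltr01 (cz k).
  have ae : {ae mu, forall x, dominated (fun n => cheight n t x) 1 (H x) /\
      full_height (z k)%:C t x = csum (fun n => (z k)%:C ^+ n * cheight n t x)}.
    by apply: ae_mono aeH _ => x hx; have [] := hx t tT.
  have [d e] := cintegral_test_csum (fun n => cmeasurable_cheight n t)
    (cmeasurable_full_height (z k)%:C t) ltr01 (cz k) lH ae (test_derive1 tpsi).
  by eexists; [exact: d|exact: e].
have hB k : exists2 C : R, dominated B 1 C &
    cintegral mu setT (fun x => wsum w0 (z k)%:C (t, x) * (psi x)%:C) =
    csum (fun n => (z k)%:C ^+ n * B n).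
  have ae : {ae mu, forall x, dominated (fun n => w0 n (t, x)) 1 (G x) /\
      wsum w0 (z k)%:C (t, x) = csum (fun n => (z k)%:C ^+ n * w0 n (t, x))}.
    by apply: aeW => x; exact: hG.
  have [d e] := cintegral_test_csum (fun n => cmeasurable_slice t (M0.1 n))
    (cmeasurable_slice t (cmeasurable_wsum (z k)%:C M0)) ltr01 (cz k) lG ae tpsi.
  by eexists; [exact: d|exact: e].
have [CA dA _] := hA 0; have [CB dB _] := hB 0.
have dAB := dominatedD ler01 dA dB.
have AB0 k : csum (fun n => (z k)%:C ^+ n * (A n + B n)) = 0.
  under eq_fun do rewrite mulrDr; rewrite csumD; last 2 first.
  - exact: dominated_csummable (cz k) dA.
  - exact: dominated_csummable (cz k) dB.
  have [_ _ <-] := hA k; have [_ _ <-] := hB k.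
  by rewrite (wd k psi tpsi) addNr.
have key (u : R[i] -> R) : (forall c, `|u c| <= cab c) ->
    (forall c (a : R) m, u (a%:C ^+ m * c) = a ^+ m * u c) ->
    (forall k, series (fun n => u ((z k)%:C ^+ n * (A n + B n))) @ \oo --> (0 : R)) ->
    u (A n + B n) = 0.
  move=> uc uX uz.
  apply: (@power_series_zeros _ (fun n => u (A n + B n)) 1 z ltr01 _ z0 z1 zc).
    apply: (@nondecreasing_is_cvgn R).
      by apply: nondecreasing_series => i _ _; rewrite expr1n mul1r.
    exists (CA + CB) => _ [N _ <-]; apply: le_trans (dAB N).
    by apply: ler_sum => i _; rewrite expr1n !mul1r.
  move=> k; have := uz k; rewrite (_ : (fun n => u _) = fun n => z k ^+ n * u (A n + B n))//.
  by apply/funext => m; rewrite uX.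
have csAB k : csummable (fun n => (z k)%:C ^+ n * (A n + B n)).
  exact: dominated_csummable (cz k) dAB.
suff /eqP : A n + B n = 0 by rewrite addr_eq0 => /eqP.
apply: complex_eq.
  apply: (key (fun c => Re c)); first exact: Re_le_cab.
    by move=> c a m; rewrite -rmorphXn ReM/= mul0r subr0.
  by move=> k; rewrite -[X in _ --> X](congr1 (fun c : R[i] => Re c) (AB0 k)); exact: csum_cvgRe.
apply: (key (fun c => Im c)); first exact: Im_le_cab.
  by move=> c a m; rewrite -rmorphXn ImM/= mul0r addr0.
by move=> k; rewrite -[X in _ --> X](congr1 (fun c : R[i] => Im c) (AB0 k)); exact: csum_cvgIm.
Qed.

Definition moment t (w : R -> R) n : R[i] := cintegral mu setT (fun x => cheight n t x * (w x)%:C).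

(** The energy estimate for the real and imaginary parts of W at the parameter z. The
    initial profile enters through sup |z Phi|, which is the only place where z
    matters, and it is linear. *)
Lemma moment_bound t C w : 0 < t < T -> weight C w ->
  (forall x, w x <= 2 * cauchy_weight x) -> forall z,
  [/\ forall n, cintegrable mu setT (fun x => cheight n t x * (w x)%:C),
   csummable (fun n => z ^+ n * moment t w n) &
   - Re (csum (fun n => z ^+ n * moment t w n)) <=
     K * (\int[mu]_x w x) * cab z + expR (rate C * T) * \int[mu]_x w x].
Proof.
move=> tT ww wc z; have r0 := cab_lt_radius z; have zr : cab z <= cab z + 1 by rewrite lerDl.
have [H [lH iH aeH]] := height_series r0 zr.
have [[wpos dw _ _ _] _] := ww.
have mw : measurable_fun setT w by apply: measurable_continuous; exact: derivable_continuous.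
have iHw : mu.-integrable setT (EFin \o (fun x => H x * w x)).
  have iH2 := integrable_EFinZ 2 measurableT (integrable_norm iH).
  apply: (le_integrableR _ _ _ iH2) => //; first by apply: measurable_funM => //; case: lH.
  move=> x _ /=; rewrite !normrM mulrCA ler_wpM2l// (ger0_norm (ltW (wpos x))).
  by rewrite (ger0_norm (ltW (cauchy_weight_gt0 x))).
have [||||||i1 i2 dd eq] := @cintegral_csum_ae _ _ _ mu setT measurableT
  (fun n x => cheight n t x * (w x)%:C) (cab z + 1) (fun x => H x * w x)
  (fun x => full_height z t x * (w x)%:C) z.
- by move=> n; apply: (cmeasurableM (cmeasurable_cheight n t)); exact: (cmeasurable_real mw).
- by apply: (cmeasurableM (cmeasurable_full_height z t)); exact: (cmeasurable_real mw).
- exact: r0.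
- exact: zr.
- exact: iHw.
- apply: ae_mono aeH _ => x hx _; have [dx fx] := hx t tT; split.
    have := dominatedMr (w x)%:C (ltW r0) dx.
    by rewrite cab_real (ger0_norm (ltW (wpos x))).
  rewrite /full_height fx mulrC -csumZ; last exact: dominated_csummable dx.
  by congr csum; apply/funext => n; rewrite mulrCA [_%:C * _]mulrC.
have cs : csummable (fun n => z ^+ n * moment t w n) by exact: dominated_csummable dd.
split => //; rewrite -eq.
have -> : Re (cintegral mu setT (fun x => full_height z t x * (w x)%:C)) =
  \int[mu]_x (height (fun x => Re (z * Phi x)) (fun p => Re (wsum w0 z p)) (fun p => Re (wsum w1 z p))
    (fun p => Im (wsum w0 z p)) t x * w x).
  by apply: Rintegral_congr => x _; rewrite ReM -full_height_Re/= mulr0 subr0.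
rewrite [K * _ * _]mulrAC -mulrDl.
refine (proj2 (@exp_energy R T C (K * cab z) w (fun x => Re (z * Phi x))
  (fun p => Re (wsum w0 z p)) (fun p => Re (wsum w1 z p)) (fun p => Re (wsum w2 z p))
  (fun p => Im (wsum w0 z p)) (fun p => Im (wsum w1 z p)) bump ww _ _ _ _ _ _ _ _ _ t tT)).
- exact: (cmeasurableM (cmeasurable_cst setT z) mPhi).1.
- move=> x; apply: le_trans (Re_le_cab _) _; apply: le_trans (cabM _ _) _.
  by rewrite mulrC ler_wpM2r ?cab_ge0.
- exact: (sqint_wsum z M0).1.
- exact: (sqint_wsum z M1).1.
- exact: (sqint_wsum z M2).1.
- exact: (sqint_wsum z M0).2.
- exact: (sqint_wsum z M1).2.
- apply: ae_mono (slices_csum z) _ => s hs sT.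
  by have [/weak_derivativeP[? ?] /weak_derivativeP[? ?] _] := hs sT.
- apply: ae_mono (slices_csum z) _ => s hs sT.
  have [_ _ /weak_derivativeP[h _]] := hs sT.
  by move: h; rewrite (_ : (fun x => Re (full_height z s x)) = height (fun x => Re (z * Phi x)) (fun p => Re (wsum w0 z p)) (fun p => Re (wsum w1 z p)) (fun p => Im (wsum w0 z p)) s)//; apply/funext => x; exact: full_height_Re.
Qed.

Lemma second_moment t C w : 0 < t < T -> weight C w ->
  (forall x, w x <= 2 * cauchy_weight x) -> moment t w 2 = 0.
Proof.
move=> tT ww wc; have [[wpos _ _ _ iw] _] := ww.
have I0 : 0 <= \int[mu]_x w x by apply: Rintegral_ge0 => x _; exact: ltW.
apply: (@second_coefficient _ _ (K * \int[mu]_x w x) (expR (rate C * T) * \int[mu]_x w x)).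
- by move=> z; have [] := moment_bound tT ww wc z.
- by rewrite mulr_ge0// K_ge0.
- by move=> z; have [] := moment_bound tT ww wc z.
Qed.

(** The weight plus a small multiple of a test function is again an admissible
    weight, and the difference of the two moments is the integral against the
    test function. *)
Lemma second_height_test t psi : 0 < t < T -> smooth_compact_support psi ->
  cintegral mu setT (fun x => cheight 2 t x * (psi x)%:C) = 0.
Proof.
move=> tT tpsi; have [e e0 he] := weight_perturbation tpsi.
have [w1' b1] := he e (introT andP (conj (ltW e0) (lexx e))).
have [w0' b0] := he 0 (introT andP (conj (lexx 0) (ltW e0))).
have [/(_ 2) i1 _ _] := moment_bound tT w1' b1 0.
have [/(_ 2) i0 _ _] := moment_bound tT w0' b0 0.
have m1 := second_moment tT w1' b1; have m0 := second_moment tT w0' b0.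
have -> : (fun x => cheight 2 t x * (psi x)%:C) = fun x => (e^-1)%:C *
    (cheight 2 t x * (cauchy_weight x + e * psi x)%:C +
      (- 1) * (cheight 2 t x * (cauchy_weight x + 0 * psi x)%:C)).
  apply/funext => x; case: (cheight 2 t x) => a b.
  by apply: complex_eq; rewrite !(ReM, ImM, ReD, ImD) /=; field; rewrite gt_eqF.
rewrite cintegralZ; last by apply: cintegrableD => //; exact: cintegrableZ.
rewrite cintegralD//; last exact: cintegrableZ.
by rewrite cintegralZ// -/(moment t _ 2) m1 -/(moment t _ 2) m0 mulr0 addr0 mulr0.
exact: measurableT.
Qed.

Lemma loc_integrable_ae_le (f g : R -> R) : measurable_fun setT f ->
  {ae mu, forall x, `|f x| <= g x} -> locally_integrable setT g -> locally_integrable setT f.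
Proof.
move=> mf fg lg; apply: loc_integrableP => // a b.
apply: (ae_le_integrableR _ _ _ (loc_integrable_itv a b lg)); first exact: measurable_itv.
  exact: measurable_funS mf.
by apply: ae_mono fg _ => x h _.
Qed.

Definition cloc (f : R -> R[i]) := locally_integrable setT (fun x => Re (f x)) /\
  locally_integrable setT (fun x => Im (f x)).

Lemma cloc_ae_le (f : R -> R[i]) (g : R -> R) : cmeasurable_fun setT f ->
  {ae mu, forall x, cab (f x) <= g x} -> locally_integrable setT g -> cloc f.
Proof.
move=> [m1 m2] fg lg; split; apply: loc_integrable_ae_le lg => //;
  apply: ae_mono fg _ => x; apply: le_trans; [exact: Re_le_cab|exact: Im_le_cab].
Qed.

Lemma Re_cintegral_real (h : R -> R[i]) (psi : R -> R) :
  Re (cintegral mu setT (fun x => h x * (psi x)%:C)) = \int[mu]_x (Re (h x) * psi x).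
Proof. by apply: Rintegral_congr => x _; rewrite ReM/= mulr0 subr0. Qed.

Lemma Im_cintegral_real (h : R -> R[i]) (psi : R -> R) :
  Im (cintegral mu setT (fun x => h x * (psi x)%:C)) = \int[mu]_x (Im (h x) * psi x).
Proof. by apply: Rintegral_congr => x _; rewrite ImM/= mulr0 add0r. Qed.

Lemma ctest_orthogonal_ae (g : R -> R[i]) : cloc g ->
  (forall psi, smooth_compact_support psi -> cintegral mu setT (fun x => g x * (psi x)%:C) = 0) ->
  {ae mu, forall x, g x = 0}.
Proof.
move=> [l1 l2] h.
have h1 := test_orthogonal_ae bump l1 (fun psi tpsi => etrans (esym (Re_cintegral_real g psi)) (congr1 (fun c : R[i] => Re c) (h psi tpsi))).
have h2 := test_orthogonal_ae bump l2 (fun psi tpsi => etrans (esym (Im_cintegral_real g psi)) (congr1 (fun c : R[i] => Im c) (h psi tpsi))).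
by apply: ae_mono2 h1 h2 _ => x a b; apply: complex_eq.
Qed.

Lemma cintegral_ae0 (D : set R) (f : R -> R[i]) : measurable D -> cmeasurable_fun D f ->
  {ae mu, forall x, D x -> f x = 0} -> cintegral mu D f = 0.
Proof.
move=> mD [m1 m2] f0; apply: complex_eq => /=.
  rewrite (@ae_eq_Rintegral _ _ _ mu D _ (fun=> 0))// ?Rintegral_eq0//.
  by apply: ae_mono f0 _ => x h Dx; rewrite h.
rewrite (@ae_eq_Rintegral _ _ _ mu D _ (fun=> 0))// ?Rintegral_eq0//.
by apply: ae_mono f0 _ => x h Dx; rewrite h.
Qed.

Lemma weak_zero (f g : R -> R[i]) : cmeasurable_fun setT f -> cloc g ->
  weak_derivative f g -> {ae mu, forall x, f x = 0} -> {ae mu, forall x, g x = 0}.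
Proof.
move=> mf lg fg f0; apply: ctest_orthogonal_ae => // psi tpsi.
apply/eqP; rewrite -oppr_eq0 -fg//; apply/eqP; apply: cintegral_ae0 => //.
  apply: (cmeasurableM mf); apply: cmeasurable_real; apply: measurable_continuous.
  exact: (test_continuous (test_derive1 tpsi)).
by apply: ae_mono f0 _ => x -> _; rewrite mul0r.
Qed.

Lemma majorized_cloc (w : nat -> R * R -> R[i]) : majorized w ->
  {ae mu, forall s, forall n, cloc (fun x => w n (s, x))}.
Proof.
move=> [mw mj]; have [g sg gw] := mj 1 ltr01.
apply: ae_mono (sqint_slices sg) _ => s /L2_loc lg n; apply: cloc_ae_le lg.
  by have [m1 m2] := mw n; split; [exact: (measurable_section1 s m1)|exact: (measurable_section1 s m2)].
apply: aeW => x; have := dominated_term n ler01 (gw (s, x)).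
by rewrite expr1n mul1r.
Qed.

Lemma second_height_ae t : 0 < t < T -> {ae mu, forall x, cheight 2 t x = 0}.
Proof.
move=> tT; have [|H [lH _ aeH]] := @height_series 1 0 ltr01; first by rewrite cab0 ler01.
apply: ctest_orthogonal_ae; last by move=> psi; exact: second_height_test.
apply: cloc_ae_le lH; first exact: cmeasurable_cheight.
apply: ae_mono aeH _ => x hx; have [dx _] := hx t tT.
by have := dominated_term 2 ler01 dx; rewrite expr1n mul1r.
Qed.

Definition time_cut (u : R * R -> R) p := if in_time T p.1 then u p else 0.

Lemma measurable_time_cut u : measurable_fun setT u -> measurable_fun setT (time_cut u).
Proof.
move=> mu'; apply: measurable_fun_ifT => //.
exact: (measurableT_comp (measurable_in_time T) measurable_fst).
Qed.

Lemma time_cut_eq u v (s x : R) : (0 < s < T -> u (s, x) = v (s, x)) -> time_cut u (s, x) = time_cut v (s, x).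
Proof. by rewrite /time_cut /in_time /=; case: ifP => // sT; apply. Qed.

Lemma time_cut_inj u v (s x : R) : time_cut u (s, x) = time_cut v (s, x) -> 0 < s < T -> u (s, x) = v (s, x).
Proof. by rewrite /time_cut /in_time /= => + sT; rewrite sT. Qed.

Lemma time_swap (f g : R * R -> R[i]) : cmeasurable_fun setT f -> cmeasurable_fun setT g ->
  {ae mu, forall s, 0 < s < T -> {ae mu, forall x, f (s, x) = g (s, x)}} ->
  {ae mu, forall x, {ae mu, forall s, 0 < s < T -> f (s, x) = g (s, x)}}.
Proof.
move=> [f1 f2] [g1 g2] fg.
have split_fg (u : R[i] -> R) : {ae mu, forall s, {ae mu, forall x,
    time_cut (fun p => u (f p)) (s, x) = time_cut (fun p => u (g p)) (s, x)}}.
  apply: ae_mono fg _ => s hs.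
  have [sT|sT] := boolP (0 < s < T).
    by apply: ae_mono (hs sT) _ => x e; apply: time_cut_eq => _; rewrite e.
  by apply: aeW => x; apply: time_cut_eq => sT'; rewrite sT' in sT.
have hR := ae_swap (measurable_time_cut f1) (measurable_time_cut g1) (split_fg _).
have hI := ae_swap (measurable_time_cut f2) (measurable_time_cut g2) (split_fg _).
apply: ae_mono2 hR hI _ => x xR xI; apply: ae_mono2 xR xI _ => s sR sI sT.
apply: complex_eq; first exact: (time_cut_inj sR sT).
exact: (time_cut_inj sI sT).
Qed.

Lemma time_swap_inv (f g : R * R -> R[i]) : cmeasurable_fun setT f -> cmeasurable_fun setT g ->
  {ae mu, forall x, {ae mu, forall s, 0 < s < T -> f (s, x) = g (s, x)}} ->
  {ae mu, forall s, 0 < s < T -> {ae mu, forall x, f (s, x) = g (s, x)}}.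
Proof.
move=> [f1 f2] [g1 g2] fg.
have split_fg (u : R[i] -> R) : {ae mu, forall x, {ae mu, forall s,
    time_cut (fun p => u (f p)) (s, x) = time_cut (fun p => u (g p)) (s, x)}}.
  apply: ae_mono fg _ => x hx; apply: ae_mono hx _ => s hs.
  by apply: time_cut_eq => /hs ->.
have hR := ae_swap_inv (measurable_time_cut f1) (measurable_time_cut g1) (split_fg _).
have hI := ae_swap_inv (measurable_time_cut f2) (measurable_time_cut g2) (split_fg _).
apply: ae_mono2 hR hI _ => s sR sI sT; apply: ae_mono2 sR sI _ => x xR xI.
apply: complex_eq; first exact: (time_cut_inj xR sT).
exact: (time_cut_inj xI sT).
Qed.

(** A continuous primitive that vanishes at almost every time vanishes throughout ]0, T[, and f
    is its derivative almost everywhere. *)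
Lemma zero_cumulative (f : R -> R) : locally_integrable setT f ->
  {ae mu, forall t, 0 < t < T -> \int[mu]_(s in `[0, t]) f s = 0} ->
  {ae mu, forall s, 0 < s < T -> f s = 0}.
Proof.
move=> lf f0; have [h h0 hE] := primitive_exists lf.
have ch : continuous h := increment_continuous lf hE.
pose u (y : R) := y * (T - y).
have cu : continuous u.
  by move=> y; apply: cvgM; [exact: cvg_id|apply: cvgB; [exact: cvg_cst|exact: cvg_id]].
have ck : continuous (fun y => h y * (u y + `|u y|)).
  move=> y; apply: cvgM; first exact: ch.
  by apply: cvgD; [exact: cu|apply: cvg_norm; exact: cu].
have k0 : (fun y => h y * (u y + `|u y|)) = (fun=> 0).
  apply: continuous_ae_eq ck _ _; first by move=> y; exact: cvg_cst.
  apply: ae_mono f0 _ => y hy.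
  have [yT|yT] := boolP (0 < y < T).
    have y0 : 0 <= y by case/andP: yT => /ltW.
    by have := hE 0 y y0; rewrite h0 subr0 hy// => ->; rewrite mul0r.
  suff uy : u y <= 0 by rewrite ler0_norm// subrr mulr0.
  rewrite /u; move: yT; rewrite negb_and -!leNgt => /orP[y0|Ty].
    by rewrite mulr_le0_ge0// subr_ge0 (le_trans y0)// ltW.
  by rewrite mulr_ge0_le0 ?subr_le0// (le_trans (ltW T0)).
have hz y : 0 < y < T -> \int[mu]_(s in `[0, y]) f s = 0.
  move=> /andP[y0 yT]; rewrite -hE ?ltW// h0 subr0.
  have uy : 0 < u y by rewrite mulr_gt0// subr_gt0.
  have := congr1 (@^~ y) k0; rewrite /= gtr0_norm// => /eqP; rewrite mulf_eq0 => /orP[/eqP//|].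
  by rewrite gt_eqF// addr_gt0.
have FTC := @FTC1 R f (BLeft 0) (fun y => loc_integrable_itv 0 y lf) lf.
apply: ae_mono FTC _ => s hs /andP[s0 sT].
have [|_ <-] := hs; first by rewrite /= lte_fin.
rewrite derive1E (@near_eq_derive _ _ _ _ (cst 0)) ?derive_cst//.
near=> y; apply: hz; apply/andP; split; near: y; [exact: lt_nbhsr|exact: lt_nbhsl].
Unshelve. all: by end_near. Qed.

Lemma second_order_zero : {ae mu, forall s, 0 < s < T ->
  {ae mu, forall x, w0 2 (s, x) = 0} /\ {ae mu, forall x, w1 2 (s, x) = 0}}.
Proof.
have ms (w : nat -> R * R -> R[i]) n s : majorized w -> cmeasurable_fun setT (fun x => w n (s, x)).
  by move=> mw; have [m1 m2] := mw.1 n; split; [exact: (measurable_section1 s m1)|exact: (measurable_section1 s m2)].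
apply: ae_mono (ae_and (ae_and slices slicesG) (ae_and (majorized_cloc M0) (majorized_cloc M1))) _.
move=> s [[sl slG] [l0 l1]] sT.
have z0 : {ae mu, forall x, w0 2 (s, x) = 0}.
  apply: weak_zero (slG sT 2) (second_height_ae sT); last exact: l0.
  exact: cmeasurable_cheight.
split => //; apply: weak_zero (sl sT 2).1 z0; last exact: l1.
exact: ms.
Qed.

Lemma cflux_two p : w0 2 p = 0 -> w1 2 p = 0 ->
  cflux 2 p = (- 2^-1)%:C * (w0 1 p * w0 1 p).
Proof.
move=> e0 e1; rewrite /cflux e1 add0r /conv !big_ord_recl big_ord0 /=.
by rewrite /bump/= e0 mulr0 mul0r add0r !addr0.
Qed.

Definition half_square p : R[i] := (- 2^-1)%:C * (w0 1 p * w0 1 p).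

Lemma cmeasurable_half_square : cmeasurable_fun setT half_square.
Proof.
apply: cmeasurableM; first exact: cmeasurable_cst.
by apply: cmeasurableM; exact: M0.1.
Qed.

Lemma cintegral_time_congr (f g : R * R -> R[i]) x t : cmeasurable_fun setT f -> cmeasurable_fun setT g ->
  {ae mu, forall s, 0 < s < T -> f (s, x) = g (s, x)} -> 0 < t < T ->
  cintegral mu `[0, t] (fun s => f (s, x)) = cintegral mu `[0, t] (fun s => g (s, x)).
Proof.
move=> [f1 f2] [g1 g2] fg /andP[t0 tT].
have e : {ae mu, forall s, `[0, t]%classic s -> f (s, x) = g (s, x)}.
  apply: ae_mono2 fg (ae_neq 0) _ => s h s0; rewrite /= in_itv/= => /andP[s1 s2].
  by apply: h; rewrite lt_neqAle eq_sym s0 s1 (le_lt_trans s2 tT).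
have ms (u : R * R -> R) : measurable_fun setT u -> measurable_fun `[0, t] (fun s => u (s, x)).
  by move=> mu'; exact: measurable_funS (measurable_section2 x mu').
apply: complex_eq => /=; apply: ae_eq_Rintegral; first exact: measurable_itv.
- exact: ms f1.
- exact: ms g1.
- by apply: ae_mono e _ => s h /h ->.
- exact: measurable_itv.
- exact: ms f2.
- exact: ms g2.
- by apply: ae_mono e _ => s h /h ->.
Qed.

Lemma half_square_cumulative : {ae mu, forall x, {ae mu, forall t, 0 < t < T ->
  cintegral mu `[0, t] (fun s => half_square (s, x)) = 0}}.
Proof.
have mh := cmeasurable_half_square.
have swp : {ae mu, forall x, {ae mu, forall s, 0 < s < T -> cflux 2 (s, x) = half_square (s, x)}}.
  apply: time_swap (cmeasurable_cflux 2) mh _.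
  apply: ae_mono second_order_zero _ => s hs sT; have [z0 z1] := hs sT.
  by apply: ae_mono2 z0 z1 _ => x e0 e1; exact: cflux_two.
have mQ : cmeasurable_fun setT (fun p : R * R => cintegral mu `[0, p.1] (fun s => half_square (s, p.2))).
  by have [m1 m2] := mh; split; [exact: (measurable_cumulative m1)|exact: (measurable_cumulative m2)].
have := @time_swap (fun p => cintegral mu `[0, p.1] (fun s => half_square (s, p.2))) (fun=> 0) mQ (cmeasurable_cst _ 0).
apply; apply: aeW => t tT /=.
apply: ae_mono2 swp (second_height_ae tT) _ => x hx <-.
rewrite /cheight mul0r add0r.
by apply: (@cintegral_time_congr half_square (cflux 2)) => //; [exact: cmeasurable_cflux|apply: ae_mono hx _ => s h /h ->].
Qed.

(** The second height vanishes and so do w0 2 and w1 2; what is left of its time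
    derivative is - w_1^2 / 2, a complex square that can vanish only if w_1 does. *)
Lemma first_order_zero : {ae mu, forall s, 0 < s < T ->
  {ae mu, forall x, w0 1 (s, x) = 0} /\ {ae mu, forall x, w1 1 (s, x) = 0}}.
Proof.
have mh := cmeasurable_half_square.
have [g [mg ig] gw] := M0.2 1 ltr01.
have z0 : {ae mu, forall s, 0 < s < T -> {ae mu, forall x, w0 1 (s, x) = 0}}.
  apply: (@time_swap_inv (w0 1) (fun=> 0) (M0.1 1) (cmeasurable_cst _ 0)).
  apply: ae_mono2 (ae_integrable2 ig) half_square_cumulative _ => x ix hx.
  have lg : locally_integrable setT (fun s => g (s, x) ^+ 2).
    by apply: open_integrable_locally => //; exact: openT.
  have [l1 l2] : cloc (fun s => half_square (s, x)).
    apply: cloc_ae_le lg.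
      by have [m1 m2] := mh; split; [exact: (measurable_section2 x m1)|exact: (measurable_section2 x m2)].
    apply: aeW => s; apply: le_trans (cabM _ _) _; rewrite cab_real normrN gtr0_norm ?invr_gt0//.
    have w1g : cab (w0 1 (s, x)) <= g (s, x).
      by have := dominated_term 1 ler01 (gw (s, x)); rewrite expr1n mul1r.
    apply: (@le_trans _ _ (1 * (cab (w0 1 (s, x)) * cab (w0 1 (s, x))))).
      apply: ler_pM; rewrite ?invr_ge0 ?cab_ge0 ?ler0n// ?cabM//.
      by rewrite invf_le1// ler1n.
    by rewrite mul1r expr2 ler_pM ?cab_ge0.
  have z1 := zero_cumulative l1 (ae_mono hx (fun t h tT => congr1 (fun c : R[i] => Re c) (h tT))).
  have z2 := zero_cumulative l2 (ae_mono hx (fun t h tT => congr1 (fun c : R[i] => Im c) (h tT))).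
  apply: ae_mono2 z1 z2 _ => s e1 e2 sT; apply/eqP.
  have : half_square (s, x) = 0 by apply: complex_eq; [exact: e1|exact: e2].
  move/eqP; rewrite /half_square !mulf_eq0 orbb => /orP[|//].
  by rewrite (_ : 0 = 0%:C)// (inj_eq (@complexI _)) oppr_eq0 invr_eq0 pnatr_eq0.
apply: ae_mono (ae_and (ae_and slices z0) (majorized_cloc M1)) _ => s [[sl h0] l1] sT.
split; first exact: h0.
apply: weak_zero (sl sT 1).1 (h0 sT); last exact: l1.
by have [m1 m2] := M0.1 1; split; [exact: (measurable_section1 s m1)|exact: (measurable_section1 s m2)].
Qed.

Lemma cflux_one p : w0 1 p = 0 -> w1 1 p = 0 -> cflux 1 p = 0.
Proof.
move=> e0 e1; rewrite /cflux e1 add0r /conv !big_ord_recl big_ord0 /=.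
by rewrite /bump/= e0 !mulr0 mul0r !addr0 mulr0.
Qed.

(** At any time where the slices behave, the first height is Phi because its flux
    vanishes, and its weak derivative w0 1 is zero. *)
Lemma initial_profile_constant : weak_derivative Phi (fun=> 0).
Proof.
have swp : {ae mu, forall x, {ae mu, forall s, 0 < s < T -> cflux 1 (s, x) = 0}}.
  apply: (@time_swap (cflux 1) (fun=> 0) (cmeasurable_cflux 1) (cmeasurable_cst _ 0)).
  apply: ae_mono first_order_zero _ => s hs sT; have [z0 z1] := hs sT.
  by apply: ae_mono2 z0 z1 _ => x e0 e1; exact: cflux_one.
have [t [tT wd w0t]] : exists t, [/\ 0 < t < T, weak_derivative (cheight 1 t) (fun x => w0 1 (t, x)) &
    {ae mu, forall x, w0 1 (t, x) = 0}].
  apply: contrapT => no.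
  have [A [mA A0 sub]] := ae_and slicesG first_order_zero.
  have TA : `]0, T[%classic `<=` A.
    move=> t /=; rewrite in_itv/= => tT; apply: sub => /= -[h1 h2]; apply: no.
    by exists t; split => //; [exact: h1|have [] := h2 tT].
  have : (mu `]0%R, T[%classic <= mu A)%E by apply: le_measure; rewrite ?inE//; exact: measurable_itv.
  rewrite A0 lebesgue_measure_itv/= lte_fin T0 -EFinB lee_fin subr0.
  by rewrite leNgt T0.
have hP : {ae mu, forall x, cheight 1 t x = Phi x}.
  apply: ae_mono swp _ => x hx; rewrite /cheight eqxx mul1r.
  rewrite (@cintegral_time_congr (cflux 1) (fun=> 0) x t)//.
  - have -> : cintegral mu `[0, t] (fun=> 0 : R[i]) = 0.
      by apply: complex_eq; apply: Rintegral_eq0.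
    by rewrite addr0.
  - exact: cmeasurable_cflux.
have [mc1 mc2] := cmeasurable_cheight 1 t; have [mp1 mp2] := mPhi.
have [mw1 mw2] : cmeasurable_fun setT (fun x => w0 1 (t, x)).
  by have [m1 m2] := M0.1 1; split; [exact: (measurable_section1 t m1)|exact: (measurable_section1 t m2)].
move/weak_derivativeP: wd => [d1 d2]; apply/weak_derivativeP; split.
  apply: weak_diff_ae d1 => //; first by apply: ae_mono hP _ => x ->.
  by apply: ae_mono w0t _ => x ->.
apply: weak_diff_ae d2 => //; first by apply: ae_mono hP _ => x ->.
by apply: ae_mono w0t _ => x ->.
Qed.

End core.
End EntireSolutions.

(** * Multi-indices supported at the first position *)

Section AxisMultiIndices.
Local Open Scope fset_scope.

(** The multi-index (n, 0, 0, ...); the others are annihilated by a parameter (z, 0, 0, ...). *)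
Definition axis (n : nat) : mindex := [fsfun x in [fset 0%N] => n].

Lemma axisE n k : axis n k = ((k == 0%N) * n)%N.
Proof. by rewrite fsfunE inE; case: eqVneq => _; rewrite ?mul1n ?mul0n. Qed.

Lemma axis_inj : injective axis.
Proof. by move=> m n /(congr1 (fun a : mindex => a 0%N)); rewrite !axisE !mul1n. Qed.

Lemma axisP (a : mindex) : reflect (forall k, (0 < k)%N -> a k = 0%N) (a == axis (a 0%N)).
Proof.
apply: (iffP eqP) => [-> k k0|a0]; first by rewrite axisE eqn0Ngt k0.
apply/fsfunP => -[|k]; rewrite axisE /= ?mul1n //.
by rewrite a0.
Qed.

Lemma finsupp_axis n : finsupp (axis n) `<=` [fset 0%N].
Proof.
apply/fsubsetP => k; rewrite inE mem_finsupp axisE.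
by case: (k == _).
Qed.

Lemma mpow_axis (A : comPzRingType) (z : nat -> A) n : mpow z (axis n) = (z 0%N ^+ n)%R.
Proof.
rewrite /mpow (big_fset_incl _ (finsupp_axis n)); first by rewrite big_seq_fset1 axisE mul1n.
by move=> k _; rewrite memNfinsupp => /eqP ->; rewrite expr0.
Qed.

Lemma mfact_axis n : mfact (axis n) = n`!.
Proof.
rewrite /mfact (big_fset_incl _ (finsupp_axis n)); first by rewrite big_seq_fset1 axisE mul1n.
by move=> k _; rewrite memNfinsupp => /eqP ->.
Qed.

Lemma mpow_off_axis (A : comPzRingType) (z : nat -> A) (a : mindex) :
  (forall k, (0 < k)%N -> z k = 0%R) -> a != axis (a 0%N) -> mpow z a = 0%R.
Proof.
move=> z0 /axisP/existsNP[k] /not_implyP[k0 /eqP ak].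
rewrite /mpow (big_fsetD1 k) ?mem_finsupp//= z0// expr0n (negbTE ak) mul0r //.
Qed.

End AxisMultiIndices.

Section AxisSums.
Context {R : realType}.
Local Open Scope ereal_scope.

Lemma nneseries_axis_le (f : mindex -> \bar R) : (forall a, 0 <= f a) ->
  \sum_(n <oo) f (axis n) <= \esum_(a in [set: mindex]) f a.
Proof.
move=> f0; rewrite nneseries_esumT// -(@esum_image _ _ _ setT axis f); last first.
  by move=> m n _ _; exact: axis_inj.
rewrite esum_mkcond; apply: le_esum => a _.
by case: ifP.
Qed.

Lemma esum_axis_le (f : mindex -> \bar R) : (forall a, 0 <= f a) ->
  (forall a : mindex, a != axis (a 0%N) -> f a = 0) ->
  \esum_(a in [set a : mindex | a != [fsfun]]) f a <= \sum_(n <oo) f (axis n.+1).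
Proof.
move=> f0 fz; rewrite nneseries_esumT//.
rewrite -(@esum_image _ _ _ setT (fun n => axis n.+1) f); last first.
  by move=> m n _ _ /axis_inj[].
rewrite [leLHS]esum_mkcond [leRHS]esum_mkcond; apply: le_esum => a _.
case: ifPn; last by case: ifP.
rewrite inE /= => a0; have [/eqP aE|an] := boolP (a == axis (a 0%N)); last by rewrite fz//; case: ifP.
case: ifPn => // /negP; rewrite inE /=; case; exists (a 0%N).-1 => //=.
rewrite prednK ?lt0n// ; apply: contra_neq a0 => a00.
rewrite aE a00; apply/fsfunP => k; rewrite axisE muln0 fsfun0E//.
Qed.

End AxisSums.

(** * Admissible small parameters *)

Section SmallParameters.
Context {R : realType}.
Local Open Scope complex_scope.
Notation Re := complex.Re.
Notation Im := complex.Im.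

Definition on_axis (z : R[i]) (k : nat) : R[i] := if k is 0%N then z else 0.

Lemma normalized_on_axis (z : R[i]) n :
  normalized_mpow (on_axis z) (axis n) = z ^+ n * ((Num.sqrt (n`!)%:R)^-1)%:C.
Proof. by rewrite /normalized_mpow mpow_axis mfact_axis fmorphV. Qed.

Lemma normalized_off_axis (z : R[i]) (a : mindex) : a != axis (a 0%N) -> normalized_mpow (on_axis z) a = 0.
Proof. by move=> an; rewrite /normalized_mpow mpow_off_axis ?mul0r//; case. Qed.

Lemma sqmod0 : sqmod (0 : R[i]) = 0.
Proof. by rewrite /sqmod (_ : Re 0 = 0)// (_ : Im 0 = 0)// expr0n addr0. Qed.

Lemma powR_exp (x l : R) n : 0 <= x -> (x ^+ n) `^ l = (x `^ l) ^+ n.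
Proof. move=> x0; elim: n => [|n ih]; first by rewrite !expr0 powR1.
by rewrite !exprS powRM ?exprn_ge0// ih. Qed.

Lemma K_set_on_axis (q : nat -> R) (l r : R) (x : R) : 1 < q 0%N ->
  q 0%N `^ l * x ^+ 2 <= 2^-1 -> 2 * (q 0%N `^ l * x ^+ 2) < r ^+ 2 ->
  K_set q l r (on_axis x%:C).
Proof.
move=> q1 y1 yr; set y := _ * _ in y1 yr.
have q0 : 0 <= q 0%N by rewrite (le_trans ler01)// ltW.
have y0 : 0 <= y by rewrite mulr_ge0 ?powR_ge0 ?sqr_ge0.
rewrite /K_set /=; apply: le_lt_trans (esum_axis_le _ _) _.
- by move=> a; rewrite lee_fin mulr_ge0 ?powR_ge0 ?sqmod_ge0.
- move=> a an; have -> : mpow (on_axis x%:C) a = 0 by apply: mpow_off_axis => //; case.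
  by rewrite sqmod0 mulr0.
have termE n : ((mpow q (axis n.+1) `^ l * sqmod (mpow (on_axis x%:C) (axis n.+1)))%:E = (y ^+ n.+1)%:E)%E.
  rewrite !mpow_axis powR_exp// sqmodX /sqmod /= expr0n addr0 -exprMn //.
rewrite (eq_eseriesr (g := fun n => (y ^+ n.+1)%:E)); last by move=> n _; exact: termE.
apply: (@le_lt_trans _ _ (2 * y)%:E); last by rewrite lte_fin.
apply: lime_le; first by apply: is_cvg_nneseries => n _ _; rewrite lee_fin exprn_ge0.
apply: nearW => N; rewrite sumEFin lee_fin.
under eq_bigr do rewrite exprS.
rewrite -mulr_sumr mulrC ler_wpM2r//; apply: le_trans (geometric_half N).
by apply: ler_sum => i _; rewrite lerXn2r// nnegrE// invr_ge0.
Qed.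

(** On the axis the sum that defines K_set is a geometric series in q_1^l |z|^2, which
    is small when z is. *)
Lemma small_parameters (q : nat -> R) (l r : R) : 1 < q 0%N -> 0 < r -> 0 <= l ->
  exists z : nat -> R, [/\ forall k, z k != 0, forall k, `|z k| <= 1, z @ \oo --> (0 : R) &
    forall k, K_set q l r (on_axis (z k)%:C)].
Proof.
move=> q1 r0 l0; set Q := q 0%N `^ l.
have Q1 : 1 <= Q by rewrite -(powRr0 (q 0%N)) ler_powR// ltW.
have Q0 : 0 < Q by exact: lt_le_trans Q1.
pose m := Num.min (2^-1 : R) (r ^+ 2 / 4).
have m0 : 0 < m by rewrite lt_min invr_gt0 ltr0n/= divr_gt0// exprn_gt0.
have m2 : m <= 2^-1 by rewrite ge_min lexx.
have mr : m <= r ^+ 2 / 4 by rewrite ge_min lexx orbT.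
pose d := m / Q.
have d0 : 0 < d by rewrite divr_gt0.
have Qd : Q * d = m by rewrite /d mulrCA mulfV ?mulr1// gt_eqF.
have d1 : d <= 1 by rewrite /d ler_pdivrMr// mul1r (le_trans m2)// (le_trans _ Q1)// invf_le1// ler1n.
exists (fun k => d * k.+1%:R^-1).
have zk k : 0 < d * k.+1%:R^-1 <= d.
  by rewrite mulr_gt0 ?invr_gt0//= ler_piMr ?(ltW d0)// invf_le1// ler1n.
have z2 k : Q * (d * k.+1%:R^-1) ^+ 2 <= m.
  have /andP[z0 zd] := zk k.
  rewrite -Qd ler_wpM2l ?(ltW Q0)//; apply: (@le_trans _ _ (d ^+ 2)).
    by rewrite lerXn2r// ?nnegrE ltW.
  by rewrite expr2 ler_piMl// ltW.
split.
- by move=> k; have /andP[z0 _] := zk k; rewrite gt_eqF.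
- by move=> k; have /andP[z0 zd] := zk k; rewrite gtr0_norm// (le_trans zd).
- by rewrite -(mulr0 d); apply: cvgM; [exact: cvg_cst|exact: cvg_harmonic].
- move=> k; apply: K_set_on_axis => //; first exact: le_trans (z2 k) m2.
  have := z2 k; rewrite -/Q; have : 0 < r ^+ 2 by rewrite exprn_gt0.
  move=> rr yy; apply: (@le_lt_trans _ _ (2 * (r ^+ 2 / 4))).
    by rewrite ler_wpM2l// (le_trans yy).
  by move: rr; move: (r ^+ 2) => s s0; lra.
Qed.

End SmallParameters.

(** * Hermite polynomials and Gaussian moments *)

Section GaussianPolynomials.
Context {R : realType}.
Notation mu := (@lebesgue_measure R).
Implicit Types (p : {poly R}).

Definition gauss (x : R) : R := expR (- (x ^+ 2) / 2).

Lemma is_derive_gauss (x : R) : is_derive x 1 gauss (- x * gauss x).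
Proof.
have d : is_derive x 1 (fun y : R => - (y ^+ 2) / 2) (- x).
  by apply: is_derive_eq; rewrite /GRing.scale/= !mulr1; field.
rewrite (_ : - x * gauss x = expR (- (x ^+ 2) / 2) *: (- x)); last by rewrite mulrC.
exact: (@is_derive1_comp _ expR (fun y : R => - (y ^+ 2) / 2)).
Qed.

Lemma gauss_gt0 (x : R) : 0 < gauss x. Proof. exact: expR_gt0. Qed.

Lemma is_derive_poly_gauss p (x : R) :
  is_derive x 1 (fun y => p.[y] * gauss y) ((p^`() - 'X * p).[x] * gauss x).
Proof.
have dp : is_derive x 1 (horner p) (p^`()).[x].
  by apply: DeriveDef; [exact: derivable_horner|rewrite -derive1E derivE].
have dg := is_derive_gauss x.
apply: is_derive_eq (is_deriveM dp dg) _.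
transitivity (p.[x] * (- x * gauss x) + gauss x * p^`().[x]); first by [].
rewrite hornerD hornerN hornerM hornerX.
by move: p.[x] (p^`()).[x] (gauss x) => a b c; ring.
Qed.

Lemma derive1_poly_gauss p : derive1 (fun y => p.[y] * gauss y) =
  fun y => (p^`() - 'X * p).[y] * gauss y.
Proof.
by apply/funext => x; rewrite derive1E (@derive_val _ _ _ _ _ _ _ (is_derive_poly_gauss p x)).
Qed.

Lemma continuous_poly_gauss p : continuous (fun y => p.[y] * gauss y).
Proof.
by apply: derivable_continuous => x; have [] := is_derive_poly_gauss p x.
Qed.

Lemma poly_bound p (x : R) : `|p.[x]| <= (\sum_(i < size p) `|p`_i|) * (1 + x ^+ 2) ^+ size p.
Proof.
rewrite horner_coef; apply: le_trans (ler_norm_sum _ _ _) _; rewrite mulr_suml.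
apply: ler_sum => i _; rewrite normrM ler_wpM2l// normrX.
have y1 := oneDsqr_ge1' x.
apply: (@le_trans _ _ ((1 + x ^+ 2) ^+ i)).
  rewrite lerXn2r// ?nnegrE ?(le_trans ler01)//.
  by have := sqr_ge0 (`|x| - 2^-1); rewrite -(real_normK (num_real x)); nra.
by rewrite ler_weXn2l// ltnW.
Qed.

Lemma poly_gauss_le p : exists C, forall x : R, `|p.[x] * gauss x| <= C * cauchy_weight x.
Proof.
set S := \sum_(i < size p) `|p`_i|; set m := (size p).+1.
exists (S * (expR 2^-1 * (2 ^+ m * m`!%:R))) => x.
have y0 := oneDsqr_gt0' x; set y := 1 + x ^+ 2 in y0 *.
have S0 : 0 <= S by apply: sumr_ge0.
have gE : gauss x = expR 2^-1 / expR (y / 2).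
  by rewrite -expRN -expRD /gauss; congr expR; rewrite /y; lra.
have f0 : 0 < m`!%:R :> R by rewrite ltr0n fact_gt0.
have ym : y ^+ m <= 2 ^+ m * m`!%:R * expR (y / 2).
  have := @expR_ge1Dxn R (y / 2) (size p) (divr_ge0 (ltW y0) (ler0n _ 2)); rewrite -/m expr_div_n => h.
  have h' : y ^+ m / 2 ^+ m / m`!%:R <= expR (y / 2) by apply: le_trans h; rewrite lerDr.
  by move: h'; rewrite -mulrA -invfM ler_pdivrMr ?mulr_gt0 ?exprn_gt0// mulrC.
rewrite normrM (gtr0_norm (gauss_gt0 x)) /cauchy_weight -/y ler_pdivlMr//.
apply: (@le_trans _ _ (S * y ^+ size p * gauss x * y)).
  by rewrite ler_wpM2r ?(ltW y0)// ler_wpM2r ?(ltW (gauss_gt0 x))//; exact: poly_bound.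
rewrite gE -!mulrA ler_wpM2l//.
rewrite (_ : y ^+ size p * _ = expR 2^-1 * (y ^+ m / expR (y / 2))); last first.
  by rewrite /m exprS; ring.
by rewrite ler_wpM2l ?expR_ge0// ler_pdivrMr ?expR_gt0.
Qed.

Lemma integrable_poly_gauss p : mu.-integrable setT (EFin \o (fun x => p.[x] * gauss x)).
Proof.
have [C hC] := poly_gauss_le p.
apply: (@le_integrableR _ _ _ mu _ _ (fun x => C * cauchy_weight x)) => //.
- by apply: measurable_continuous; exact: continuous_poly_gauss.
- by apply: integrable_EFinZ => //; exact: integrable_cauchy_weight.
Qed.

Lemma poly_gauss_cvg0 p (u : nat -> R) : (forall n, u n ^+ 2 = n%:R ^+ 2) ->
  (fun n => p.[u n] * gauss (u n)) @ \oo --> (0 : R).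
Proof.
move=> un; have [C hC] := poly_gauss_le p.
apply/norm_cvg0P; apply: (@squeeze_cvgr _ _ _ _ (fun=> 0) (fun n => C * cauchy_weight (u n))).
- by apply: nearW => n; rewrite normr_ge0 hC.
- exact: cvg_cst.
- by rewrite -(mulr0 C); apply: cvgM; [exact: cvg_cst|exact: cauchy_weight_cvg0].
Qed.

Lemma integral_poly_gauss_derive p : \int[mu]_x ((p^`() - 'X * p).[x] * gauss x) = 0.
Proof.
have c1 := Rintegral_centered_cvg (integrable_poly_gauss (p^`() - 'X * p)).
have e n : \int[mu]_(x in `[- n%:R, n%:R]) ((p^`() - 'X * p).[x] * gauss x) =
    p.[n%:R] * gauss n%:R - p.[- n%:R] * gauss (- n%:R).
  have := @FTC_C1 R (fun y => p.[y] * gauss y) (- n%:R) n%:R; rewrite derive1_poly_gauss; apply.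
  - by have n0 := ler0n R n; lra.
  - by move=> x; have [] := is_derive_poly_gauss p x.
  - exact: continuous_poly_gauss.
have c2 : (fun n => p.[n%:R] * gauss n%:R - p.[- n%:R] * gauss (- n%:R)) @ \oo --> (0 - 0 : R).
  by apply: cvgB; apply: poly_gauss_cvg0 => n //; rewrite sqrrN.
rewrite subrr in c2; move: c1; under eq_fun do rewrite e.
by move=> c1; exact: (cvg_unique _ c1 c2).
Qed.

(** The polynomial factor of the n-th derivative of the Gaussian, that is
    (- 1)^n times the n-th Hermite polynomial. *)
Fixpoint hermite_poly n : {poly R} :=
  if n is n'.+1 then (hermite_poly n')^`() - 'X * hermite_poly n' else 1.

Lemma derive1n_gauss n : derive1n n gauss = fun x => (hermite_poly n).[x] * gauss x.
Proof.
elim: n => [|n ih]; first by apply/funext => x; rewrite /= hornerC mul1r.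
by rewrite derive1nS ih derive1_poly_gauss.
Qed.

Lemma hermiteE n (x : R) : hermite n x = (-1) ^+ n * (hermite_poly n).[x].
Proof.
rewrite /hermite -/gauss derive1n_gauss -mulrA; congr (_ * _).
rewrite mulrCA [_ * expR _]mulrC (_ : expR _ * _ = 1) ?mulr1//.
by rewrite /gauss -expRD mulNr addNr expR0.
Qed.

(** For n different from 1 the product X H_n exp(- x^2 / 2) is an exact derivative of a
    polynomial multiple of the Gaussian; this replaces the orthogonality of the
    Hermite polynomials. *)
Lemma X_hermite_primitive n : n != 1%N -> exists p, p^`() - 'X * p = 'X * hermite_poly n.
Proof.
case: n => [|[//|n]] _.
  by exists (-1); rewrite /= derivN derivC oppr0 mulrN1 opprK mulr1 add0r.
exists ('X * hermite_poly n.+1 - hermite_poly n).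
by rewrite derivB derivM derivX /=; ring.
Qed.

Lemma integral_X_hermite n : n != 1%N -> \int[mu]_x (('X * hermite_poly n).[x] * gauss x) = 0.
Proof. by move=> /X_hermite_primitive[p <-]; exact: integral_poly_gauss_derive. Qed.

Lemma integral_X_hermite1 : \int[mu]_x (('X * hermite_poly 1).[x] * gauss x) = - \int[mu]_x gauss x.
Proof.
have := integral_poly_gauss_derive 'X.
have -> : (fun x => (deriv 'X - 'X * 'X).[x] * gauss x) =
   fun x => (1 : {poly R}).[x] * gauss x + ('X * hermite_poly 1).[x] * gauss x.
  by apply/funext => x; rewrite /= derivC derivX !hornerE; ring.
rewrite RintegralD//; try exact: integrable_poly_gauss.
move/eqP; rewrite addrC addr_eq0 => /eqP ->; congr (- _).
by apply: Rintegral_congr => x _; rewrite hornerC mul1r.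
Qed.

Lemma integral_normal_density (f : R -> \bar R) : measurable_fun setT f ->
  (\int[normal_prob 0 1]_x `|f x| < +oo)%E ->
  (\int[normal_prob 0 1]_x f x = \int[mu]_x (f x * (normal_pdf 0 1 x)%:E))%E.
Proof.
move=> mf finf.
rewrite -(Radon_Nikodym_change_of_variables (@normal_prob_dominates R 0 1))//=; last first.
  by apply/integrableP; split.
apply: ae_eq_integral => //.
- apply: emeasurable_funM => //; apply: (measurable_int mu).
  by apply: Radon_Nikodym_integrable; exact: normal_prob_dominates.
- apply: emeasurable_funM => //=; apply/measurableT_comp => //=.
  exact: measurable_normal_pdf.
- apply: ae_eqe_mul2l => /=.
  rewrite Radon_NikodymE//=; first exact: normal_prob_dominates.
  move=> abmu.
  case: cid => /= h [h1 h2 h3].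
  apply: integral_ae_eq => //=.
  + by apply/measurableT_comp =>//; exact: measurable_normal_pdf.
  + by move=> E E01 mE; rewrite -h3.
Qed.

Lemma normal_integrable (f : R -> R) : measurable_fun setT f ->
  mu.-integrable setT (EFin \o (fun x => f x * normal_pdf 0 1 x)) ->
  (normal_prob 0 1).-integrable setT (EFin \o f).
Proof.
move=> mf /integrableP[_ fi].
have pdf0 (x : R) : 0 <= normal_pdf 0 1 x := normal_pdf_ge0 0 1 x.
pose g n x : R := Num.min `|f x| n%:R.
have g0 n x : 0 <= g n x by rewrite le_min normr_ge0 ler0n.
have mg n : measurable_fun setT (g n).
  by apply: measurable_minr; [exact: measurableT_comp|exact: measurable_cst].
have mgE n : measurable_fun setT (fun x => (g n x)%:E) by apply/measurable_EFinP; exact: mg.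
have gle n : (\int[normal_prob 0 1]_x (g n x)%:E <= \int[mu]_x `|(f x * normal_pdf 0 1 x)%:E|)%E.
  rewrite integral_normal_density; first last.
  - apply: (@le_lt_trans _ _ (\int[normal_prob 0 1]_x (n%:R)%:E)%E).
      apply: ge0_le_integral => //.
      - by apply: measurableT_comp => //; exact: mgE.
      - by move=> x _; rewrite lee_fin ger0_norm// ge_min lexx orbT.
    by rewrite integral_cst//= probability_setT mule1 ltry.
  - exact: mgE.
  apply: ge0_le_integral => //.
  - by move=> x _; rewrite mule_ge0 ?lee_fin.
  - apply: emeasurable_funM; first exact: mgE.
    by apply/measurable_EFinP; exact: measurable_normal_pdf.
  - apply: measurableT_comp => //; apply/measurable_EFinP; apply: measurable_funM => //.
    exact: measurable_normal_pdf.
  - move=> x _; rewrite -EFinM lee_fin normrM (ger0_norm (pdf0 x)).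
    by rewrite ler_wpM2r// ge_min lexx.
apply/integrableP; split; first exact/measurable_EFinP.
apply: le_lt_trans fi.
have cg := @cvg_monotone_convergence _ _ _ (normal_prob 0 1) setT measurableT (fun n x => (g n x)%:E).
have {}cg : (\int[normal_prob 0 1]_x (g n x)%:E)%E @[n --> \oo] --> (\int[normal_prob 0 1]_x `|(f x)%:E|)%E.
  have -> : (fun x => `|(f x)%:E|%E) = (fun x => limn (fun n => (g n x)%:E)).
    apply/funext => x; apply/esym/cvg_lim => //.
    apply: cvg_near_cst; near=> n; rewrite /g /=; congr EFin; apply/min_idPl.
    by near: n; exact: nbhs_infty_ger.
  apply: cg.
  - exact: mgE.
  - by move=> n x _; rewrite lee_fin.
  - move=> x _ m n mn; rewrite lee_fin le_min ge_min lexx/= ge_min ler_nat mn orbT//.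
rewrite -(cvg_lim _ cg)//; apply: lime_le; first by apply/cvg_ex; eexists; exact: cg.
exact: nearW.
Unshelve. all: by end_near. Qed.

Lemma normal_pdf_gauss : exists2 k : R, 0 < k & forall x : R, normal_pdf 0 1 x = k * gauss x.
Proof.
exists (normal_peak 1); first by apply: normal_peak_gt0; rewrite oner_neq0.
move=> x; rewrite normal_pdfE ?oner_neq0//; congr (_ * expR _).
by rewrite subr0 expr1n.
Qed.

Lemma integral_gauss : exists2 k : R, (forall x : R, normal_pdf 0 1 x = k * gauss x) &
  k * \int[mu]_x gauss x = 1.
Proof.
have [k k0 kE] := normal_pdf_gauss; exists k => //.
have ig : mu.-integrable setT (EFin \o (gauss : R -> R)).
  have := integrable_poly_gauss 1; congr (integrable _ _ _).
  by apply/funext => x; rewrite /= hornerC mul1r.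
rewrite -RintegralZl//.
have := @integral_normal_pdf R 0 1; rewrite /Rintegral => h.
by under eq_integral do rewrite -kE; rewrite h.
Qed.

(** The expansion of a standard Gaussian variable has a single nonzero
    coefficient, the one of order 1. *)
Lemma hermite_moment d (Omega : measurableType d) (P : probability Omega R) (X : {RV P >-> R}) n :
  (forall B : set R, measurable B -> distribution P X B = normal_prob 0 1 B) ->
  P.-integrable setT (EFin \o (fun w => X w * hermite n (X w))) /\
  \int[P]_w (X w * hermite n (X w)) = (n == 1%N)%:R.
Proof.
move=> XN.
have mX : @measurable_fun _ _ Omega (measurableTypeR R) setT X by exact: (@measurable_funPT _ _ _ _ X).
pose mY := isMeasurableFun.Build _ _ Omega (measurableTypeR R) X mX.
pose Y : {RV P >-> measurableTypeR R} := HB.pack (X : Omega -> measurableTypeR R) mY.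
have YN (B : set (measurableTypeR R)) : measurable B -> distribution P Y B = normal_prob 0 1 B.
  by move=> mB; exact: (XN B mB).
have [k kE k1] := integral_gauss.
pose f (x : R) := x * hermite n x.
have fE x : f x = (-1) ^+ n * ('X * hermite_poly n).[x].
  by rewrite /f hermiteE hornerM hornerX mulrCA.
have mf : measurable_fun setT f.
  rewrite (_ : f = fun x => (-1) ^+ n * ('X * hermite_poly n).[x]); last exact/funext.
  by apply: measurable_funM => //; apply: measurable_continuous; exact: continuous_horner.
have fgE x : f x * normal_pdf 0 1 x = (-1) ^+ n * k * (('X * hermite_poly n).[x] * gauss x).
  by rewrite fE kE; ring.
have ifg : mu.-integrable setT (EFin \o (fun x => f x * normal_pdf 0 1 x)).
  under eq_fun do rewrite /= fgE; apply: integrable_EFinZ => //; exact: integrable_poly_gauss.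
have iN := normal_integrable mf ifg.
have iD : (distribution P Y).-integrable setT (EFin \o f).
  apply/integrableP; split; first exact/measurable_EFinP.
  have /integrableP[_] := iN; congr (_ < _)%E; apply/esym.
  by apply: eq_measure_integral => A mA _; exact: YN.
have iP : P.-integrable setT (EFin \o (f \o Y)).
  apply/integrableP; split; first by apply/measurable_EFinP; exact: (measurableT_comp mf mX).
  have /integrableP[mfD] := iD; rewrite ge0_integral_distribution//.
  by apply: measurableT_comp => //; exact/measurable_EFinP.
split; first exact: iP.
rewrite /Rintegral -[X in fine X](@integral_distribution _ _ _ _ _ P Y (EFin \o f))//; last exact/measurable_EFinP.
rewrite (eq_measure_integral (normal_prob 0 1)); last by move=> A mA _; exact: YN.
have /integrableP[mfN fN] := iN.
rewrite integral_normal_density//.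
transitivity (\int[mu]_x ((-1) ^+ n * k * (('X * hermite_poly n).[x] * gauss x))).
  by congr fine; apply: eq_integral => x _; rewrite -fgE.
rewrite RintegralZl//; last exact: integrable_poly_gauss.
case: eqVneq => [->|n1]; last by rewrite integral_X_hermite ?mulr0.
by rewrite integral_X_hermite1 expr1 mulrN mulN1r mulNr opprK k1.
Qed.

End GaussianPolynomials.

(** * Majorants of entire families *)

Section EntireMajorants.
Context {R : realType}.
Notation mu := (@lebesgue_measure R).
Local Open Scope complex_scope.
Notation Re := complex.Re.
Notation Im := complex.Im.

(** Any positive power of the factorial beats every geometric sequence; this is where
    rho < 1 is used. *)
Lemma power_le_fact_powR (x s : R) : 0 <= x -> 0 < s ->
  exists2 C, 0 <= C & forall n, x ^+ n <= C * (n`!%:R) `^ s.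
Proof.
move=> x0 s0; pose y := x `^ s^-1.
have y0 : 0 <= y by exact: powR_ge0.
have ys : y `^ s = x by rewrite /y -powRrM mulVf ?gt_eqF// powRr1.
exists (expR y `^ s); first exact: powR_ge0.
move=> n; have f0 : 0 < n`!%:R :> R by rewrite ltr0n fact_gt0.
have yn : y ^+ n <= expR y * n`!%:R.
  case: n f0 => [_|n f0]; first by rewrite expr0 mulr1 -expR0 ler_expR.
  rewrite -ler_pdivrMr//; apply: le_trans (expR_ge1Dxn n y0).
  by rewrite lerDr.
rewrite -powRM ?expR_ge0 ?(ltW f0)// -ys -powR_exp//.
by apply: ge0_ler_powR; rewrite ?(ltW s0)// nnegrE ?exprn_ge0 ?mulr_ge0 ?expR_ge0 ?(ltW f0).
Qed.

Lemma measurable_sqmod d (X : measurableType d) (D : set X) (f : X -> R[i]) :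
  cmeasurable_fun D f -> measurable_fun D (fun x => sqmod (f x)).
Proof. by move=> [f1 f2]; apply: measurable_funD; exact: measurable_funX. Qed.

(** Convergence of the majorant series holds outside a null set only; the family is set to
    zero there to have it everywhere. *)
Definition cut_off (N : set (R * R)) (w : nat -> R * R -> R[i]) n p : R[i] :=
  if p \in N then 0 else w n p.

Lemma cmeasurable_cut_off N w n : measurable N -> cmeasurable_fun setT (w n) ->
  cmeasurable_fun setT (cut_off N w n).
Proof.
move=> mN [m1 m2].
have mdec : measurable_fun setT (fun x => x \in N).
  apply: (@measurable_fun_bool _ _ setT _ true); rewrite (_ : _ @^-1` _ = N); first exact: measurableI.
  by apply/seteqP; split => x /=; [move/set_mem|move/mem_set].
split.
  rewrite (_ : (fun x => _) = fun x => if x \in N then 0 else Re (w n x)); first exact: measurable_fun_ifT.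
  by apply/funext => x; rewrite /cut_off; case: ifP.
rewrite (_ : (fun x => _) = fun x => if x \in N then 0 else Im (w n x)); first exact: measurable_fun_ifT.
by apply/funext => x; rewrite /cut_off; case: ifP.
Qed.

(** The square sums at all integer radii are integrable over the strip, hence finite
    off one null set, and dominated_sqmod turns them into majorants. *)
Lemma majorized_cut_off (w : nat -> R * R -> R[i]) : (forall n, cmeasurable_fun setT (w n)) ->
  (forall m : nat, (\sum_(n <oo) ((m%:R ^+ n)%:E *
     \int[(mu \x mu)%E]_p (sqmod (w n p))%:E) < +oo)%E) ->
  exists N : set (R * R), [/\ measurable N, ((mu \x mu)%E N = 0)%E & majorized (cut_off N w)].
Proof.
move=> mw fin.
pose t m n p : \bar R := ((m%:R ^+ n * sqmod (w n p))%:E).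
pose G m p : \bar R := (\sum_(n <oo) t m n p)%E.
have t0 m n p : (0 <= t m n p)%E by rewrite lee_fin mulr_ge0 ?exprn_ge0 ?sqmod_ge0.
have mt m n : measurable_fun setT (t m n).
  apply/measurable_EFinP; apply: measurable_funM => //; exact: measurable_sqmod.
have mG m : measurable_fun setT (G m).
  by apply: ge0_emeasurable_sum.
have G0 m p : (0 <= G m p)%E by apply: nneseries_ge0.
have iG m : (mu \x mu)%E.-integrable setT (G m).
  apply/integrableP; split; first exact: mG.
  have -> : (\int[(mu \x mu)%E]_p `|G m p| = \int[(mu \x mu)%E]_p G m p)%E.
    by apply: eq_integral => p _; rewrite gee0_abs.
  rewrite (@integral_nneseries _ _ _ (mu \x mu)%E setT measurableT (t m) (mt m) (fun n p _ => t0 m n p)).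
  rewrite (eq_eseriesr (g := fun n => ((m%:R ^+ n)%:E * \int[(mu \x mu)%E]_p (sqmod (w n p))%:E)%E)); first exact: fin.
  move=> n _; rewrite -(@ge0_integralZl_EFin _ _ _ (mu \x mu)%E setT measurableT) ?exprn_ge0//.
  - by move=> p _; rewrite lee_fin sqmod_ge0.
  - by apply/measurable_EFinP; exact: (measurable_sqmod (mw n)).
have aeG : {ae (mu \x mu)%E, forall p, forall m, G m p \is a fin_num}.
  by apply: ae_all => m; apply: ae_mono (integrable_ae measurableT (iG m)) _ => p; apply.
have [N [mN N0 sub]] := aeG.
have good p m : p \notin N -> G m p \is a fin_num.
  by move/negP => pN; apply: contrapT => h; apply: pN; apply/mem_set/sub => /= H; apply: h; exact: H.
exists N; split => //; split; first by move=> n; exact: cmeasurable_cut_off.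
move=> r r0.
have [m mr] : exists m : nat, 2 * r ^+ 2 <= m%:R.
  exists (Num.bound (2 * r ^+ 2)); apply/ltW/archi_boundP.
  by rewrite mulr_ge0 ?sqr_ge0.
exists (fun p => if p \in N then 0 else 2 * Num.sqrt (fine (G m p))).
  have mdec : measurable_fun setT (fun x => x \in N).
    apply: (@measurable_fun_bool _ _ setT _ true); rewrite (_ : _ @^-1` _ = N); first exact: measurableI.
    by apply/seteqP; split => x /=; [move/set_mem|move/mem_set].
  have mf : measurable_fun setT (fine \o G m) by exact: measurableT_comp.
  have mg : measurable_fun setT (fun p => if p \in N then 0 else 2 * Num.sqrt (fine (G m p))).
    apply: measurable_fun_ifT => //; apply: measurable_funM => //.
    apply: (@measurableT_comp _ _ _ _ _ _ (Num.sqrt : R -> R)) => //.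
    by apply: measurable_continuous; exact: sqrt_continuous.
  split => //.
  have i4 : (mu \x mu)%E.-integrable setT (EFin \o (fun p => 4 * fine (G m p))).
    apply: integrable_EFinZ => //.
    apply: le_integrable (iG m) => //; first exact/measurable_EFinP.
    move=> p _ /=; have := G0 m p; case: (G m p) => [s| |] //=; rewrite ?normr0 ?leey//.
  apply: (le_integrableR _ _ _ i4) => //; first exact: measurable_funX.
  move=> p _; rewrite ger0_norm ?sqr_ge0//; case: ifP => _.
    by rewrite expr0n mulr_ge0 ?fine_ge0.
  by rewrite exprMn sqr_sqrtr ?fine_ge0// -natrX.
move=> p; rewrite /cut_off; case: ifPn => [_|pN]; first exact: dominated0.
apply: dominated_sqmod (ltW r0) _ => k.
have Gf := good p m pN.
rewrite -lee_fin fineK//; apply: le_trans (nneseries_lim_ge k _); last by move=> i _ _; exact: t0.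
rewrite /series/= sumEFin lee_fin; apply: ler_sum => i _.
rewrite ler_wpM2r ?sqmod_ge0// lerXn2r// ?nnegrE//.
by rewrite mulr_ge0 ?sqr_ge0.
Qed.

End EntireMajorants.

(** * The chaos coefficients as functions on the strip *)

Section StripFamilies.
Context {R : realType}.
Notation mu := (@lebesgue_measure R).
Local Open Scope complex_scope.
Notation Re := complex.Re.
Notation Im := complex.Im.

Lemma cmeasurable_strip (T : R) (f : R * R -> R[i]) : cmeasurable_fun (`]0, T[ `*` [set: R]) f ->
  cmeasurable_fun setT (fun p => if in_time T p.1 then f p else 0).
Proof.
have mD : measurable (`]0, T[%classic `*` [set: R]) by apply: measurableX => //; exact: measurable_itv.
have DE (p : R * R) : (p \in `]0, T[%classic `*` [set: R]) = in_time T p.1.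
  by apply/idP/idP; rewrite in_timeE; [move/set_mem => -[]|move=> h; apply/mem_set; split].
move=> [/(measurable_restrictT _ mD) f1 /(measurable_restrictT _ mD) f2]; split.
  rewrite (_ : (fun p => _) = (fun p => Re (f p)) \_ (`]0, T[ `*` [set: R]))//.
  by apply/funext => p; rewrite patchE DE; case: ifP.
rewrite (_ : (fun p => _) = (fun p => Im (f p)) \_ (`]0, T[ `*` [set: R]))//.
by apply/funext => p; rewrite patchE DE; case: ifP.
Qed.

Lemma strip_tonelli (T : R) (f : R * R -> R[i]) : cmeasurable_fun (`]0, T[ `*` [set: R]) f ->
  (\int[(mu \x mu)%E]_p (sqmod (if in_time T p.1 then f p else 0))%:E =
   \int[mu]_(t in `]0%R, T[) L2_sqnorm (fun x => f (t, x)))%E.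
Proof.
move=> mf; have mF := cmeasurable_strip mf.
rewrite fubini_tonelli1/=; last 2 first.
- by apply/measurable_EFinP; exact: (measurable_sqmod mF).
- by move=> p; rewrite lee_fin sqmod_ge0.
rewrite [RHS]integral_mkcond; apply: eq_integral => t _; rewrite /fubini_F patchE/=.
have -> : (t \in `]0, T[%classic) = in_time T t.
  by rewrite in_timeE; apply/idP/idP => [/set_mem|/mem_set].
case: ifP => _; first by [].
by under eq_integral do rewrite sqmod0; rewrite integral0.
Qed.

Lemma L2H2_component_le (T : R) (F : @jet_point R -> R[i]) (k : 'I_3) :
  (\int[mu]_(t in `]0%R, T[) L2_sqnorm (fun x => F (k, (t, x))) <= L2H2_sqnorm T F)%E.
Proof.
rewrite /L2H2_sqnorm (bigD1 k)//= leeDl//; apply: sume_ge0 => j _.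
by apply: integral_ge0 => t _; apply: integral_ge0 => x _; rewrite lee_fin sqmod_ge0.
Qed.

Lemma ae_product_slices (Q : R * R -> Prop) : {ae (mu \x mu)%E, forall p, Q p} ->
  {ae mu, forall s, {ae mu, forall x, Q (s, x)}}.
Proof.
move=> [N [mN N0 sub]].
have mx : measurable_fun setT (fun s => mu (xsection N s)) by exact: measurable_fun_xsection.
have h : {ae mu, forall s, mu (xsection N s) = 0%E}.
  apply: integral_abs_eq0_ae => //; rewrite -[RHS]N0 /product_measure1/=.
  by apply: eq_integral => s _; rewrite gee0_abs.
apply: ae_mono h _ => s hs; exists (xsection N s); split => //; first exact: measurable_xsection.
by move=> x nQ; rewrite /xsection/= inE; apply: sub.
Qed.

Lemma ae_product_slices2 (Q : R * R -> Prop) : {ae (mu \x mu)%E, forall p, Q p} ->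
  {ae mu, forall x, {ae mu, forall s, Q (s, x)}}.
Proof.
move=> [N [mN N0 sub]].
have mI : measurable_fun setT (\1_N : R * R -> R) by exact: measurable_indic.
have e1 : {ae mu, forall s, {ae mu, forall x, (\1_N : R * R -> R) (s, x) = 0}}.
  apply: (@ae_product_slices (fun p => (\1_N : R * R -> R) p = 0)); exists N; split => // p h; apply: contrapT => pN; apply: h.
  by rewrite /= indicE memNset.
have e2 := ae_swap mI (measurable_cst _) e1.
apply: ae_mono e2 _ => x hx; apply: ae_mono hx _ => s; rewrite indicE => h.
apply: contrapT => nQ; have sN : N (s, x) by apply: sub.
by move: h; rewrite mem_set//= => /eqP; rewrite oner_eq0.
Qed.

Lemma weak_derivative_scaled_ae (c : R) (f f' w w' : R -> R[i]) : c != 0 ->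
  cmeasurable_fun setT f -> cmeasurable_fun setT f' ->
  cmeasurable_fun setT w -> cmeasurable_fun setT w' -> cloc w -> cloc w' ->
  {ae mu, forall x, w x = c%:C * f x} -> {ae mu, forall x, w' x = c%:C * f' x} ->
  weak_derivative f f' -> weak_derivative w w'.
Proof.
move=> c0 mf mf' mw mw' lw lw' wf wf' ff psi tpsi.
have c1 : c%:C != 0 :> R[i] by rewrite (_ : 0 = 0%:C)// (inj_eq (@complexI _)).
have key (g v : R -> R[i]) (p : R -> R) : cmeasurable_fun setT g -> cmeasurable_fun setT v ->
    cloc v -> {ae mu, forall x, v x = c%:C * g x} -> smooth_compact_support p ->
    cintegral mu setT (fun x => g x * (p x)%:C) = c%:C^-1 * cintegral mu setT (fun x => v x * (p x)%:C).
  move=> mg mv [l1 l2] vg tp.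
  have mp : measurable_fun setT p by apply: measurable_continuous; exact: test_continuous.
  have iv : cintegrable mu setT (fun x => v x * (p x)%:C).
    split.
      by under eq_fun do rewrite /= ReM/= mulr0 subr0; exact: loc_test_integrable.
    by under eq_fun do rewrite /= ImM/= mulr0 add0r; exact: loc_test_integrable.
  rewrite -(@cintegralZ _ _ _ mu setT measurableT)//.
  have i1 := @cintegrableZ _ _ _ mu setT measurableT (c%:C^-1) _ iv.
  have m1 : cmeasurable_fun setT (fun x => g x * (p x)%:C).
    by apply: (cmeasurableM mg); exact: (cmeasurable_real mp).
  have e : {ae mu, forall x, [set: R] x -> c%:C^-1 * (v x * (p x)%:C) = g x * (p x)%:C}.
    by apply: ae_mono vg _ => x -> _; rewrite mulrA mulKf.
  by have [_ ->] := @cintegrable_ae _ _ _ mu setT measurableT _ _ i1 m1 e.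
have e1 := key _ _ _ mf mw lw wf (test_derive1 tpsi).
have e2 := key _ _ _ mf' mw' lw' wf' tpsi.
have := ff psi tpsi; rewrite e1 e2 -mulrN; apply: mulfI.
by rewrite invr_eq0.
Qed.

Variables (q : nat -> R) (T rho l : R) (u : mindex -> @jet_point R -> R[i]).
Hypotheses (q1 : 1 < q 0%N) (rho01 : 0 <= rho < 1).
Hypothesis uS : chaos_space q (- rho) (- l) (L2H2 T) u.

Definition axis_coef (k : 'I_3) n (p : R * R) : R[i] :=
  ((Num.sqrt n`!%:R)^-1)%:C * u (axis n) (k, p).
(** The coefficient w_n of the transformed solution, extended by zero outside the time
    interval so that integrals over the strip become integrals over the plane. *)
Definition strip_coef k n p : R[i] := if in_time T p.1 then axis_coef k n p else 0.

Lemma cmeasurable_axis_coef k n : cmeasurable_fun (`]0, T[ `*` [set: R]) (axis_coef k n).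
Proof.
apply: cmeasurableM; first exact: cmeasurable_cst.
by have [/(_ (axis n))[]] := uS.
Qed.

Lemma strip_coef_norm k n :
  (\int[(mu \x mu)%E]_p (sqmod (strip_coef k n p))%:E <=
   (n`!%:R^-1)%:E * L2H2_sqnorm T (u (axis n)))%E.
Proof.
have f0 : 0 <= (n`!%:R : R)^-1 by rewrite invr_ge0.
rewrite /strip_coef strip_tonelli; last exact: cmeasurable_axis_coef.
apply: (@le_trans _ _ ((n`!%:R^-1)%:E * \int[mu]_(t in `]0%R, T[) L2_sqnorm (fun x => u (axis n) (k, (t, x))))%E); last first.
  by apply: lee_wpmul2l; [rewrite lee_fin|exact: L2H2_component_le].
have mU : cmeasurable_fun setT (fun p => if in_time T p.1 then u (axis n) (k, p) else 0).
  by apply: cmeasurable_strip; have [/(_ (axis n))[]] := uS.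
have sE c : sqmod (c%:C : R[i]) = c ^+ 2 by rewrite /sqmod/= expr0n addr0.
have e p : ((sqmod (if in_time T p.1 then axis_coef k n p else 0))%:E =
   (n`!%:R^-1)%:E * (sqmod (if in_time T p.1 then u (axis n) (k, p) else 0))%:E)%E.
  case: ifP => _; last by rewrite sqmod0 mule0.
  by rewrite /axis_coef sqmodM sE EFinM exprVn sqr_sqrtr.
rewrite -strip_tonelli; last exact: cmeasurable_axis_coef.
rewrite -(@strip_tonelli T (fun p => u (axis n) (k, p))); last by have [/(_ (axis n))[]] := uS.
rewrite -(@ge0_integralZl_EFin _ _ _ (mu \x mu)%E setT measurableT)//.
- by rewrite le_eqVlt; apply/orP; left; apply/eqP; apply: eq_integral => p _; exact: e.
- by move=> p _; rewrite lee_fin sqmod_ge0.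
- by apply/measurable_EFinP; exact: (measurable_sqmod mU).
Qed.

Lemma strip_coef_cmeasurable k n : cmeasurable_fun setT (strip_coef k n).
Proof. by apply: cmeasurable_strip; exact: cmeasurable_axis_coef. Qed.

(** The weights (n!)^-rho q_1^(-l n) of the chaos space, divided by n!, leave a
    positive power of n! to spare against any r^n. *)
Lemma strip_coef_majorized k : exists N : set (R * R),
  [/\ measurable N, ((mu \x mu)%E N = 0)%E & majorized (cut_off N (strip_coef k))].
Proof.
apply: majorized_cut_off; first exact: strip_coef_cmeasurable.
move=> m; have /andP[rho0 rho1] := rho01.
have q0 : 0 < q 0%N by exact: lt_trans q1.
set Q := q 0%N `^ l; have Q0 : 0 < Q by exact: powR_gt0.
have s0 : 0 < 1 - rho by rewrite subr_gt0.
have [C C0 hC] := @power_le_fact_powR R (m%:R * Q) (1 - rho) (mulr_ge0 (ler0n _ _) (ltW Q0)) s0.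
pose f (a : mindex) : \bar R := (((mfact a)%:R `^ (- rho) * mpow q a `^ (- l))%:E * sqnorm (L2H2 T) (u a))%E.
have f0 a : (0 <= f a)%E.
  rewrite mule_ge0// ?lee_fin ?mulr_ge0 ?powR_ge0//.
  by apply: sume_ge0 => j _; apply: integral_ge0 => t _; apply: integral_ge0 => x _; rewrite lee_fin sqmod_ge0.
apply: (@le_lt_trans _ _ (C%:E * \sum_(n <oo) f (axis n))%E); last first.
  rewrite lte_mul_pinfty ?lee_fin//; apply: le_lt_trans (nneseries_axis_le f0) _.
  by have [_] := uS.
rewrite -nneseriesZl; last by move=> n _; exact: f0.
apply: lee_nneseries.
  move=> n _ _; rewrite mule_ge0 ?lee_fin ?exprn_ge0//.
  by apply: integral_ge0 => p _; rewrite lee_fin sqmod_ge0.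
move=> n _; apply: (@le_trans _ _ ((m%:R ^+ n)%:E * ((n`!%:R^-1)%:E * L2H2_sqnorm T (u (axis n))))%E).
  by apply: lee_wpmul2l; [rewrite lee_fin exprn_ge0|exact: strip_coef_norm].
rewrite /f muleA [in leRHS]muleA -!EFinM; apply: lee_wpmul2r.
  by apply: sume_ge0 => j _; apply: integral_ge0 => t _; apply: integral_ge0 => x _; rewrite lee_fin sqmod_ge0.
rewrite lee_fin mfact_axis mpow_axis powR_exp ?(ltW q0)// !powRN -/Q.
have F0 : 0 < n`!%:R :> R by rewrite ltr0n fact_gt0.
have F1 : 0 < (n`!%:R : R) `^ rho by exact: powR_gt0.
have QX : 0 < Q ^+ n by exact: exprn_gt0.
have := hC n; rewrite exprMn powRD ?gt_eqF ?implybT// powRr1 ?(ltW F0)// powRN => h.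
rewrite -(ler_pM2r (mulr_gt0 QX F0)).
rewrite (_ : m%:R ^+ n / n`!%:R * (Q ^+ n * n`!%:R) = m%:R ^+ n * Q ^+ n); last by field; rewrite gt_eqF.
apply: le_trans h _; rewrite le_eqVlt; apply/orP; left; apply/eqP.
by rewrite exprVn; field; rewrite !gt_eqF.
Qed.

End StripFamilies.

(** * Identification of limits *)

Section FatouIdentification.
Context d (X : measurableType d) {R : realType} (m : {measure set X -> \bar R}).
Local Open Scope complex_scope.
Notation Re := complex.Re.
Notation Im := complex.Im.

Lemma sqmod_eq0 (z : R[i]) : sqmod z = 0 -> z = 0.
Proof.
move/eqP; rewrite /sqmod paddr_eq0 ?sqr_ge0// !sqrf_eq0 => /andP[/eqP a /eqP b].
exact: complex_eq.
Qed.

Lemma ae_zero_sqmod (h : X -> R[i]) : cmeasurable_fun setT h ->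
  (forall e : R, 0 < e -> (\int[m]_p (sqmod (h p))%:E <= e%:E)%E) ->
  {ae m, forall p, h p = 0}.
Proof.
move=> mh small.
have ms : measurable_fun setT (fun p => (sqmod (h p))%:E).
  by apply/measurable_EFinP; exact: (measurable_sqmod mh).
have I0 : (\int[m]_p `|(sqmod (h p))%:E| = 0)%E.
  have -> : (\int[m]_p `|(sqmod (h p))%:E| = \int[m]_p (sqmod (h p))%:E)%E.
    by apply: eq_integral => p _; rewrite gee0_abs// lee_fin sqmod_ge0.
  apply/eqP; rewrite eq_le; apply/andP; split; last first.
    by apply: integral_ge0 => p _; rewrite lee_fin sqmod_ge0.
  by apply/lee_addgt0Pr => e e0; rewrite add0e; exact: small.
have := (ae_eq_integral_abs m measurableT ms).1 I0.
move=> H; apply: ae_mono H _ => p hp; apply: sqmod_eq0; apply: EFin_inj.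
exact: (hp Logic.I).
Qed.

(** Convergence in mean square to zero along a pointwise convergent sequence; Fatou
    replaces the extraction of a subsequence. *)
Lemma fatou_zero_sqmod (h : nat -> X -> R[i]) (h0 : X -> R[i]) :
  (forall n, cmeasurable_fun setT (h n)) -> cmeasurable_fun setT h0 ->
  (forall p, (fun n => Re (h n p)) @ \oo --> Re (h0 p) /\ (fun n => Im (h n p)) @ \oo --> Im (h0 p)) ->
  (forall e : R, 0 < e -> exists M, forall n, (M <= n)%N -> (\int[m]_p (sqmod (h n p))%:E <= e%:E)%E) ->
  {ae m, forall p, h0 p = 0}.
Proof.
move=> mh mh0 ch small; apply: ae_zero_sqmod => // e e0.
have [M hM] := small e e0.
have F := @fatou _ _ _ m setT measurableT (fun n p => (sqmod (h n p))%:E)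
  (fun n => (measurable_EFinP _ _).2 (measurable_sqmod (mh n)))
  (fun n p _ => sqmod_ge0 (h n p)).
have e1 : (\int[m]_p (sqmod (h0 p))%:E = \int[m]_p limn_einf (fun n => (sqmod (h n p))%:E))%E.
  apply: eq_integral => p _; have [c1 c2] := ch p.
  have c : (fun n => (sqmod (h n p))%:E) @ \oo --> (sqmod (h0 p))%:E.
    apply/fine_cvgP; split; first exact: nearW.
    by rewrite /sqmod; apply: cvgD; rewrite !expr2; apply: cvgM.
  by rewrite is_cvg_limn_einfE ?(cvg_lim _ c)//; apply/cvg_ex; eexists; exact: c.
rewrite e1; apply: le_trans F _; rewrite limn_einf_lim; apply: lime_le; first exact: is_cvg_einfs.
apply: nearW => n; apply: le_trans (hM (maxn n M) (leq_maxr _ _)).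
by apply: ereal_inf_lbound; exists (maxn n M) => //=; exact: leq_maxl.
Qed.

End FatouIdentification.

(** * The S-transform as a power series *)

Section STransformOnAxis.
Context {R : realType}.
Notation mu := (@lebesgue_measure R).
Local Open Scope complex_scope.
Notation Re := complex.Re.
Notation Im := complex.Im.

Lemma cmeasurableN d (X : measurableType d) (D : set X) (f : X -> R[i]) :
  cmeasurable_fun D f -> cmeasurable_fun D (fun x => - f x).
Proof.
move=> mf; rewrite (_ : (fun x => - f x) = fun x => (- 1) * f x).
  by apply: cmeasurableM => //; exact: cmeasurable_cst.
by apply/funext => x; rewrite mulN1r.
Qed.

Lemma cmeasurable_sum d (X : measurableType d) (D : set X) (f : nat -> X -> R[i]) N :
  (forall n, cmeasurable_fun D (f n)) -> cmeasurable_fun D (fun x => \sum_(0 <= n < N) f n x).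
Proof.
move=> mf; split.
  by under eq_fun do rewrite Re_sum; apply: measurable_sum => n; exact: (mf n).1.
by under eq_fun do rewrite Im_sum; apply: measurable_sum => n; exact: (mf n).2.
Qed.

(** Unconditional convergence over finite sets of multi-indices is specialized to
    the sets that add an initial segment of the axis. *)
Lemma sum_fset_axis (A0 : {fset mindex}) : exists M, forall N, (M <= N)%N ->
  exists2 A : {fset mindex}, (A0 `<=` A)%fset &
  forall f : mindex -> R[i], (forall a : mindex, a != axis (a 0%N) -> f a = 0) ->
    \sum_(a <- A) f a = \sum_(0 <= n < N) f (axis n).
Proof.
exists (\max_(a <- A0) (a 0%N).+1) => N MN.
pose B : {fset mindex} := seq_fset tt [seq axis n | n <- iota 0 N].
exists (A0 `|` B)%fset; first exact: fsubsetUl.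
move=> f fz.
have -> : \sum_(a <- (A0 `|` B)%fset) f a = \sum_(a <- B) f a.
  apply/esym; apply: (big_fset_incl _ (fsubsetUr A0 B)) => a; rewrite inE => /orP[aA|->//] aB.
  apply: fz; apply: contra aB => /eqP aE; rewrite seq_fsetE aE map_f// mem_iota add0n.
  by apply: leq_trans MN; rewrite (big_fsetD1 a)//= leq_maxl.
rewrite (perm_big [seq axis n | n <- iota 0 N]); last first.
  apply: uniq_perm; [exact: fset_uniq|by rewrite map_inj_uniq ?iota_uniq//; exact: axis_inj|].
  by move=> a; rewrite seq_fsetE.
by rewrite big_map /index_iota subn0.
Qed.

Variables (q : nat -> R) (T rho l : R) (u : mindex -> @jet_point R -> R[i]).
Variables (z : R[i]) (F : @jet_point R -> R[i]) (k : 'I_3) (N : set (R * R)).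
Hypotheses (mN : measurable N) (N0 : ((mu \x mu)%E N = 0)%E)
  (Mw : majorized (cut_off N (strip_coef T u k))).
Hypothesis uS : chaos_space q (- rho) (- l) (L2H2 T) u.

(** The S-transform is a limit in L_2((0,T); H^2) of partial sums, and the same partial sums
    converge pointwise to wsum; the two limits agree almost everywhere. *)
Lemma S_transform_axis rho' l' : is_S_transform q rho' l' (L2H2 T) u (on_axis z) F ->
  {ae (mu \x mu)%E, forall p, in_time T p.1 -> F (k, p) = wsum (cut_off N (strip_coef T u k)) z p}.
Proof.
move=> [_ _ [mF _ _] approx].
pose W := cut_off N (strip_coef T u k).
pose Fh p := if in_time T p.1 then F (k, p) else 0.
have mFh : cmeasurable_fun setT Fh by apply: cmeasurable_strip; exact: mF.
have notN : {ae (mu \x mu)%E, forall p, p \notin N}.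
  exists N; split => // p /=; rewrite /= => h; apply: contrapT => pN; apply: h.
  by apply/negP => /set_mem.
pose h n p := Fh p - \sum_(0 <= i < n) z ^+ i * W i p.
have mh n : cmeasurable_fun setT (h n).
  apply: cmeasurableD => //; apply: cmeasurableN.
  apply: (@cmeasurable_sum _ _ _ (fun i p => z ^+ i * W i p)) => i.
  by apply: cmeasurableM; [exact: cmeasurable_cst|exact: Mw.1].
have mW := cmeasurable_wsum z Mw.
have key : {ae (mu \x mu)%E, forall p, Fh p - wsum W z p = 0}.
  apply: (@fatou_zero_sqmod _ _ _ (mu \x mu)%E h) => //.
  - by apply: cmeasurableD => //; exact: cmeasurableN.
  - move=> p; have cs : csummable (fun i => z ^+ i * W i p) by exact: (majorized_csummable (w := W)).
    split.
      rewrite [X in X @ _ --> _](_ : _ = fun n => Re (Fh p) - series (fun i => Re (z ^+ i * W i p)) n).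
        by rewrite ReD ReN; apply: cvgB; [exact: cvg_cst|exact: csum_cvgRe].
      by apply/funext => n; rewrite /h ReD ReN Re_sum.
    rewrite [X in X @ _ --> _](_ : _ = fun n => Im (Fh p) - series (fun i => Im (z ^+ i * W i p)) n).
      by rewrite ImD ImN; apply: cvgB; [exact: cvg_cst|exact: csum_cvgIm].
    by apply/funext => n; rewrite /h ImD ImN Im_sum.
  - move=> e e0; have [A0 hA0] := approx e e0.
    have [M hM] := sum_fset_axis A0; exists M => n Mn.
    have [A A0A sumA] := hM n Mn.
    have lt := hA0 A A0A; apply/ltW; apply: le_lt_trans lt.
    pose D (p : @jet_point R) := F p - \sum_(a <- A) normalized_mpow (on_axis z) a * u a p.
    apply: le_trans (L2H2_component_le T D k).
    have DE (p : R * R) : D (k, p) = F (k, p) - \sum_(0 <= i < n) z ^+ i * axis_coef u k i p.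
      rewrite /D sumA; last by move=> a an; rewrite normalized_off_axis ?mul0r.
      congr (_ - _); apply: eq_bigr => i _.
      by rewrite normalized_on_axis /axis_coef mulrA.
    have mD : cmeasurable_fun (`]0, T[ `*` [set: R]) (fun p => D (k, p)).
      rewrite (_ : (fun p => _) = fun p : R * R => F (k, p) - \sum_(0 <= i < n) z ^+ i * axis_coef u k i p); last first.
        by apply/funext => p; exact: DE.
      apply: cmeasurableD; first exact: mF.
      apply: cmeasurableN; apply: (@cmeasurable_sum _ _ _ (fun i p => z ^+ i * axis_coef u k i p)) => i.
      apply: (cmeasurableM (cmeasurable_cst _ (z ^+ i))); exact: (cmeasurable_axis_coef uS k i).
    rewrite -(strip_tonelli mD) le_eqVlt; apply/orP; left; apply/eqP.
    apply: ae_eq_integral => //.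
    + by apply/measurable_EFinP; exact: (measurable_sqmod (mh n)).
    + by apply/measurable_EFinP; exact: (measurable_sqmod (cmeasurable_strip mD)).
    + apply: ae_mono notN _ => p pN _; congr (sqmod _)%:E; rewrite /h /Fh DE.
      have WE i : W i p = strip_coef T u k i p by rewrite /W /cut_off (negbTE pN).
      under eq_bigr do rewrite WE /strip_coef.
      case: ifP => // _; rewrite big1 ?subr0// => i _; exact: mulr0.
by apply: ae_mono key _ => p /eqP; rewrite subr_eq0 /Fh => /eqP <- ->.
Qed.

End STransformOnAxis.

(** * Products of square-integrable Sobolev functions *)

Section WeakProducts.
Context {R : realType}.
Notation mu := (@lebesgue_measure R).
Local Open Scope complex_scope.
Notation Re := complex.Re.
Notation Im := complex.Im.

Lemma loc_L2M (a b : R -> R) : L2fun a -> L2fun b -> locally_integrable setT (fun x => a x * b x).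
Proof.
move=> [ma a2] [mb b2]; apply: open_integrable_locally; first exact: openT.
apply: (le_integrableR _ _ _ (integrable_EFinD measurableT a2 b2)) => //; first exact: measurable_funM.
move=> x _; have := sqr_ge0 (a x - b x); have := sqr_ge0 (a x + b x).
by rewrite ler_norml => h1 h2; apply/andP; split; have := sqr_ge0 (a x); have := sqr_ge0 (b x); nra.
Qed.

Lemma weak_diffD (f f' g g' : R -> R) : locally_integrable setT f -> locally_integrable setT f' ->
  locally_integrable setT g -> locally_integrable setT g' ->
  weak_diff f f' -> weak_diff g g' -> weak_diff (fun x => f x + g x) (fun x => f' x + g' x).
Proof.
move=> lf lf' lg lg' ff gg psi tpsi; have tp' := test_derive1 tpsi.
under eq_Rintegral do rewrite mulrDl.
rewrite RintegralD//; try exact: loc_test_integrable.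
under [in RHS]eq_Rintegral do rewrite mulrDl.
rewrite [in RHS]RintegralD//; try exact: loc_test_integrable.
by rewrite opprD ff// gg.
Qed.

Lemma weak_diffN (f f' : R -> R) : locally_integrable setT f -> locally_integrable setT f' ->
  weak_diff f f' -> weak_diff (fun x => - f x) (fun x => - f' x).
Proof.
move=> lf lf' ff psi tpsi; have tp' := test_derive1 tpsi.
under eq_Rintegral do rewrite mulNr.
under [in RHS]eq_Rintegral do rewrite mulNr.
by rewrite !Rintegral_opp ?ff//; exact: loc_test_integrable.
Qed.

Definition cL2 (f : R -> R[i]) := L2fun (fun x => Re (f x)) /\ L2fun (fun x => Im (f x)).

Lemma cL2_cloc f : cL2 f -> cloc f.
Proof. by move=> [/L2_loc ? /L2_loc ?]; split. Qed.

Lemma locD (f g : R -> R) : locally_integrable setT f -> locally_integrable setT g ->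
  locally_integrable setT (fun x => f x + g x).
Proof.
move=> lf lg; apply: loc_integrableP => [|a b]; first by apply: measurable_funD; [case: lf|case: lg].
by apply: integrable_EFinD; [exact: measurable_itv|exact: loc_integrable_itv|exact: loc_integrable_itv].
Qed.

Lemma locN (f : R -> R) : locally_integrable setT f -> locally_integrable setT (fun x => - f x).
Proof.
move=> lf; apply: loc_integrableP => [|a b]; first by apply: measurableT_comp => //; case: lf.
by apply: integrable_EFinN; [exact: measurable_itv|exact: loc_integrable_itv].
Qed.

Lemma cloc_M (f g : R -> R[i]) : cL2 f -> cL2 g -> cloc (fun x => f x * g x).
Proof.
move=> [f1 f2] [g1 g2]; split.
  under eq_fun do rewrite ReM; apply: locD; first exact: loc_L2M.
  by apply: locN; exact: loc_L2M.
by under eq_fun do rewrite ImM; apply: locD; exact: loc_L2M.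
Qed.

Lemma weak_derivative_sq (f f1 f2 : R -> R[i]) : @has_bump R -> cL2 f -> cL2 f1 -> cloc f2 ->
  weak_derivative f f1 -> weak_derivative f1 f2 ->
  weak_derivative (fun x => f x * f x) (fun x => f x * f1 x + f x * f1 x).
Proof.
move=> bump Lf Lf1 [l2 l2'] /weak_derivativeP[w1 w1'] /weak_derivativeP[w2 w2'].
have [La Lb] := Lf; have [La1 Lb1] := Lf1; have [la lb] := cL2_cloc Lf; have [la1 lb1] := cL2_cloc Lf1.
have aa := weak_diffM bump la la1 l2 la la1 l2 w1 w2 w1 w2.
have bb := weak_diffM bump lb lb1 l2' lb lb1 l2' w1' w2' w1' w2'.
have ab := weak_diffM bump la la1 l2 lb lb1 l2' w1 w2 w1' w2'.
have laa := loc_L2M La La; have lbb := loc_L2M Lb Lb; have lab := loc_L2M La Lb.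
have laa1 := locD (loc_L2M La1 La) (loc_L2M La La1).
have lbb1 := locD (loc_L2M Lb1 Lb) (loc_L2M Lb Lb1).
have lab1 := locD (loc_L2M La1 Lb) (loc_L2M La Lb1).
apply/weak_derivativeP; split.
  have := weak_diffD laa laa1 (locN lbb) (locN lbb1) aa (weak_diffN lbb lbb1 bb).
  congr weak_diff; apply/funext => x; rewrite ?ReD ?ReM//; ring.
have := weak_diffD lab lab1 lab lab1 ab ab.
congr weak_diff; apply/funext => x; rewrite ?ImD ?ImM//; ring.
Qed.

Lemma ctest_integrable f (psi : R -> R) : cloc f -> smooth_compact_support psi ->
  cintegrable mu setT (fun x => f x * (psi x)%:C).
Proof.
move=> [l1 l2] tpsi; split.
  by under eq_fun do rewrite /= ReM/= mulr0 subr0; exact: loc_test_integrable.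
by under eq_fun do rewrite /= ImM/= mulr0 add0r; exact: loc_test_integrable.
Qed.

End WeakProducts.

(** * Time integrals against test functions *)

Section CumulativeFubini.
Context {R : realType}.
Notation mu := (@lebesgue_measure R).
Local Open Scope complex_scope.
Notation Re := complex.Re.
Notation Im := complex.Im.

(** The integrand of both iterated integrals in the exchange below, extended to the
    plane. *)
Definition window (t : R) (psi : R -> R) (f : R * R -> R) p : R := \1_`[0, t] p.1 * (f p * psi p.2).

Definition strip_integrable t psi f := (mu \x mu)%E.-integrable setT (EFin \o window t psi f).

Lemma measurable_window t psi f : measurable_fun setT f -> measurable_fun setT psi ->
  measurable_fun setT (window t psi f).
Proof.
move=> mf mpsi.
have mI : measurable_fun setT (fun p : R * R => \1_`[0, t] p.1 : R).
  by apply: (measurableT_comp (measurable_indic _)) => //; exact: measurable_itv.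
apply: measurable_funM => //; apply: measurable_funM => //.
exact: (measurableT_comp mpsi).
Qed.

Lemma strip_integrable_sq t psi f : sqint f -> smooth_compact_support psi -> strip_integrable t psi f.
Proof.
move=> [mf f2] tpsi.
have mpsi : measurable_fun setT psi by apply: measurable_continuous; exact: test_continuous.
have i2 : mu.-integrable setT (EFin \o (fun x => psi x * psi x)).
  exact: (loc_test_integrable (continuous_loc (test_continuous tpsi)) tpsi).
have iI : mu.-integrable setT (EFin \o (\1_`[0, t] : R -> R)) by exact: integrable_indic_itv.
have ib := integrable_EFinD measurableT f2 (integrable_tensor iI i2).
apply: (le_integrableR _ _ _ ib) => //; first exact: measurable_window.
move=> p _; rewrite /window /= indicE; case: (_ \in _); rewrite ?mul1r ?mul0r.
  have := sqr_ge0 (f p - psi p.2); have := sqr_ge0 (f p + psi p.2).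
  by rewrite ler_norml => h1 h2; apply/andP; split; have := sqr_ge0 (f p); have := sqr_ge0 (psi p.2); nra.
by rewrite normr0 addr0 sqr_ge0.
Qed.

Lemma strip_integrableM t psi f g : sqint f -> sqint g -> smooth_compact_support psi ->
  strip_integrable t psi (fun p => f p * g p).
Proof.
move=> [mf f2] [mg g2] tpsi.
have mpsi : measurable_fun setT psi by apply: measurable_continuous; exact: test_continuous.
have [M [C [_ _ hC]]] := test_bound tpsi.
have ib := integrable_EFinZ C measurableT (integrable_EFinD measurableT f2 g2).
apply: (le_integrableR _ _ _ ib) => //.
  by apply: measurable_window => //; exact: measurable_funM.
move=> p _; have C0 : 0 <= C by exact: le_trans (hC 0).
have s0 : 0 <= f p ^+ 2 + g p ^+ 2 by rewrite addr_ge0// sqr_ge0.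
rewrite /window indicE; case: (_ \in _); last by rewrite mul0r normr0 mulr_ge0.
rewrite mul1r normrM mulrC ler_pM//.
have := sqr_ge0 (f p - g p); have := sqr_ge0 (f p + g p).
by rewrite ler_norml => h1 h2; apply/andP; split; have := sqr_ge0 (f p); have := sqr_ge0 (g p); nra.
Qed.

Lemma strip_integrableD t psi f g : strip_integrable t psi f -> strip_integrable t psi g ->
  strip_integrable t psi (fun p => f p + g p).
Proof.
move=> fi gi; have := integrable_EFinD measurableT fi gi.
by congr (integrable _ _ _); apply/funext => p; rewrite /= /window; congr EFin; ring.
Qed.

Lemma strip_integrableZ t psi k f : strip_integrable t psi f -> strip_integrable t psi (fun p => k * f p).
Proof.
move=> fi; have := integrable_EFinZ k measurableT fi.
by congr (integrable _ _ _); apply/funext => p; rewrite /= /window; congr EFin; ring.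
Qed.

Lemma Rintegral_window t (f : R -> R) : \int[mu]_s (\1_`[0, t] s * f s) = \int[mu]_(s in `[0, t]) f s.
Proof.
rewrite [RHS]Rintegral_mkcond; apply: Rintegral_congr => s _.
by rewrite patchE indicE; case: ifP => _; rewrite ?mul1r ?mul0r.
Qed.

(** Dividing by psi x where it is nonzero recovers the integrability of f in time
    from that of the window. *)
Lemma cumulative_fubini t psi f : measurable_fun setT f -> measurable_fun setT psi ->
  strip_integrable t psi f ->
  mu.-integrable setT (EFin \o (fun x => (\int[mu]_(s in `[0, t]) f (s, x)) * psi x)) /\
  \int[mu]_x ((\int[mu]_(s in `[0, t]) f (s, x)) * psi x) =
  \int[mu]_(s in `[0, t]) \int[mu]_x (f (s, x) * psi x).
Proof.
move=> mf mpsi iw.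
have ae : {ae mu, forall x, [set: R] x -> \int[mu]_s window t psi f (s, x) = (\int[mu]_(s in `[0, t]) f (s, x)) * psi x}.
  apply: ae_mono (ae_integrable2 iw) _ => x ix _; rewrite Rintegral_window.
  have [p0|p0] := eqVneq (psi x) 0.
    rewrite [psi x]p0 mulr0; apply: Rintegral_eq0 => s _.
    exact: mulr0.
  have ix' : mu.-integrable setT (EFin \o (fun s => (psi x)^-1 * window t psi f (s, x))) by exact: integrable_EFinZ.
  have ixT : mu.-integrable `[0, t] (EFin \o (fun s => (psi x)^-1 * window t psi f (s, x))).
    by apply: integrableS ix' => //; exact: measurable_itv.
  have ix0 : mu.-integrable `[0, t] (EFin \o (fun s => f (s, x))).
    apply: eq_integrable ixT => // s; rewrite inE /window /= => sT; rewrite indicE mem_set// mul1r.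
    by rewrite mulrC mulfK.
  have Z := @RintegralZr _ _ _ mu `[0, t]%classic (fun s => f (s, x)) (psi x) (measurable_itv _) ix0.
  exact: Z.
have i2 := integrable_Rfubini2 iw.
have m2 : measurable_fun setT (fun x => (\int[mu]_(s in `[0, t]) f (s, x)) * psi x).
  by apply: measurable_funM => //; exact: (measurable_section1 t (measurable_cumulative mf)).
split.
  apply: (ae_le_integrableR _ _ _ (integrable_norm i2)) => //.
  by apply: ae_mono ae _ => x <-.
have m1 := integrable_measurable i2.
rewrite -(ae_eq_Rintegral measurableT m1 m2 ae) -Rintegral_fubini// -Rintegral_window.
apply: Rintegral_congr => s _; rewrite /window /= indicE.
case: (_ \in _); first by rewrite mul1r; apply: Rintegral_congr => x _; rewrite mul1r.
by rewrite mul0r; apply: Rintegral_eq0 => x _; rewrite mul0r.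
Qed.

End CumulativeFubini.
(** * The equation for the potential *)

Section IntegratedEquation.
Context {R : realType}.
Notation mu := (@lebesgue_measure R).
Local Open Scope complex_scope.
Notation Re := complex.Re.
Notation Im := complex.Im.

Definition csqint (f : R * R -> R[i]) := sqint (fun p => Re (f p)) /\ sqint (fun p => Im (f p)).

Lemma csqint_measurable f : csqint f -> cmeasurable_fun setT f.
Proof. by move=> [[m1 _] [m2 _]]; split. Qed.

Definition cstrip_integrable t psi (f : R * R -> R[i]) :=
  strip_integrable t psi (fun p => Re (f p)) /\ strip_integrable t psi (fun p => Im (f p)).

Lemma cstrip_integrable_sq t psi f : csqint f -> smooth_compact_support psi -> cstrip_integrable t psi f.
Proof. by move=> [f1 f2] tpsi; split; exact: strip_integrable_sq. Qed.

Lemma cstrip_integrableM t psi f g : csqint f -> csqint g -> smooth_compact_support psi ->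
  cstrip_integrable t psi (fun p => f p * g p).
Proof.
move=> [f1 f2] [g1 g2] tpsi; split.
  rewrite (_ : (fun p => _) = fun p => Re (f p) * Re (g p) + (-1) * (Im (f p) * Im (g p))).
    by apply: strip_integrableD; [|apply: strip_integrableZ]; exact: strip_integrableM.
  by apply/funext => p; rewrite ReM mulN1r.
rewrite (_ : (fun p => _) = fun p => Re (f p) * Im (g p) + Im (f p) * Re (g p)).
  by apply: strip_integrableD; exact: strip_integrableM.
by apply/funext => p; rewrite ImM.
Qed.

Lemma cstrip_integrableD t psi f g : cstrip_integrable t psi f -> cstrip_integrable t psi g ->
  cstrip_integrable t psi (fun p => f p + g p).
Proof.
move=> [f1 f2] [g1 g2]; split.
  by under eq_fun do rewrite ReD; exact: strip_integrableD.
by under eq_fun do rewrite ImD; exact: strip_integrableD.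
Qed.

Lemma cstrip_integrableZ t psi (k : R) f : cstrip_integrable t psi f ->
  cstrip_integrable t psi (fun p => k%:C * f p).
Proof.
move=> [f1 f2]; split.
  rewrite (_ : (fun p => _) = fun p => k * Re (f p)); first exact: strip_integrableZ.
  by apply/funext => p; rewrite ReM/= mul0r subr0.
rewrite (_ : (fun p => _) = fun p => k * Im (f p)); first exact: strip_integrableZ.
by apply/funext => p; rewrite ImM/= mul0r addr0.
Qed.

Lemma ccumulative_fubini t psi f : cmeasurable_fun setT f -> smooth_compact_support psi ->
  cstrip_integrable t psi f ->
  cintegrable mu setT (fun x => cintegral mu `[0, t] (fun s => f (s, x)) * (psi x)%:C) /\
  cintegral mu setT (fun x => cintegral mu `[0, t] (fun s => f (s, x)) * (psi x)%:C) =
  cintegral mu `[0, t] (fun s => cintegral mu setT (fun x => f (s, x) * (psi x)%:C)).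
Proof.
move=> [f1 f2] tpsi [i1 i2].
have mpsi : measurable_fun setT psi by apply: measurable_continuous; exact: test_continuous.
have [j1 e1] := cumulative_fubini f1 mpsi i1; have [j2 e2] := cumulative_fubini f2 mpsi i2.
split.
  split; [move: j1|move: j2]; congr (integrable _ _ _); apply/funext => x; congr EFin.
    by rewrite ReM/= mulr0 subr0.
  by rewrite ImM/= mulr0 add0r.
apply: complex_eq.
  rewrite Re_cintegral_real; apply: etrans e1 _ => /=; apply: Rintegral_congr => s _.
  by rewrite -Re_cintegral_real.
rewrite Im_cintegral_real; apply: etrans e2 _ => /=; apply: Rintegral_congr => s _.
by rewrite -Im_cintegral_real.
Qed.

Lemma sqint_sections2 (f : R * R -> R) : sqint f ->
  {ae mu, forall x, L2fun (fun s => f (s, x))}.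
Proof.
move=> [mf f2]; apply: ae_mono (ae_integrable2 f2) _ => x fx; split => //.
exact: measurable_section2.
Qed.

Lemma cloc_cintegrable f (a b : R) : cloc f -> cintegrable mu `[a, b] f.
Proof. by move=> [l1 l2]; split; exact: loc_integrable_itv. Qed.

Section equation.
Variables (T t K : R) (z : R[i]) (Phi phi : R -> R[i]) (W0 W1 W2 : R * R -> R[i]).
Hypotheses (bump : @has_bump R) (tT : 0 < t < T).
Hypotheses (mPhi : cmeasurable_fun setT Phi) (lPhi : cloc Phi) (lphi : cloc phi)
  (dPhi : weak_derivative Phi phi).
Hypotheses (s0 : csqint W0) (s1 : csqint W1) (s2 : csqint W2).
Hypothesis slices : {ae mu, forall s, 0 < s < T ->
  weak_derivative (fun x => W0 (s, x)) (fun x => W1 (s, x)) /\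
  weak_derivative (fun x => W1 (s, x)) (fun x => W2 (s, x))}.
Hypothesis equation : {ae mu, forall x,
  W0 (t, x) + cintegral mu `[0, t] (fun s => W0 (s, x) * W1 (s, x)) =
  z * phi x + cintegral mu `[0, t] (fun s => W2 (s, x))}.

(** The time derivative of the Cole-Hopf potential. *)
Definition flow p : R[i] := W1 p + (- 2^-1)%:C * (W0 p * W0 p).
(** Minus the x-derivative of flow, that is W W_x - W_xx. *)
Definition source p : R[i] := W0 p * W1 p + (-1)%:C * W2 p.

Lemma flow_weak : {ae mu, forall s, 0 < s < T -> forall psi, smooth_compact_support psi ->
  cintegral mu setT (fun x => flow (s, x) * (derive1 psi x)%:C) =
  cintegral mu setT (fun x => source (s, x) * (psi x)%:C)}.
Proof.
have a0 := ae_and (sqint_slices s0.1) (sqint_slices s0.2).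
have a1 := ae_and (sqint_slices s1.1) (sqint_slices s1.2).
have a2 := ae_and (sqint_slices s2.1) (sqint_slices s2.2).
apply: ae_mono (ae_and (ae_and a0 a1) (ae_and a2 slices)) _.
move=> s [[L0 L1] [L2 sl]] sT psi tpsi; have [d0 d1] := sl sT.
have tp' := test_derive1 tpsi.
have C0 : cL2 (fun x => W0 (s, x)) by exact: L0.
have C1 : cL2 (fun x => W1 (s, x)) by exact: L1.
have l1 := cL2_cloc C1.
have l2 : cloc (fun x => W2 (s, x)) by apply: cL2_cloc; exact: L2.
have l00 := cloc_M C0 C0; have l01 := cloc_M C0 C1.
have dsq := weak_derivative_sq bump C0 C1 l2 d0 d1.
have I1' := ctest_integrable l1 tp'; have I00' := ctest_integrable l00 tp'.
have I01 := ctest_integrable l01 tpsi; have I2 := ctest_integrable l2 tpsi.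
have -> : (fun x => flow (s, x) * (derive1 psi x)%:C) = fun x => W1 (s, x) * (derive1 psi x)%:C +
    (- 2^-1)%:C * (W0 (s, x) * W0 (s, x) * (derive1 psi x)%:C).
  by apply/funext => x; rewrite /flow mulrDl -!mulrA.
have -> : (fun x => source (s, x) * (psi x)%:C) = fun x => W0 (s, x) * W1 (s, x) * (psi x)%:C +
    (- 1)%:C * (W2 (s, x) * (psi x)%:C).
  by apply/funext => x; rewrite /source mulrDl -!mulrA.
rewrite !(@cintegralD _ _ _ mu setT measurableT)//; try exact: (@cintegrableZ _ _ _ mu setT measurableT).
rewrite !(@cintegralZ _ _ _ mu setT measurableT)//.
rewrite d1// dsq//.
have -> : (fun x => (W0 (s, x) * W1 (s, x) + W0 (s, x) * W1 (s, x)) * (psi x)%:C) =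
   fun x => W0 (s, x) * W1 (s, x) * (psi x)%:C + W0 (s, x) * W1 (s, x) * (psi x)%:C.
  by apply/funext => x; rewrite mulrDl.
rewrite (@cintegralD _ _ _ mu setT measurableT)//.
move: (cintegral _ _ _) (cintegral _ _ _) => A B.
by apply: complex_eq; rewrite !(ReD, ImD, ReN, ImN, ReM, ImM)/=; field.
Qed.

(** Integrates Burgers' equation once in x: the equation in integrated form,
    tested with psi, is compared with the slicewise relation flow_weak through
    Fubini. *)
Lemma equation_weak_derivative :
  weak_derivative (fun x => z * Phi x + cintegral mu `[0, t] (fun s => flow (s, x))) (fun x => W0 (t, x)).
Proof.
move=> psi tpsi; have tp' := test_derive1 tpsi.
have m0 := csqint_measurable s0; have m1 := csqint_measurable s1; have m2 := csqint_measurable s2.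
have mflow : cmeasurable_fun setT flow.
  apply: (cmeasurableD m1); apply: (cmeasurableM (cmeasurable_cst _ _)); exact: (cmeasurableM m0 m0).
have msource : cmeasurable_fun setT source.
  apply: (cmeasurableD (cmeasurableM m0 m1)); exact: (cmeasurableM (cmeasurable_cst _ _) m2).
have iflow : cstrip_integrable t (derive1 psi) flow.
  apply: cstrip_integrableD; first exact: cstrip_integrable_sq.
  by apply: cstrip_integrableZ; exact: cstrip_integrableM.
have isource : cstrip_integrable t psi source.
  apply: cstrip_integrableD; first exact: cstrip_integrableM.
  by apply: cstrip_integrableZ; exact: cstrip_integrable_sq.
have [jf ef] := ccumulative_fubini mflow tp' iflow.
have [js es] := ccumulative_fubini msource tpsi isource.
have IP' := ctest_integrable lPhi tp'; have Ip := ctest_integrable lphi tpsi.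
have fs : cintegral mu `[0, t] (fun s => cintegral mu setT (fun x => flow (s, x) * (derive1 psi x)%:C)) =
    cintegral mu `[0, t] (fun s => cintegral mu setT (fun x => source (s, x) * (psi x)%:C)).
  have mt (g : R * R -> R[i]) (p : R -> R) : cmeasurable_fun setT g -> smooth_compact_support p ->
      cmeasurable_fun `[0, t] (fun s => cintegral mu setT (fun x => g (s, x) * (p x)%:C)).
    move=> mg tp.
    have mp : measurable_fun setT (fun q : R * R => p q.2).
      apply: (measurableT_comp _ measurable_snd) => //.
      by apply: measurable_continuous; exact: test_continuous.
    have [n1 n2] := cmeasurableM mg (cmeasurable_real mp).
    have k1 := measurable_Rintegral_param n1; have k2 := measurable_Rintegral_param n2.
    by split; [exact: measurable_funS k1|exact: measurable_funS k2].
  have e : {ae mu, forall s, `[0, t]%classic s ->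
      cintegral mu setT (fun x => flow (s, x) * (derive1 psi x)%:C) =
      cintegral mu setT (fun x => source (s, x) * (psi x)%:C)}.
    move: tT => /andP[t0 tT'].
    apply: ae_mono2 flow_weak (ae_neq 0) _ => s h sn; rewrite /= in_itv/= => /andP[s1' s2'].
    by apply: h => //; rewrite lt_neqAle eq_sym sn s1' (le_lt_trans s2' tT').
  have [g1 g2] := mt _ _ mflow tp'; have [h1 h2] := mt _ _ msource tpsi.
  by apply: complex_eq; apply: ae_eq_Rintegral; rewrite ?measurable_itv//;
    apply: ae_mono e _ => s h /h ->.
have W0E : {ae mu, forall x, [set: R] x ->
    z * (phi x * (psi x)%:C) + (-1)%:C * (cintegral mu `[0, t] (fun s => source (s, x)) * (psi x)%:C) =
    W0 (t, x) * (psi x)%:C}.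
  have b0 := ae_and (sqint_sections2 s0.1) (sqint_sections2 s0.2).
  have b1 := ae_and (sqint_sections2 s1.1) (sqint_sections2 s1.2).
  have b2 := ae_and (sqint_sections2 s2.1) (sqint_sections2 s2.2).
  apply: ae_mono (ae_and (ae_and b0 b1) (ae_and b2 equation)) _ => x [[L0 L1] [L2 eq]] _.
  have C0 : cL2 (fun s => W0 (s, x)) by exact: L0.
  have C1 : cL2 (fun s => W1 (s, x)) by exact: L1.
  have C2 : cL2 (fun s => W2 (s, x)) by exact: L2.
  have I01 := cloc_cintegrable 0 t (cloc_M C0 C1).
  have I2 := cloc_cintegrable 0 t (cL2_cloc C2).
  have mI : measurable (`[0, t]%classic : set (measurableTypeR R)) by exact: measurable_itv.
  have Z := @cintegralZ _ _ _ mu `[0, t]%classic mI (-1)%:C _ I2.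
  have D := @cintegralD _ _ _ mu `[0, t]%classic mI _ _ I01 (@cintegrableZ _ _ _ mu `[0, t]%classic mI (-1)%:C _ I2).
  rewrite [X in _ + _ * (X * _)](etrans D (congr1 _ Z)).
  have -> : W0 (t, x) = z * phi x + cintegral mu `[0, t] (fun s => W2 (s, x)) -
      cintegral mu `[0, t] (fun s => W0 (s, x) * W1 (s, x)) by rewrite -eq addrK.
  rewrite mulrA mulrA -mulrDl; congr (_ * _).
  move: (z * phi x) (cintegral _ _ _) (cintegral _ _ _) => A B C.
  by apply: complex_eq; rewrite !(ReD, ImD, ReN, ImN, ReM, ImM)/=; ring.
have mW0 : cmeasurable_fun setT (fun x => W0 (t, x) * (psi x)%:C).
  apply: (cmeasurableM (cmeasurable_slice t m0)); apply: cmeasurable_real.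
  by apply: measurable_continuous; exact: test_continuous.
have Iz := @cintegrableZ _ _ _ mu setT measurableT z _ Ip.
have Is := @cintegrableZ _ _ _ mu setT measurableT ((-1)%:C) _ js.
have [_ <-] := @cintegrable_ae _ _ _ mu setT measurableT _ _ (@cintegrableD _ _ _ mu setT measurableT _ _ Iz Is) mW0 W0E.
have RS := etrans (@cintegralD _ _ _ mu setT measurableT _ _ Iz Is) (f_equal2 +%R
  (@cintegralZ _ _ _ mu setT measurableT z _ Ip) (@cintegralZ _ _ _ mu setT measurableT (-1)%:C _ js)).
have -> : (fun x => (z * Phi x + cintegral mu `[0, t] (fun s => flow (s, x))) * (derive1 psi x)%:C) =
   fun x => z * (Phi x * (derive1 psi x)%:C) + cintegral mu `[0, t] (fun s => flow (s, x)) * (derive1 psi x)%:C.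
  by apply/funext => x; rewrite mulrDl -!mulrA.
have ZP := @cintegralZ _ _ _ mu setT measurableT z _ IP'.
have D := @cintegralD _ _ _ mu setT measurableT _ _ (@cintegrableZ _ _ _ mu setT measurableT z _ IP') jf.
have alg (a b : R[i]) : z * - a + b = - (z * a + (-1)%:C * b).
  by apply: complex_eq; rewrite !(ReD, ImD, ReN, ImN, ReM, ImM)/=; ring.
refine (etrans D _); refine (etrans (f_equal2 +%R ZP ef) _).
refine (etrans (f_equal2 (fun a b => z * a + b) (dPhi tpsi) (etrans fs (esym es))) _).
exact: etrans (alg _ _) (congr1 -%R (esym RS)).
Qed.

End equation.
End IntegratedEquation.

(** * The initial condition *)

Section InitialProfile.
Context {R : realType}.
Notation mu := (@lebesgue_measure R).
Local Open Scope complex_scope.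
Notation Re := complex.Re.
Notation Im := complex.Im.

(** A primitive of an integrable function is bounded by the integral of its
    absolute value. *)
Lemma bounded_primitive (f : R -> R) : smooth_compact_support f ->
  exists F : R -> R, [/\ forall x : R, derivable F x 1, forall x, derive1 F x = f x &
    exists K, forall x, `|F x| <= K].
Proof.
move=> tf; have cf := test_continuous tf; have lf := continuous_loc cf.
have [M [C [_ fM _]]] := test_bound tf.
have fi : mu.-integrable setT (EFin \o f) := compact_support_integrable cf fM.
have [F F0 FE] := primitive_exists lf.
exists F; split; [by move=> x; have [] := increment_derive cf FE x|by move=> x; have [] := increment_derive cf FE x|].
exists (\int[mu]_x `|f x|) => x.
have le (a b : R) : `|\int[mu]_(s in `[a, b]) f s| <= \int[mu]_x `|f x|.
  apply: le_trans (@le_normr_Rintegral _ _ _ mu `[a, b]%classic f (measurable_itv _) (loc_integrable_itv a b lf)) _.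
  apply: (@ge0_le_RintegralS _ _ _ mu `[a, b]%classic setT) => //.
  exact: (integrable_norm fi).
have [x0|x0] := leP 0 x.
  by have := le 0 x; rewrite -FE// F0 subr0.
by have := le x 0; rewrite -FE ?(ltW x0)// F0 sub0r normrN.
Qed.

Lemma complex_primitive (phi : R -> R[i]) : csmooth_compact_support phi ->
  exists Phi K, [/\ cmeasurable_fun setT Phi, cloc Phi, cloc phi, (forall x, cab (Phi x) <= K) &
    weak_derivative Phi phi].
Proof.
move=> [t1 t2].
have [F1 [d1 e1 [K1 b1]]] := bounded_primitive t1.
have [F2 [d2 e2 [K2 b2]]] := bounded_primitive t2.
have c1 := derivable_continuous d1; have c2 := derivable_continuous d2.
exists (fun x => F1 x +i* F2 x), (K1 + K2); split.
- by split; exact: measurable_continuous.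
- by split; exact: continuous_loc.
- by split; apply: continuous_loc; exact: test_continuous.
- by move=> x; rewrite /cab/= lerD.
- have key (F f : R -> R) (d : forall x : R, derivable F x 1) (e : forall x, derive1 F x = f x) :
      continuous f -> weak_diff F f.
    have -> : f = derive1 F by apply/funext => x; rewrite e.
    by move=> c; have W := C1_weak_diff d c.
  have k1 := key _ _ d1 e1 (test_continuous t1); have k2 := key _ _ d2 e2 (test_continuous t2).
  by apply/weak_derivativeP; split; [exact: k1|exact: k2].
Qed.

Lemma nonzero_bump (phi : R -> R[i]) : csmooth_compact_support phi -> (exists x, phi x != 0) -> @has_bump R.
Proof.
move=> [t1 t2] [x px]; have [r0|r0] := eqVneq (Re (phi x)) 0.
  exists (fun x => Im (phi x)); split => //; exists x; apply: contra px => /eqP i0.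
  by apply/eqP; exact: complex_eq.
by exists (fun x => Re (phi x)); split => //; exists x.
Qed.

Lemma constant_profile_zero (Phi phi : R -> R[i]) : @has_bump R -> csmooth_compact_support phi ->
  weak_derivative Phi phi -> weak_derivative Phi (fun=> 0) -> forall x, phi x = 0.
Proof.
move=> bump [t1 t2] d1 d0.
have c1 := test_continuous t1; have c2 := test_continuous t2.
have lphi : cloc phi by split; exact: continuous_loc.
have ae0 : {ae mu, forall x, phi x = 0}.
  apply: ctest_orthogonal_ae => // psi tpsi.
  have h := etrans (esym (d1 psi tpsi)) (d0 psi tpsi).
  have z0 : cintegral mu setT (fun x => (fun=> 0 : R[i]) x * (psi x)%:C) = 0.
    by apply: complex_eq; apply: Rintegral_eq0 => x _; rewrite mul0r.
  by move: h; rewrite z0 => /oppr_inj.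
have r1 : (fun x => Re (phi x)) = fun=> 0.
  by apply: continuous_ae_eq => //; [move=> x; exact: cvg_cst|apply: ae_mono ae0 _ => x ->].
have r2 : (fun x => Im (phi x)) = fun=> 0.
  by apply: continuous_ae_eq => //; [move=> x; exact: cvg_cst|apply: ae_mono ae0 _ => x ->].
by move=> x; apply: complex_eq; [exact: (congr1 (fun f => f x) r1)|exact: (congr1 (fun f => f x) r2)].
Qed.

Section initial_data.
Context d (Omega : measurableType d) (P : probability Omega R) (xi : nat -> {RV P >-> R}).
Hypothesis xi_gaussian : iid_standard_gaussian xi.
Variable phi : R -> R[i].
Hypothesis tphi : csmooth_compact_support phi.

Definition initial_coef := chaos_coef xi (fun w x => (xi 0%N w)%:C * phi x).

Lemma xi_basis_axis n w : xi_basis xi (axis n) w = hermite n (xi 0%N w) / Num.sqrt n`!%:R.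
Proof.
rewrite /xi_basis mfact_axis (big_fset_incl _ (finsupp_axis n)).
  by rewrite big_seq_fset1 axisE mul1n.
move=> k _; rewrite memNfinsupp => /eqP ->.
by rewrite /hermite expr0 mul1r /= -expRD mulNr subrr expR0.
Qed.

Lemma initial_coef_axis n x : initial_coef (axis n) x = (n == 1%N)%:R * phi x.
Proof.
have [hi hm] := @hermite_moment R _ _ P (xi 0%N) n (xi_gaussian.2 0%N).
set s : R := (Num.sqrt n`!%:R)^-1.
have sn : s * (n == 1%N)%:R = (n == 1%N)%:R.
  by rewrite /s; case: eqP => [->|_]; rewrite ?mulr0// (_ : 1`! = 1%N)// sqrtr1 invr1 mulr1.
have key (c : R) : \int[P]_w ((s * c) * (xi 0%N w * hermite n (xi 0%N w))) = (n == 1%N)%:R * c.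
  by rewrite RintegralZl// hm mulrAC sn.
have E w : (xi 0%N w)%:C * phi x * (xi_basis xi (axis n) w)%:C =
    (s * Re (phi x) * (xi 0%N w * hermite n (xi 0%N w))) +i*
    (s * Im (phi x) * (xi 0%N w * hermite n (xi 0%N w))).
  rewrite xi_basis_axis -/s; apply: complex_eq; rewrite !(ReM, ImM)/=; ring.
have N1 : ((n == 1%N)%:R : R[i]) = ((n == 1%N)%:R : R)%:C by case: (n == 1%N).
rewrite N1; apply: complex_eq; rewrite !(ReM, ImM)/= ?mul0r ?subr0 ?addr0 -key;
  by apply: Rintegral_congr => w _; rewrite E.
Qed.

Lemma initial_S_transform q rho l (z : R[i]) F0 :
  is_S_transform q rho l L2R initial_coef (on_axis z) F0 -> {ae mu, forall x, F0 x = z * phi x}.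
Proof.
move=> [_ _ [mF _] approx]; have [t1 t2] := tphi.
have mphi : cmeasurable_fun setT phi.
  by split; apply: measurable_continuous; exact: test_continuous.
have mD : cmeasurable_fun setT (fun x => F0 x - z * phi x).
  apply: (cmeasurableD mF); apply: cmeasurableN.
  exact: (cmeasurableM (cmeasurable_cst _ z) mphi).
have key : {ae mu, forall x, F0 x - z * phi x = 0}.
  apply: ae_zero_sqmod => // e e0; have [A0 hA0] := approx e e0.
  have [M hM] := sum_fset_axis (R := R) A0.
  have [A A0A sumA] := hM (maxn M 2) (leq_maxl _ _).
  have := hA0 A A0A; rewrite /= /L2_sqnorm => lt; apply/ltW.
  rewrite (_ : (\int[mu]_x _)%E = (\int[mu]_x (sqmod (F0 x - \sum_(a <- A) normalized_mpow (on_axis z) a * initial_coef a x))%:E)%E)//.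
  apply: eq_integral => x _; congr (sqmod (_ - _))%:E.
  rewrite sumA; last by move=> a an; rewrite normalized_off_axis ?mul0r.
  rewrite (bigD1_seq 1%N) ?iota_uniq//=; last by rewrite mem_index_iota/= leq_maxr.
  rewrite big1 => [|n n1].
    by rewrite normalized_on_axis initial_coef_axis eqxx mul1r (_ : 1`! = 1%N)// sqrtr1 invr1 mulr1 expr1 addr0.
  by rewrite initial_coef_axis (negbTE n1) mul0r mulr0.
by apply: ae_mono key _ => x /eqP; rewrite subr_eq0 => /eqP.
Qed.

End initial_data.
End InitialProfile.

(** * The equation for the power series *)

Section TimeIntegrals.
Context {R : realType}.
Notation mu := (@lebesgue_measure R).
Local Open Scope complex_scope.
Notation Re := complex.Re.
Notation Im := complex.Im.

Lemma Rintegral_time_ae (f h g : R -> R) (T t : R) : 0 < t < T ->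
  measurable_fun setT h -> measurable_fun setT g -> (forall s, 0 < s < T -> f s = h s) ->
  {ae mu, forall s, 0 < s < T -> h s = g s} ->
  \int[mu]_(s in `[0, t]) f s = \int[mu]_(s in `[0, t]) g s.
Proof.
move=> /andP[t0 tT] mh mg fh hg.
have mh' : measurable_fun (`]0, t[%classic : set R) h by exact: measurable_funS mh.
have mg' : measurable_fun (`]0, t[%classic : set R) g by exact: measurable_funS mg.
have fh' s : `]0, t[%classic s -> f s = h s.
  by rewrite /= in_itv/= => /andP[s0 st]; apply: fh; rewrite s0 (lt_trans st tT).
have mf' : measurable_fun (`]0, t[%classic : set R) f.
  by apply: eq_measurable_fun mh' => s /set_mem /fh' ->.
have op (k : R -> R) : measurable_fun (`]0, t[%classic : set R) k ->
    \int[mu]_(s in `[0, t]) k s = \int[mu]_(s in `]0, t[) k s.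
  by move=> mk; rewrite /Rintegral integral_itv_bndoo//; apply/measurable_EFinP.
rewrite (op f mf') (op g mg').
apply: etrans (@Rintegral_congr _ _ _ mu `]0, t[%classic f h fh') _.
apply: ae_eq_Rintegral => //.
apply: ae_mono hg _ => s e; rewrite /= in_itv/= => /andP[s0 st].
by apply: e; rewrite s0 (lt_trans st tT).
Qed.

Lemma cintegral_time_ae (f h g : R -> R[i]) (T t : R) : 0 < t < T ->
  cmeasurable_fun setT h -> cmeasurable_fun setT g -> (forall s, 0 < s < T -> f s = h s) ->
  {ae mu, forall s, 0 < s < T -> h s = g s} ->
  cintegral mu `[0, t] f = cintegral mu `[0, t] g.
Proof.
move=> tT [h1 h2] [g1 g2] fh hg; apply: complex_eq => /=.
  apply: (Rintegral_time_ae tT h1 g1) => [s /fh ->//|].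
  by apply: ae_mono hg _ => s e /e ->.
apply: (Rintegral_time_ae tT h2 g2) => [s /fh ->//|].
by apply: ae_mono hg _ => s e /e ->.
Qed.

Lemma cmeasurable_section2 (f : R * R -> R[i]) x : cmeasurable_fun setT f ->
  cmeasurable_fun setT (fun s => f (s, x)).
Proof. by move=> [m1 m2]; split; [exact: (measurable_section2 x m1)|exact: (measurable_section2 x m2)]. Qed.

(** The transformed solution and the power series agree almost everywhere on the
    strip, hence on almost every line in each direction; the restriction to times
    inside ]0, T[ matters because values elsewhere are arbitrary. *)
Lemma equation_transfer (T : R) (F : @jet_point R -> R[i]) (W : 'I_3 -> R * R -> R[i]) (F0 v : R -> R[i]) :
  members (L2H2 T) F -> (forall j, cmeasurable_fun setT (W j)) ->
  (forall j, {ae (mu \x mu)%E, forall p, in_time T p.1 -> F (j, p) = W j p}) ->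
  {ae mu, forall x, F0 x = v x} ->
  (forall t : R, 0 <= t <= T ->
     L2_eq (fun x => F (0, (t, x)) +
              cintegral mu `[0, t] (fun s => F (0, (s, x)) * F (1, (s, x))))
           (fun x => F0 x + cintegral mu `[0, t] (fun s => F (2%R, (s, x))))) ->
  {ae mu, forall t, 0 < t < T -> {ae mu, forall x,
     W 0 (t, x) + cintegral mu `[0, t] (fun s => W 0 (s, x) * W 1 (s, x)) =
     v x + cintegral mu `[0, t] (fun s => W 2%R (s, x))}}.
Proof.
move=> [mF _ _] mW FW F0v eqn.
pose Fh j p := if in_time T p.1 then F (j, p) else 0.
have mFh j : cmeasurable_fun setT (Fh j) by apply: cmeasurable_strip; exact: mF.
have sx j : {ae mu, forall x, {ae mu, forall s, 0 < s < T -> Fh j (s, x) = W j (s, x)}}.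
  apply: ae_mono (ae_product_slices2 (FW j)) _ => x hx; apply: ae_mono hx _ => s e sT.
  by have sT' : in_time T s by []; rewrite /Fh/= sT'; exact: e.
apply: ae_mono (ae_product_slices (FW 0)) _ => t ht tT.
have t0 : 0 <= t <= T by move/andP: tT => [a b]; rewrite !ltW.
have [_ _ E] := eqn t t0.
apply: ae_mono (ae_and (ae_and ht (ae_and E F0v)) (ae_and (sx 0) (ae_and (sx 1) (sx 2%R)))) _.
move=> x [[hW [e Fv]] [s0 [s1 s2]]].
have FhE j s : 0 < s < T -> F (j, (s, x)) = Fh j (s, x).
  by move=> sT; have sT' : in_time T s by []; rewrite /Fh/= sT'.
rewrite -hW// -Fv.
have c2 := @cintegral_time_ae _ _ _ T t tT (cmeasurable_section2 x (mFh 2%R)) (cmeasurable_section2 x (mW 2%R)) (FhE 2%R) s2.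
have c01 : cintegral mu `[0, t] (fun s => F (0, (s, x)) * F (1, (s, x))) =
    cintegral mu `[0, t] (fun s => W 0 (s, x) * W 1 (s, x)).
  apply: (@cintegral_time_ae _ (fun s => Fh 0 (s, x) * Fh 1 (s, x)) _ T t tT).
  - exact: (cmeasurableM (cmeasurable_section2 x (mFh 0)) (cmeasurable_section2 x (mFh 1))).
  - exact: (cmeasurableM (cmeasurable_section2 x (mW 0)) (cmeasurable_section2 x (mW 1))).
  - by move=> s sT; rewrite !FhE.
  - by apply: ae_mono2 s0 s1 _ => s a b sT; rewrite a// b.
exact: etrans (congr1 (fun a => F (0, (t, x)) + a) (esym c01)) (etrans e (congr1 (fun a => F0 x + a) c2)).
Qed.

End TimeIntegrals.

(** * Weak derivatives of the coefficients *)

Section StripSlices.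
Context {R : realType}.
Notation mu := (@lebesgue_measure R).
Local Open Scope complex_scope.
Variables (q : nat -> R) (T rho l : R) (u : mindex -> @jet_point R -> R[i]).
Hypothesis uS : chaos_space q (- rho) (- l) (L2H2 T) u.

Lemma cut_off_slice (j : 'I_3) (N : set (R * R)) : ((mu \x mu)%E N = 0)%E -> measurable N ->
  {ae mu, forall s, in_time T s -> forall n, {ae mu, forall x,
    cut_off N (strip_coef T u j) n (s, x) = ((Num.sqrt n`!%:R)^-1)%:C * u (axis n) (j, (s, x))}}.
Proof.
move=> N0 mN.
have notN : {ae (mu \x mu)%E, forall p, p \notin N}.
  exists N; split => // p /= h; apply: contrapT => pN; apply: h.
  by apply/negP => /set_mem.
apply: ae_mono (ae_product_slices notN) _ => s hs sT n; apply: ae_mono hs _ => x pN.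
by rewrite /cut_off (negbTE pN) /strip_coef /= sT.
Qed.

(** Each coefficient is a multiple of a member of L_2((0,T); H^2) off a null set. *)
Lemma strip_weak_slices (w : 'I_3 -> nat -> R * R -> R[i]) :
  (forall j, exists N, [/\ measurable N, ((mu \x mu)%E N = 0)%E & w j = cut_off N (strip_coef T u j)]) ->
  (forall j, majorized (w j)) ->
  {ae mu, forall s, 0 < s < T -> forall n,
    weak_derivative (fun x => w 0 n (s, x)) (fun x => w 1 n (s, x)) /\
    weak_derivative (fun x => w 1 n (s, x)) (fun x => w 2%R n (s, x))}.
Proof.
move=> wN Mw.
have co j : {ae mu, forall s, in_time T s -> forall n, {ae mu, forall x,
    w j n (s, x) = ((Num.sqrt n`!%:R)^-1)%:C * u (axis n) (j, (s, x))}}.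
  by have [N [mN N0 ->]] := wN j; exact: cut_off_slice.
have du : {ae mu, forall s, forall n, s \in `]0, T[ ->
    weak_derivative (fun x => u (axis n) (0, (s, x))) (fun x => u (axis n) (1, (s, x))) /\
    weak_derivative (fun x => u (axis n) (1, (s, x))) (fun x => u (axis n) (2%R, (s, x)))}.
  by apply: ae_all => n; have [/(_ (axis n))[_ + _]] := uS.
have lo := ae_and (majorized_cloc (Mw 0)) (ae_and (majorized_cloc (Mw 1)) (majorized_cloc (Mw 2%R))).
apply: ae_mono (ae_and (ae_and du lo) (ae_and (co 0) (ae_and (co 1) (co 2%R)))) _.
move=> s [[d [l0 [l1 l2]]] [c0 [c1 c2]]] sT n.
have sT' : in_time T s by [].
have [d01 d12] := d n (etrans (esym (in_timeE T s)) sT').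
have mu_ j : cmeasurable_fun setT (fun x => u (axis n) (j, (s, x))).
  have mS : cmeasurable_fun setT (fun p => if in_time T p.1 then u (axis n) (j, p) else 0).
    by apply: cmeasurable_strip; have [/(_ (axis n))[]] := uS.
  have := cmeasurable_slice s mS; congr cmeasurable_fun; apply/funext => x.
  by rewrite /= sT'.
have mw j : cmeasurable_fun setT (fun x => w j n (s, x)) by exact/cmeasurable_slice/(Mw j).1.
have c : (Num.sqrt n`!%:R : R)^-1 != 0 by rewrite invr_eq0 gt_eqF// sqrtr_gt0 ltr0n fact_gt0.
have D01 := weak_derivative_scaled_ae c (mu_ 0) (mu_ 1) (mw 0) (mw 1) (l0 n) (l1 n) (c0 sT' n) (c1 sT' n) d01.
have D12 := weak_derivative_scaled_ae c (mu_ 1) (mu_ 2%R) (mw 1) (mw 2%R) (l1 n) (l2 n) (c1 sT' n) (c2 sT' n) d12.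
by split; [exact: D01|exact: D12].
Qed.

End StripSlices.

(** * The potential at one parameter *)

Section ParameterEquation.
Context {R : realType}.
Notation mu := (@lebesgue_measure R).
Local Open Scope complex_scope.
Variables (T : R) (Phi phi : R -> R[i]) (w : 'I_3 -> nat -> R * R -> R[i]) (z : R[i]).
Hypotheses (bump : @has_bump R) (lPhi : cloc Phi) (lphi : cloc phi) (dPhi : weak_derivative Phi phi).
Hypothesis Mw : forall j, majorized (w j).
Hypothesis slices : {ae mu, forall s, 0 < s < T -> forall n,
    weak_derivative (fun x => w 0 n (s, x)) (fun x => w 1 n (s, x)) /\
    weak_derivative (fun x => w 1 n (s, x)) (fun x => w 2%R n (s, x))}.

(** The sums inherit the slicewise weak derivatives of the coefficients, and flow is the
    sum of the series of the cflux. *)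
Lemma full_height_weak_derivative (t : R) : 0 < t < T ->
  {ae mu, forall x, wsum (w 0) z (t, x) +
     cintegral mu `[0, t] (fun s => wsum (w 0) z (s, x) * wsum (w 1) z (s, x)) =
     z * phi x + cintegral mu `[0, t] (fun s => wsum (w 2%R) z (s, x))} ->
  weak_derivative (full_height Phi (w 0) (w 1) z t) (fun x => wsum (w 0) z (t, x)).
Proof.
move=> tT eqn.
have sq j : csqint (wsum (w j) z) by have [a b] := sqint_wsum z (Mw j); split.
have sl : {ae mu, forall s, 0 < s < T ->
    weak_derivative (fun x => wsum (w 0) z (s, x)) (fun x => wsum (w 1) z (s, x)) /\
    weak_derivative (fun x => wsum (w 1) z (s, x)) (fun x => wsum (w 2%R) z (s, x))}.
  have s01 := slice_wsum z (Mw 0) (Mw 1); have s12 := slice_wsum z (Mw 1) (Mw 2%R).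
  apply: ae_mono (ae_and slices (ae_and s01 s12)) _ => s [h [a b]] sT.
  by split; [apply: a => n|apply: b => n]; have [] := h sT n.
have D := equation_weak_derivative bump tT lPhi lphi dPhi (sq 0) (sq 1) (sq 2%R) sl eqn.
have -> : full_height Phi (w 0) (w 1) z t =
    fun x => z * Phi x + cintegral mu `[0, t] (fun s => flow (wsum (w 0) z) (wsum (w 1) z) (s, x)).
  apply/funext => x; rewrite /full_height; congr (_ + cintegral _ _ _); apply/funext => s.
  by have [_ ->] := flux_series (Mw 0) (Mw 1) z (s, x); rewrite /flow expr2.
by move=> psi tpsi; exact: D.
Qed.

End ParameterEquation.

Local Open Scope complex_scope.

Theorem theorem3p2 (R : realType) (d : measure_display)
    (Omega : measurableType d) (P : probability Omega R)
    (xi : nat -> {RV P >-> R})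
    (xi_gaussian : iid_standard_gaussian xi) (xi_generating : generating xi)
    (q : nat -> R) (q_weights : weight_sequence q)
    (T : R) (T_gt0 : 0 < T)
    (phi : R -> R[i]) (phi_smooth : csmooth_compact_support phi)
    (phi_neq0 : exists x, phi x != 0) :
  ~ exists (rho l : R) (u : mindex -> jet_point -> R[i]),
      [/\ 0 <= rho < 1, 0 < l,
          chaos_space q (- rho) (- l) (L2H2 T) u &
          strong_chaos_solution q T
            (chaos_coef xi (fun w x => (xi 0%N w)%:C * phi x)) u].
Proof.
move=> [rho [l [u [rho01 l_gt0 uS [l1 [_ [r [l2 [r0 l20 sol]]]]]]]]].
have q1 : 1 < q 0%N by case: q_weights.
have bump := nonzero_bump phi_smooth phi_neq0.
have [Phi [K [mPhi lPhi lphi PhiK dPhi]]] := complex_primitive phi_smooth.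
have /choice[N hN] := strip_coef_majorized q1 rho01 uS.
pose w j := cut_off (N j) (strip_coef T u j).
have Mw j : majorized (w j) by have [] := hN j.
have slices := strip_weak_slices uS (w := w)
  (fun j => let: And3 a b _ := hN j in ex_intro _ (N j) (And3 a b erefl)) Mw.
have [z [z0 z1 zc zK]] := small_parameters q1 r0 (ltW l20).
have sums : {ae lebesgue_measure, forall t, forall k, 0 < t < T ->
    weak_derivative (full_height Phi (w 0) (w 1) (z k)%:C t) (fun x => wsum (w 0) (z k)%:C (t, x))}.
  apply: ae_all => k; have [F [F0 [SF SF0 eqn]]] := sol _ (zK k).
  have FW j : {ae (lebesgue_measure \x lebesgue_measure)%E, forall p : R * R,
      in_time T p.1 -> F (j, p) = wsum (w j) (z k)%:C p}.
    by have [mN N0 _] := hN j; exact: (S_transform_axis mN N0 (Mw j) uS SF).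
  have mF : members (L2H2 T) F by case: SF.
  have F0z := initial_S_transform xi_gaussian phi_smooth SF0.
  have E := equation_transfer mF (fun j => cmeasurable_wsum (z k)%:C (Mw j)) FW F0z eqn.
  apply: ae_mono E _ => t e tT.
  exact: (full_height_weak_derivative bump lPhi lphi dPhi Mw slices tT (e tT)).
have heights : {ae lebesgue_measure, forall t, 0 < t < T -> forall n,
    weak_derivative (cheight Phi (w 0) (w 1) n t) (fun x => w 0 n (t, x))}.
  apply: ae_mono2 (heights_from_sums T mPhi PhiK (Mw 0) (Mw 1) z0 z1 zc) sums _ => t h s tT.
  by apply: h => // k; exact: s.
have d0 := initial_profile_constant bump T_gt0 mPhi PhiK (Mw 0) (Mw 1) (Mw 2%R) slices heights.
have [x /eqP] := phi_neq0; apply.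
exact: constant_profile_zero bump phi_smooth dPhi d0 x.
Qed.
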